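(* Fix a constant $E<0$. Consider the space $M_E^+$ of all vectors $\boldsymbol\pi\in\mathbb{R}^3$ such that $\boldsymbol\pi\cdot\boldsymbol\pi>2E$, together with a single improper point $\boldsymbol\pi=\infty$. Then $M_E^+$ possesses one and only one Riemannian metric $ds^2$ such that the arc-length parameter $\int ds$ along any circle (or line) $t\mapsto\boldsymbol\pi(t)$ associated with a Kepler orbit on $S^3$ with $H-\tfrac12|\boldsymbol\mu|^2=E$ is precisely equal to the parameter $\int \frac{dt}{q_0|\boldsymbol q|}$. This metric is smooth and complete, with constant curvature $-2E$, and its geodesics are precisely the circles or lines $t\mapsto\boldsymbol\pi(t)$ associated with Kepler orbits (with this value of $E$).
   Context: Notation: $\langle\cdot,\cdot\rangle$ is the Euclidean inner product on $\mathbb{R}^4$; $\cdot$, $\times$, $|\cdot|$ are the dot product, cross product and norm on $\mathbb{R}^3$. Write $q=(q_0,\boldsymbol q)$, $v=(v_0,\boldsymbol v)\in\mathbb{R}\times\mathbb{R}^3$, and $TS^3=\{(q,v): \langle q,q\rangle=1,\ \langle q,v\rangle=0\}$. Fix $\gamma>0$. The Kepler problem on $S^3$ is the Hamiltonian system on $\{(q,v)\in TS^3: q_0\neq\pm1\}$ with Hamiltonian $H(q,v)=\frac12\langle v,v\rangle-\gamma\frac{q_0}{(1-q_0^2)^{1/2}}$ and symplectic form the restriction of $\sum_{i=0}^3 dq_i\wedge dv_i$; its equations of motion are $$\dot q=v,\qquad \dot v=\frac{\gamma e_0}{(1-q_0^2)^{3/2}}-\Big(\langle v,v\rangle+\gamma\frac{q_0}{(1-q_0^2)^{3/2}}\Big)q,\qquad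 e_0=(1,0,0,0).$$ Along an orbit $(q(t),v(t))$ set $\boldsymbol\mu=\boldsymbol q\times\boldsymbol v$ and $\boldsymbol\pi=q_0\boldsymbol v-v_0\boldsymbol q$. The quantity $E=H-\frac12|\boldsymbol\mu|^2=\frac12|\boldsymbol\pi|^2-\gamma\frac{q_0}{(1-q_0^2)^{1/2}}$ is constant along orbits; if $E<0$ then $q_0>0$ along the orbit. As $(q(t),v(t))$ runs over a Kepler orbit, $\boldsymbol\pi(t)$ moves along a circle in $\mathbb{R}^3$ if $\boldsymbol\mu\ne0$, or along a line (through the origin) if $\boldsymbol\mu=0$; these are the circles or lines ''associated with Kepler orbits'', lines being regarded as completed by the point $\infty$. The smooth structure of $M_E^+$ near $\infty$ is given by the inverted coordinate $\boldsymbol w=\boldsymbol\pi/|\boldsymbol\pi|^2$, with $\boldsymbol w=0$ corresponding to $\boldsymbol\pi=\infty$. *)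

(* Defs.v *)
From mathcomp Require Import all_boot all_order all_algebra.
From mathcomp Require Import all_classical all_reals all_analysis.
Set Implicit Arguments.
Unset Strict Implicit.
Unset Printing Implicit Defensive.
Import Order.TTheory GRing.Theory Num.Theory.
Import numFieldNormedType.Exports.
Local Open Scope classical_set_scope.
Local Open Scope ring_scope.

(** * Euclidean geometry *)

Section Euclid.
Variable R : realType.

Definition dot n (u v : 'rV[R]_n) : R := \sum_(i < n) u 0 i * v 0 i.

(* The library norm on 'rV[R]_n is the sup norm. *)
Definition enorm n (u : 'rV[R]_n) : R := Num.sqrt (dot u u).

(* Index arithmetic is modulo 3. *)
Definition cross (u v : 'rV[R]_3) : 'rV[R]_3 :=
  \row_(k < 3) (u 0 (k + 1) * v 0 (k + 2%:R) - u 0 (k + 2%:R) * v 0 (k + 1)).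

End Euclid.

(** * The Kepler problem on the 3-sphere *)

Section Kepler.
Variables (R : realType) (gamma : R).
Implicit Types (q v : 'rV[R]_4) (I J : set R).

Definition scal q : R := q 0 0.
Definition vect q : 'rV[R]_3 := \row_(i < 3) q 0 (lift ord0 i).
Definition e0 : 'rV[R]_4 := delta_mx 0 0.

Definition phase_space q v : Prop :=
  [/\ dot q q = 1, dot q v = 0, scal q != 1 & scal q != -1].

Definition hamiltonian q v : R :=
  2^-1 * dot v v - gamma * (scal q / Num.sqrt (1 - scal q ^+ 2)).

Definition mu_vec q v : 'rV[R]_3 := cross (vect q) (vect v).
Definition pi_vec q v : 'rV[R]_3 := scal q *: vect v - scal v *: vect q.

Definition kepler_energy q v : R :=
  hamiltonian q v - 2^-1 * dot (mu_vec q v) (mu_vec q v).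

Definition acceleration q v : 'rV[R]_4 :=
  let r3 := Num.sqrt (1 - scal q ^+ 2) ^+ 3 in
  (gamma / r3) *: e0 - (dot v v + gamma * (scal q / r3)) *: q.

Definition kepler_orbit I (q v : R -> 'rV[R]_4) : Prop :=
  [/\ open I, is_interval I, I !=set0 &
   forall t, I t ->
     [/\ phase_space (q t) (v t),
         is_derive t (1 : R) q (v t) &
         is_derive t (1 : R) v (acceleration (q t) (v t))]].

Definition maximal_kepler_orbit I (q v : R -> 'rV[R]_4) : Prop :=
  kepler_orbit I q v /\
  forall J (q' v' : R -> 'rV[R]_4), kepler_orbit J q' v' -> I `<=` J ->
    (forall t, I t -> q' t = q t /\ v' t = v t) -> J `<=` I.

Definition has_energy (E : R) I (q v : R -> 'rV[R]_4) : Prop :=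
  forall t, I t -> kepler_energy (q t) (v t) = E.

(* The circle, or line completed by [None] = infinity, swept out by pi. *)
Definition hodograph I (q v : R -> 'rV[R]_4) : set (option 'rV[R]_3) :=
  [set x | (exists2 t, I t & x = Some (pi_vec (q t) (v t))) \/
           (x = None /\ forall t, I t -> mu_vec (q t) (v t) = 0)].

End Kepler.

(** * The manifold M_E^+ and its two charts *)

Inductive chart_name := affine | inverted.

Section Manifold.
Variables (R : realType) (E : R).

(* [None] is the improper point. *)
Definition extended_space : Type := option 'rV[R]_3.

Definition MEplus : set extended_space :=
  [set x | if x is Some p then 2 * E < dot p p else True].

Definition inversion (p : 'rV[R]_3) : 'rV[R]_3 := (dot p p)^-1 *: p.

Definition chart_dom (b : chart_name) : set extended_space :=
  match b with
  | affine => [set x | x <> None]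
  | inverted => [set x | x <> Some 0]
  end.

(* Only meaningful on [chart_dom b]. *)
Definition chart (b : chart_name) (x : extended_space) : 'rV[R]_3 :=
  match b, x with
  | affine, Some p => p
  | inverted, Some p => inversion p
  | _, None => 0
  end.

Definition chart_image (b : chart_name) : set 'rV[R]_3 :=
  chart b @` (MEplus `&` chart_dom b).

(** * Riemannian metrics, given by their matrices in the two charts *)

Definition local_metrics : Type := chart_name -> 'rV[R]_3 -> 'M[R]_3.

Definition inner (G : 'rV[R]_3 -> 'M[R]_3) (p u v : 'rV[R]_3) : R :=
  (u *m G p *m v^T) 0 0.

(* Only continuity is required, so that smoothness of the metric is a genuine
   conclusion and uniqueness holds among all continuous metrics.  The last
   clause says that the metric in the affine chart is the pull-back of the one
   in the inverted chart; recall that 'D_u f p = u *m 'J f p. *)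
Definition riemannian_metric (g : local_metrics) : Prop :=
  [/\ forall b p, chart_image b p -> {for p, continuous (g b)},
      forall b p, chart_image b p -> (g b p)^T = g b p,
      forall b p, chart_image b p ->
        forall u, u != 0 -> 0 < inner (g b) p u u &
      forall p, chart_image affine p -> p != 0 ->
        g affine p = 'J inversion p *m g inverted (inversion p)
                       *m ('J inversion p)^T].

Definition metric_eq (g g' : local_metrics) : Prop :=
  forall b p, chart_image b p -> g b p = g' b p.

Definition basis_vec (i : 'I_3) : 'rV[R]_3 := delta_mx 0 i.

Definition pderiv (i : 'I_3) (f : 'rV[R]_3 -> R) : 'rV[R]_3 -> R :=
  fun p => 'D_(basis_vec i) f p.

Fixpoint Ck_on (k : nat) (U : set 'rV[R]_3) (f : 'rV[R]_3 -> R) : Prop :=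
  (forall p, U p -> {for p, continuous f}) /\
  if k is k'.+1 then
    forall i, (forall p, U p -> derivable f p (basis_vec i)) /\
              Ck_on k' U (pderiv i f)
  else True.

Definition smooth_metric (g : local_metrics) : Prop :=
  forall b i j k, Ck_on k (chart_image b) (fun p => g b p i j).

Section LocalFormulas.
Variable G : 'rV[R]_3 -> 'M[R]_3.
Implicit Types (p u v w : 'rV[R]_3) (i j k l m : 'I_3).

(* Gamma^k_(ij), the Christoffel symbols of the Levi-Civita connection. *)
Definition christoffel k i j p : R :=
  2^-1 * \sum_(l < 3) invmx (G p) k l *
    (pderiv i (fun x => G x j l) p + pderiv j (fun x => G x i l) p
     - pderiv l (fun x => G x i j) p).

(* R(d_i, d_j) d_k = \sum_l (riemann_coef l k i j) d_l, with the convention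
   R(X, Y) Z = nabla_X nabla_Y Z - nabla_Y nabla_X Z - nabla_[X, Y] Z. *)
Definition riemann_coef l k i j p : R :=
  pderiv i (christoffel l j k) p - pderiv j (christoffel l i k) p
  + \sum_(m < 3) (christoffel l i m p * christoffel m j k p
                  - christoffel l j m p * christoffel m i k p).

Definition riemann p u v w : 'rV[R]_3 :=
  \row_(l < 3) \sum_(i < 3) \sum_(j < 3) \sum_(k < 3)
    riemann_coef l k i j p * u 0 i * v 0 j * w 0 k.

Definition sectional_curvature p u v : R :=
  inner G p (riemann p u v v) u /
  (inner G p u u * inner G p v v - inner G p u v ^+ 2).

End LocalFormulas.

Definition constant_curvature (g : local_metrics) (K : R) : Prop :=
  forall b p, chart_image b p -> forall u v : 'rV[R]_3,
    row_free (col_mx u v) -> sectional_curvature (g b) p u v = K.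

(** * Geodesics *)

Definition geodesic_on (g : local_metrics) (J : set R)
    (c : R -> extended_space) : Prop :=
  forall t, J t -> MEplus (c t) /\
  forall b, chart_dom b (c t) ->
    let x := chart b \o c in
    [/\ \forall s \near t, chart_dom b (c s) /\ derivable x s 1,
        derivable (derive1 x) t 1 &
        forall k, derive1 (derive1 x) t 0 k +
          \sum_(i < 3) \sum_(j < 3)
            christoffel (g b) k i j (x t) * derive1 x t 0 i * derive1 x t 0 j = 0].

(* Geodesic completeness: every geodesic extends to the whole real line. *)
Definition complete_metric (g : local_metrics) : Prop :=
  forall (J : set R) c, open J -> is_interval J -> J !=set0 ->
    geodesic_on g J c ->
    exists2 c', geodesic_on g setT c' & forall t, J t -> c' t = c t.

(* Nonconstant geodesic defined for all times. *)
Definition full_geodesic (g : local_metrics) (c : R -> extended_space) : Prop :=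
  geodesic_on g setT c /\ exists s t, c s <> c t.

(** * Relation with the Kepler problem *)

(* Kepler orbits stay in the affine chart, where pi lives. *)
Definition arclength_is_kepler_time (gamma : R) (g : local_metrics) : Prop :=
  forall (I : set R) (q v : R -> 'rV[R]_4),
    kepler_orbit gamma I q v -> has_energy gamma E I q v ->
    let p := fun t => pi_vec (q t) (v t) in
    forall t1 t2, I t1 -> I t2 -> t1 <= t2 ->
    (\int[lebesgue_measure]_(t in `[t1, t2])
        (Num.sqrt (inner (g affine) (p t) (derive1 p t) (derive1 p t)))%:E =
     \int[lebesgue_measure]_(t in `[t1, t2])
        ((scal (q t) * enorm (vect (q t)))^-1)%:E)%E.

(* [c] and the completed circle or line t |-> pi(t) are the same curve up to
   an orientation-preserving change of parameter. *)
Definition same_curve (I : set R) (q v : R -> 'rV[R]_4)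
    (c : R -> extended_space) : Prop :=
  hodograph I q v = range c /\
  exists s : R -> R, forall t, I t ->
    [/\ derivable s t 1, 0 < derive1 s t & c (s t) = Some (pi_vec (q t) (v t))].

Definition geodesics_are_kepler_circles (gamma : R) (g : local_metrics) : Prop :=
  (forall c, full_geodesic g c ->
     exists I q v, [/\ maximal_kepler_orbit gamma I q v,
                       has_energy gamma E I q v & same_curve I q v c]) /\
  (forall I q v, maximal_kepler_orbit gamma I q v -> has_energy gamma E I q v ->
     exists2 c, full_geodesic g c & same_curve I q v c).

End Manifold.

(* Main.v *)
Require Import Defs.
From mathcomp Require Import all_boot all_order all_algebra.
From mathcomp Require Import all_classical all_reals all_analysis.
From mathcomp Require Import ring lra.
Set Implicit Arguments.
Unset Strict Implicit.
Unset Printing Implicit Defensive.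
Import Order.TTheory GRing.Theory Num.Theory.
Import numFieldNormedType.Exports.
Local Open Scope classical_set_scope.
Local Open Scope ring_scope.

(** Put [a = - 2 E > 0]. Along a Kepler orbit of energy [E] the vector [pi]
    satisfies [d pi / dt = - gamma / r ^ 3 * q] with [r = |q|] (the spatial part
    of the position), and the energy relation reads
    [|pi| ^ 2 + a = 2 gamma q_0 / r]. Hence [|d pi / dt| = gamma / r ^ 2], and the
    ratio of the Kepler parameter [dt / (q_0 r)] to the Euclidean arc length
    [|d pi|] is [2 / (|pi| ^ 2 + a)], which depends on [pi] only. So the only
    possible metric is [4 |d pi| ^ 2 / (|pi| ^ 2 + a) ^ 2], the round metric of
    curvature [a] in stereographic coordinates; in the inverted chart it becomes
    [4 |d w| ^ 2 / (1 + a |w| ^ 2) ^ 2] ([spherical_metric]). Both expressions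
    have the form [4 / (al + be |x| ^ 2) ^ 2] with [al * be = a], and smoothness,
    curvature and the geodesic equation are treated for this form.

    Geodesics. Stereographic projection from the ellipsoid
    [y_0 ^ 2 + a |y| ^ 2 = 1], which is the unit sphere up to a linear change of
    coordinates and has rational formulas, turns the geodesic equation in both
    charts into the linear equation [Y'' = - kap Y] with [kap] constant
    ([great_circle_geodesic], [geodesic_lift_derivatives]). Its solutions are
    explicit and live for all time, which gives completeness
    ([geodesic_extends]).

    Kepler orbits. On the energy surface, [y_0 = 1 - a r / (gamma q_0)] and
    [y = r / (gamma q_0) * pi]; in the time [s] with [dt = q_0 r ds] the pair
    satisfies [Y'' = - a Y] ([der_lift_y0] and its companions), and a
    position and velocity of the great circle determine those of the Kepler
    orbit, by rational formulas and one square root ([kepler_pos],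
    [kepler_vel]). Therefore no existence theorem for the Kepler flow is needed: a
    great circle is turned into an orbit by inverting the primitive [T] of
    [q_0 r] along it, and conversely every orbit is recovered from its circle by
    a linear uniqueness argument. The angular momentum vanishes exactly when the
    circle passes through the pole [y_0 = 1], the image of the improper point.
    Such orbits end in a collision there, where [q_0 = 1], and trace the circle
    up to the pole; all others traverse their circle infinitely often, since
    [q_0 r] is then bounded below. This determines the maximal orbits
    ([kepler_orbit_of_circle], [maximal_orbit_is_circle]) and identifies
    their hodographs with the geodesics.

    Uniqueness. Every unit vector at every point is tangent to the hodograph of
    some orbit ([orbit_through]), and equality of the two integrals over all
    time intervals gives equality of their continuous integrands. So the
    quadratic form of the metric is determined in the affine chart, then in the
    inverted chart away from [0] by the change of charts, and at [0] by
    continuity ([metric_unique]). *)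

(** * Dot product *)

Section DotProduct.
Variables (R : realType) (n : nat).
Implicit Types (u v w : 'rV[R]_n) (a : R).

Lemma dotC u v : dot u v = dot v u.
Proof. by apply: eq_bigr => i _; rewrite mulrC. Qed.

Lemma dotDl u v w : dot (u + v) w = dot u w + dot v w.
Proof. by rewrite -big_split; apply: eq_bigr => i _; rewrite mxE mulrDl. Qed.

Lemma dotZl a u w : dot (a *: u) w = a * dot u w.
Proof. by rewrite mulr_sumr; apply: eq_bigr => i _; rewrite mxE mulrA. Qed.

Lemma dotNl u w : dot (- u) w = - dot u w.
Proof. by rewrite -scaleN1r dotZl mulN1r. Qed.

Lemma dot0l w : dot 0 w = 0.
Proof. by rewrite -(scale0r 0) dotZl mul0r. Qed.

Lemma dotDr u v w : dot u (v + w) = dot u v + dot u w.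
Proof. by rewrite dotC dotDl !(dotC u). Qed.

Lemma dotZr a u w : dot u (a *: w) = a * dot u w.
Proof. by rewrite dotC dotZl dotC. Qed.

Lemma dotNr u w : dot u (- w) = - dot u w.
Proof. by rewrite dotC dotNl dotC. Qed.

Lemma dot0r w : dot w 0 = 0.
Proof. by rewrite dotC dot0l. Qed.

Definition dotE := (dotDl, dotDr, dotZl, dotZr, dotNl, dotNr, dot0l, dot0r).

Lemma dot_ge0 u : 0 <= dot u u.
Proof. by apply: sumr_ge0 => i _; rewrite -expr2 sqr_ge0. Qed.

Lemma dot_eq0 u : (dot u u == 0) = (u == 0).
Proof.
apply/idP/eqP => [|->]; last by rewrite dot0l.
rewrite psumr_eq0 => [/allP uu0|i _]; last by rewrite -expr2 sqr_ge0.
apply/rowP => i; have := uu0 i (mem_index_enum _).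
by rewrite mxE /= mulf_eq0 orbb => /eqP.
Qed.

Lemma dot_gt0 u : (0 < dot u u) = (u != 0).
Proof. by rewrite lt_def dot_ge0 andbT dot_eq0. Qed.

End DotProduct.

(** * Derivatives of curves, coordinate by coordinate *)

Section Derivatives.
Variable R : realType.

Section OneDirection.
Variables (V : normedModType R) (x v : V).
Implicit Types (f g : V -> R) (a b : R).

Lemma derD f g a b : is_derive x v f a -> is_derive x v g b ->
  is_derive x v (fun y => f y + g y) (a + b).
Proof. by move=> fa gb; exact: is_deriveD. Qed.

Lemma derN f a : is_derive x v f a -> is_derive x v (fun y => - f y) (- a).
Proof. by move=> fa; exact: is_deriveN. Qed.

Lemma derB f g a b : is_derive x v f a -> is_derive x v g b ->
  is_derive x v (fun y => f y - g y) (a - b).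
Proof. by move=> fa gb; apply: derD => //; exact: derN. Qed.

Lemma derM f g a b : is_derive x v f a -> is_derive x v g b ->
  is_derive x v (fun y => f y * g y) (a * g x + f x * b).
Proof.
move=> fa gb; have h := is_deriveM fa gb.
by apply: (is_derive_eq h); rewrite addrC [_ *: a]mulrC.
Qed.

Lemma derV f a : f x != 0 -> is_derive x v f a ->
  is_derive x v (fun y => (f y)^-1) (- a / f x ^+ 2).
Proof.
move=> f0 [df <-]; apply: DeriveDef; first exact: derivableV.
by rewrite deriveV // scaleNr mulNr mulrC.
Qed.

Lemma der_cst a : is_derive x v (fun=> a) 0.
Proof. exact: is_derive_cst. Qed.

Lemma der_eq (W : normedModType R) (f : V -> W) (a b : W) :
  is_derive x v f a -> a = b -> is_derive x v f b.
Proof. by move=> + <-. Qed.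

Lemma der_ext (W : normedModType R) (f g : V -> W) (a : W) :
  f =1 g -> is_derive x v f a -> is_derive x v g a.
Proof. by move=> /funext ->. Qed.

Lemma der_rowP n (u : V -> 'rV[R]_n) (d : 'rV[R]_n) :
  is_derive x v u d <-> forall i, is_derive x v (fun y => u y 0 i) (d 0 i).
Proof.
split=> [[du <-] i|h].
- by apply: DeriveDef; [move/derivable_mxP: du; apply|rewrite derive_mx // mxE].
- have du : derivable u x v.
    by apply/derivable_mxP => i j; rewrite (ord1 i); have [] := h j.
  apply: DeriveDef => //; rewrite derive_mx //; apply/rowP => i; rewrite mxE.
  by have [_ ->] := h i.
Qed.

Lemma derZv n f (u : V -> 'rV[R]_n) a (d : 'rV[R]_n) :
  is_derive x v f a -> is_derive x v u d ->
  is_derive x v (fun y => f y *: u y) (a *: u x + f x *: d).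
Proof.
move=> fa /der_rowP ud; apply/der_rowP => i.
apply: der_ext (der_eq (derM fa (ud i)) _) => [y|]; by rewrite !mxE.
Qed.

Lemma derDv n (u w : V -> 'rV[R]_n) (d e : 'rV[R]_n) :
  is_derive x v u d -> is_derive x v w e ->
  is_derive x v (fun y => u y + w y) (d + e).
Proof. by move=> ud we; exact: is_deriveD. Qed.

Lemma derNv n (u : V -> 'rV[R]_n) (d : 'rV[R]_n) :
  is_derive x v u d -> is_derive x v (fun y => - u y) (- d).
Proof. by move=> ud; exact: is_deriveN. Qed.

Lemma der_cstv n (d : 'rV[R]_n) : is_derive x v (fun=> d) 0.
Proof. exact: is_derive_cst. Qed.

Lemma der_sum n (f : 'I_n -> V -> R) (d : 'I_n -> R) :
  (forall i, is_derive x v (f i) (d i)) ->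
  is_derive x v (fun y => \sum_i f i y) (\sum_i d i).
Proof.
move=> h; have hs := is_derive_sum h.
by apply: der_ext hs => y; rewrite fct_sumE.
Qed.

Lemma der_dot n (u w : V -> 'rV[R]_n) (d e : 'rV[R]_n) :
  is_derive x v u d -> is_derive x v w e ->
  is_derive x v (fun y => dot (u y) (w y)) (dot d (w x) + dot (u x) e).
Proof.
move=> /der_rowP ud /der_rowP we.
rewrite /dot -big_split /=.
by apply: der_sum => i; exact: derM.
Qed.

End OneDirection.

Lemma der_cvg (V : normedModType R) (f : R -> V) (t : R) (d : V) :
  is_derive t 1 f d -> {for t, continuous f}.
Proof.
by move=> [df _]; apply: differentiable_continuous; apply/derivable1_diffP.
Qed.

Lemma der_comp (f g : R -> R) (t a b : R) :
  is_derive (g t) 1 f a -> is_derive t 1 g b ->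
  is_derive t 1 (fun s => f (g s)) (a * b).
Proof. exact: is_derive1_comp. Qed.

Lemma der_compv n (f : R -> 'rV[R]_n) (g : R -> R) (t b : R) (a : 'rV[R]_n) :
  is_derive (g t) 1 f a -> is_derive t 1 g b ->
  is_derive t 1 (fun s => f (g s)) (b *: a).
Proof.
move=> /der_rowP fa gb; apply/der_rowP => i.
by apply: der_eq (der_comp (fa i) gb) _; rewrite mxE mulrC.
Qed.

Lemma der_id (t : R) : is_derive t 1 (fun s : R => s) 1.
Proof. exact: is_derive_id. Qed.

Lemma derive1_der (V : normedModType R) (f : R -> V) (t : R) (d : V) :
  is_derive t 1 f d -> derive1 f t = d.
Proof. by move=> [_ <-]; rewrite derive1E. Qed.

Lemma der_derive1 (V : normedModType R) (f : R -> V) (t : R) :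
  derivable f t 1 -> is_derive t 1 f (derive1 f t).
Proof. by move=> df; rewrite derive1E; exact: derivableP. Qed.

Lemma der_unique (V W : normedModType R) (f : V -> W) (x v : V) (a b : W) :
  is_derive x v f a -> is_derive x v f b -> a = b.
Proof. by move=> [_ <-] [_ <-]. Qed.

Lemma der_near (V : normedModType R) (f g : R -> V) (t : R) (d : V) :
  (\forall s \near t, f s = g s) -> is_derive t 1 f d -> is_derive t 1 g d.
Proof. exact: near_eq_is_derive. Qed.

End Derivatives.

(** * One-variable calculus on intervals *)

Section Intervals.
Variable R : realType.
Implicit Types (I : set R) (f F : R -> R).

Lemma interval_between I a b t : is_interval I -> I a -> I b ->
  a <= t <= b -> I t.
Proof. by move=> /[apply]/[apply]; exact. Qed.

Lemma mvt_interval I F f a b : is_interval I ->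
  (forall t, I t -> is_derive t 1 F (f t)) -> I a -> I b -> a < b ->
  exists2 c, I c & F b - F a = f c * (b - a).
Proof.
move=> iI dF Ia Ib ab; have Iab t : a <= t <= b -> I t by exact: interval_between.
have [||c cab ->] := @MVT R F f a b ab.
- by move=> t; rewrite in_itv /= => /andP[at_ tb]; by apply/dF/Iab; rewrite !ltW.
- apply: derivable_within_continuous => t; rewrite in_itv /= => tab.
  by have [] := dF t (Iab t tab).
- by exists c => //; apply: Iab; move: cab; rewrite in_itv /= => /andP[/ltW -> /ltW].
Qed.

Lemma constant_on_interval I F : is_interval I ->
  (forall t, I t -> is_derive t 1 F 0) -> forall a b, I a -> I b -> F a = F b.
Proof.
move=> iI dF; suff h a b : I a -> I b -> a < b -> F a = F b.
  move=> a b Ia Ib; have [/h->//|/h->//|->//] := ltgtP a b.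
move=> Ia Ib ab; have [c _] := mvt_interval iI dF Ia Ib ab.
by rewrite mul0r => /eqP; rewrite subr_eq0 => /eqP.
Qed.

Lemma constant_on_interval_row I n (u : R -> 'rV[R]_n) : is_interval I ->
  (forall t, I t -> is_derive t 1 u 0) -> forall a b, I a -> I b -> u a = u b.
Proof.
move=> iI du a b Ia Ib; apply/rowP => i.
apply: (@constant_on_interval I (fun t => u t 0 i)) => // t It.
by have /der_rowP/(_ i) := du t It; rewrite mxE.
Qed.

Lemma increasing_on_interval I F f : is_interval I ->
  (forall t, I t -> is_derive t 1 F (f t)) -> (forall t, I t -> 0 < f t) ->
  forall a b, I a -> I b -> a < b -> F a < F b.
Proof.
move=> iI dF f0 a b Ia Ib ab; have [c Ic e] := mvt_interval iI dF Ia Ib ab.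
by rewrite -subr_gt0 e mulr_gt0 ?f0 // subr_gt0.
Qed.

Lemma open_itv_around I (t : R) : open I -> I t ->
  exists2 e : R, 0 < e & forall s, t - e <= s <= t + e -> I s.
Proof.
rewrite openE => /[apply] /nbhs_ballP[e /= e0 eI]; exists (e / 2).
  by rewrite divr_gt0.
move=> s /andP[h1 h2]; apply: eI; rewrite /ball /= distrC ltr_norml.
by apply/andP; split; lra.
Qed.

Lemma der_integral f a b t : a < t < b ->
  (forall s, a <= s <= b -> {for s, continuous f}) ->
  is_derive t 1 (fun x => \int[lebesgue_measure]_(s in `[a, x]) f s)%R (f t).
Proof.
move=> /andP[at_ tb] cf.
have fi : lebesgue_measure.-integrable `[a, b] (EFin \o f).
  apply: continuous_compact_integrable; first exact: segment_compact.
  apply: continuous_in_subspaceT => s; rewrite inE /= in_itv /=; exact: cf.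
have [] := @continuous_FTC1_closed R f a t b tb fi at_.
  by apply: cf; rewrite !ltW.
by move=> dF <-; exact: der_derive1.
Qed.

Lemma integrals_determine I f g : open I ->
  (forall t, I t -> {for t, continuous f}) ->
  (forall t, I t -> {for t, continuous g}) ->
  (forall t1 t2, I t1 -> I t2 -> t1 <= t2 ->
    (\int[lebesgue_measure]_(t in `[t1, t2]) (f t)%:E =
     \int[lebesgue_measure]_(t in `[t1, t2]) (g t)%:E)%E) ->
  forall t, I t -> f t = g t.
Proof.
move=> oI cf cg fg t It; have [e e0 eI] := open_itv_around oI It.
have te : t - e < t < t + e by apply/andP; split; lra.
apply: der_unique (der_integral te (fun s hs => cf s (eI s hs))) _.
apply: der_near (der_integral te (fun s hs => cg s (eI s hs))).
near=> x; congr fine; apply/esym/fg.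
- by apply: eI; apply/andP; split; lra.
- have /andP[] : t - e < x < t + e by near: x; apply: near_in_itvoo; rewrite in_itv.
  by move=> h1 h2; apply: eI; rewrite !ltW.
- have /andP[/ltW] : t - e < x < t + e by near: x; apply: near_in_itvoo; rewrite in_itv.
  by [].
Unshelve. all: by end_near. Qed.

(** Indefinite integrals taken over different compact pieces differ by constants;
    normalizing them to vanish at a common base point glues them. *)
Lemma primitive_on_interval I f : open I -> is_interval I ->
  (forall t, I t -> {for t, continuous f}) ->
  exists F, forall t, I t -> is_derive t 1 F (f t).
Proof.
move=> oI iI cf; have [[t0 It0]|/set0P/negP/negPn/eqP I0] := pselect (I !=set0);
  last by exists (fun=> 0) => t; rewrite I0.
have hG x : exists G, I x -> exists a b, [/\ a < t0 < b, a < x < b &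
    forall t, a < t < b -> I t /\ is_derive t 1 G (f t)].
  have [Ix|] := pselect (I x); last by exists (fun=> 0).
  have [e1 e10 h1] := open_itv_around oI It0.
  have [e2 e20 h2] := open_itv_around oI Ix.
  pose a := Num.min (t0 - e1) (x - e2); pose b := Num.max (t0 + e1) (x + e2).
  have at0 : a < t0 by rewrite /a gt_min; apply/orP; left; lra.
  have ax : a < x by rewrite /a gt_min; apply/orP; right; lra.
  have t0b : t0 < b by rewrite /b lt_max; apply/orP; left; lra.
  have xb : x < b by rewrite /b lt_max; apply/orP; right; lra.
  have Ia : I a.
    by rewrite /a /Num.min; case: ifP => _; [apply: h1|apply: h2]; lra.
  have Ib : I b.
    by rewrite /b /Num.max; case: ifP => _; [apply: h2|apply: h1]; lra.
  have Iab t : a <= t <= b -> I t by exact: interval_between.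
  exists (fun y => \int[lebesgue_measure]_(s in `[a, y]) f s)%R => _.
  exists a, b; split; rewrite ?at0 ?ax //.
  move=> t tab; split; first by apply: Iab; case/andP: tab => /ltW -> /ltW.
  by apply: (der_integral tab) => s sab; exact/cf/Iab.
have [G {}hG] := choice hG.
exists (fun x => G x x - G x t0) => x Ix.
have [a [b [t0ab xab dG]]] := hG x Ix.
have -> : f x = f x - 0 by rewrite subr0.
apply: (@der_near _ _ (fun y => G x y - G x t0)); last first.
  exact: derB (dG x xab).2 (der_cst _ _ _).
near=> y.
have yab : a < y < b.
  by near: y; apply: near_in_itvoo; rewrite in_itv.
have [Iy _] := dG y yab.
have [c [d [t0cd ycd dGy]]] := hG y Iy.
have iJ : is_interval [set t | (a < t < b) && (c < t < d)].
  move=> u v /= /andP[/andP[u1 u2] /andP[u3 u4]] /andP[/andP[v1 v2] /andP[v3 v4]] w.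
  by move=> /andP[uw wv]; apply/andP; split; apply/andP; split; lra.
have := constant_on_interval iJ (F := fun t => G x t - G y t).
move=> /(_ _ y t0); rewrite /= yab ycd t0ab t0cd => h.
suff : G x y - G y y = G x t0 - G y t0 by lra.
apply: h => // t /andP[tab tcd].
have -> : 0 = f t - f t by rewrite subrr.
exact: derB (dG t tab).2 (dGy t tcd).2.
Unshelve. all: by end_near. Qed.

Lemma inverse_on_interval I F f : open I -> is_interval I ->
  (forall t, I t -> is_derive t 1 F (f t)) -> (forall t, I t -> 0 < f t) ->
  exists g, [/\ open (F @` I), is_interval (F @` I),
    forall t, I t -> g (F t) = t &
    forall t, I t -> is_derive (F t) 1 g (f t)^-1].
Proof.
move=> oI iI dF f0.
have incF := increasing_on_interval iI dF f0.
have injF a b : I a -> I b -> F a = F b -> a = b.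
  move=> Ia Ib e; have [/(incF a b Ia Ib)|/(incF b a Ib Ia)|//] := ltgtP a b;
    by rewrite e ltxx.
pose g y := get [set t | I t /\ F t = y].
have gK t : I t -> g (F t) = t.
  move=> It; have [] : [set t' | I t' /\ F t' = F t] (g (F t)).
    by apply: (@getI _ _ t); split.
  by move=> Ig; exact: injF.
have iFI : is_interval (F @` I).
  move=> _ _ [a Ia <-] [b Ib <-] z zab.
  have leab : a <= b.
    rewrite leNgt; apply/negP => /(incF _ _ Ib Ia).
    by case/andP: zab; lra.
  have cF : {within `[a, b], continuous F}.
    apply: derivable_within_continuous => t; rewrite in_itv /= => tab.
    by have [] := dF t (interval_between iI Ia Ib tab).
  have [|t tab <-] := IVT leab cF (v := z).
    have Fab : F a <= F b by case/andP: zab; exact: le_trans.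
    by rewrite (min_idPl _) ?(max_idPr _).
  by exists t => //; apply: (interval_between iI Ia Ib); rewrite in_itv in tab.
have oFI : open (F @` I).
  rewrite openE => _ [t It <-].
  have [e e0 eI] := open_itv_around oI It.
  have I1 : I (t - e) by apply: eI; lra.
  have I2 : I (t + e) by apply: eI; lra.
  have F1 : F (t - e) < F t by apply: incF => //; lra.
  have F2 : F t < F (t + e) by apply: incF => //; lra.
  rewrite /interior; near=> y.
  have : F (t - e) < y < F (t + e).
    by near: y; apply: near_in_itvoo; rewrite in_itv /= F1.
  case/andP => /ltW y1 /ltW y2; apply: (iFI (F (t - e)) (F (t + e))).
  - by exists (t - e).
  - by exists (t + e).
  - by rewrite y1.
exists g; split=> // t It.
have nI : \forall s \near t, I s by move: oI; rewrite openE => /(_ t It).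
apply: is_derive_inverse; last by rewrite gt_eqF // f0.
- by near=> s; apply: gK; near: s.
- by near=> s; apply: (der_cvg (dF s _)); near: s.
- exact: dF.
Unshelve. all: by end_near. Qed.

End Intervals.

(** * The round metric in conformal charts *)

Section RationalFunctions.
Variables (R : realType) (al be : R).
Hypotheses (al0 : 0 < al) (be0 : 0 < be).
Implicit Types (p : 'rV[R]_3) (f g : 'rV[R]_3 -> R).

Definition conf_den p : R := al + be * dot p p.

Lemma conf_den_gt0 p : 0 < conf_den p.
Proof. by rewrite /conf_den ltr_wpDr // mulr_ge0 ?dot_ge0 // ltW. Qed.

Lemma conf_den_neq0 p : conf_den p != 0.
Proof. by rewrite gt_eqF // conf_den_gt0. Qed.

Lemma der_coord p i (j : 'I_3) :
  is_derive p (basis_vec R i) (fun x => x 0 j) (j == i)%:R.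
Proof.
have /der_rowP/(_ j) := is_derive_id p (basis_vec R i).
by rewrite /basis_vec mxE eqxx.
Qed.

Lemma der_conf_den p i :
  is_derive p (basis_vec R i) conf_den (2 * be * p 0 i).
Proof.
have did := is_derive_id p (basis_vec R i).
have dd := derD (der_cst p _ al) (derM (der_cst p _ be) (der_dot did did)).
apply: (der_eq dd); rewrite /basis_vec dotC.
have -> : dot p (delta_mx 0 i) = p 0 i.
  rewrite /dot (bigD1 i) //= big1 => [|j ji]; first by rewrite mxE !eqxx mulr1 addr0.
  by rewrite mxE (negPf ji) andbF mulr0.
ring.
Qed.

(** A class of functions closed under partial derivatives, which makes the
    smoothness of its members an induction. *)
Inductive conf_rational : ('rV[R]_3 -> R) -> Prop :=
| ConfCst c : conf_rational (fun=> c)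
| ConfCoord i : conf_rational (fun p => p 0 i)
| ConfInv : conf_rational (fun p => (conf_den p)^-1)
| ConfAdd f g : conf_rational f -> conf_rational g ->
    conf_rational (fun p => f p + g p)
| ConfMul f g : conf_rational f -> conf_rational g ->
    conf_rational (fun p => f p * g p).

Lemma conf_rational_der f : conf_rational f ->
  exists2 df : 'I_3 -> 'rV[R]_3 -> R, forall i, conf_rational (df i) &
    forall i p, is_derive p (basis_vec R i) f (df i p).
Proof.
elim=> {f} [c|j||f g cf [df cdf hf] cg [dg cdg hg]|f g cf [df cdf hf] cg [dg cdg hg]].
- by exists (fun _ _ => 0) => [i|i p]; [exact: ConfCst|exact: der_cst].
- exists (fun i _ => (j == i)%:R) => [i|i p]; first exact: ConfCst.
  exact: der_coord.
- exists (fun i p => (- (2 * be) * p 0 i) * ((conf_den p)^-1 * (conf_den p)^-1)).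
    by move=> i; do !apply: ConfMul; (exact: ConfCst || exact: ConfCoord || exact: ConfInv).
  move=> i p; apply: der_eq (derV (conf_den_neq0 p) (der_conf_den p i)) _.
  by field; exact: conf_den_neq0.
- exists (fun i p => df i p + dg i p) => [i|i p]; first exact: ConfAdd.
  exact: derD.
- exists (fun i p => df i p * g p + f p * dg i p) => [i|i p].
    by apply: ConfAdd; exact: ConfMul.
  exact: derM.
Qed.

Lemma conf_rational_differentiable f p : conf_rational f -> differentiable f p.
Proof.
have hd (p' : 'rV[R]_3) i : differentiable (fun x : 'rV[R]_3 => x 0 i) p'.
  exact: differentiable_coord.
elim=> {f} [c|j||f g cf hf cg hg|f g cf hf cg hg].
- exact: differentiable_cst.
- exact: hd.
- apply: differentiableV (conf_den_neq0 p).
  apply: differentiableD; first exact: differentiable_cst.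
  apply: differentiableM; first exact: differentiable_cst.
  rewrite (_ : (fun x => dot x x) = \sum_(i < 3) (fun x : 'rV[R]_3 => x 0 i * x 0 i)).
    by apply: differentiable_sum => i; exact: differentiableM.
  by apply/funext => x; rewrite fct_sumE.
- exact: differentiableD.
- exact: differentiableM.
Qed.

Lemma pderivE f (df : 'I_3 -> 'rV[R]_3 -> R) i :
  (forall p, is_derive p (basis_vec R i) f (df i p)) -> pderiv i f = df i.
Proof. by move=> h; apply/funext => p; have [_] := h p. Qed.

Lemma conf_rational_smooth k U f : conf_rational f -> Ck_on k U f.
Proof.
elim: k f => [|k IH] f cf; (split; first by move=> p _;
  exact/differentiable_continuous/conf_rational_differentiable) => // i.
have [df cdf hf] := conf_rational_der cf.
split; first by move=> p _; have [] := hf i p.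
by rewrite (@pderivE _ df) //; exact: IH.
Qed.

End RationalFunctions.

Section ConformalMetric.
Variables (R : realType) (al be : R).
Hypotheses (al0 : 0 < al) (be0 : 0 < be).
Implicit Types (p u v w : 'rV[R]_3) (i j k l : 'I_3).

Local Notation D := (conf_den al be).

Definition conf_factor p : R := 4 / D p ^+ 2.

Definition conf_metric p : 'M[R]_3 := (conf_factor p)%:M.

Let D0 p : D p != 0 := conf_den_neq0 al0 be0 p.

Lemma conf_factor_gt0 p : 0 < conf_factor p.
Proof. by rewrite divr_gt0 ?ltr0n // exprn_gt0 // conf_den_gt0. Qed.

Lemma conf_innerE p u v : inner conf_metric p u v = conf_factor p * dot u v.
Proof.
rewrite /inner /conf_metric mul_mx_scalar -scalemxAl !mxE; congr (_ * _).
by apply: eq_bigr => i _; rewrite !mxE.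
Qed.

Lemma conf_metric_continuous p : {for p, continuous conf_metric}.
Proof.
have -> : conf_metric = (fun x => conf_factor x *: (1%:M : 'M[R]_3)).
  by apply/funext => x; rewrite scalemx1.
apply: differentiable_continuous; apply: differentiableZl.
have -> : conf_factor = (fun x => 4 * ((D x)^-1 * (D x)^-1)).
  by apply/funext => x; rewrite /conf_factor expr2 invfM.
apply: (conf_rational_differentiable al0 be0).
exact: (ConfMul (ConfCst _ _ _) (ConfMul (ConfInv _ _) (ConfInv _ _))).
Qed.

Lemma conf_metric_smooth (n : nat) U i j : Ck_on n U (fun p => conf_metric p i j).
Proof.
apply: (conf_rational_smooth al0 be0).
have -> : (fun p => conf_metric p i j) =
    (fun x => (4 *+ (i == j)) * ((D x)^-1 * (D x)^-1)).
  apply/funext => x; rewrite mxE /conf_factor expr2 invfM.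
  by case: eqP => _; rewrite ?mulr1n ?mulr0n ?mul0r.
exact: (ConfMul (ConfCst _ _ _) (ConfMul (ConfInv _ _) (ConfInv _ _))).
Qed.

(** Half the gradient of the logarithm of [conf_factor]. *)
Definition log_grad i p : R := - (2 * be) * p 0 i / D p.

Let delta i j : R := (i == j)%:R.

Let deltaC i j : delta i j = delta j i.
Proof. by rewrite /delta eq_sym. Qed.

Lemma sum_delta (F : 'I_3 -> R) l : \sum_(m < 3) delta m l * F m = F l.
Proof.
rewrite (bigD1 l) //= big1 => [|m ml]; first by rewrite /delta eqxx mul1r addr0.
by rewrite /delta (negPf ml) mul0r.
Qed.

Lemma pderiv_conf_metric i j k p :
  pderiv i (fun x => conf_metric x j k) p = 2 * log_grad i p * conf_factor p * delta j k.
Proof.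
have dD := der_conf_den al be p i.
have D20 : D p * D p != 0 by rewrite mulf_neq0.
have := derM (der_cst p _ (4 * delta j k)) (derV (f := fun y => D y * D y) D20 (derM dD dD)).
have -> : (fun y : 'rV[R]_3 => 4 * delta j k / (D y * D y)) = (fun x => conf_metric x j k).
  by apply/funext => x; rewrite mxE /conf_factor /delta; case: eqP => _ /=; field.
by case=> _; rewrite /pderiv => ->; rewrite /log_grad /conf_factor; field.
Qed.

Lemma christoffelE k i j p :
  christoffel conf_metric k i j p =
  log_grad i p * delta j k + log_grad j p * delta i k - log_grad k p * delta i j.
Proof.
have c0 : conf_factor p != 0 by rewrite gt_eqF // conf_factor_gt0.
rewrite /christoffel {1}/conf_metric invmx_scalar.
have -> : \sum_(l < 3) (conf_factor p)^-1%:M k l * (pderiv i (fun x => conf_metric x j l) p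
    + pderiv j (fun x => conf_metric x i l) p - pderiv l (fun x => conf_metric x i j) p) =
  \sum_(l < 3) delta l k * (2 * (log_grad i p * delta j l + log_grad j p * delta i l
    - log_grad l p * delta i j)).
  apply: eq_bigr => l _; rewrite !pderiv_conf_metric mxE (deltaC l) /delta.
  by case: eqP => _ /=; field.
by rewrite sum_delta; field.
Qed.

Lemma der_log_grad i j p : is_derive p (basis_vec R i) (log_grad j)
  (log_grad i p * log_grad j p - 2 * be / D p * delta i j).
Proof.
have := derM (derM (der_cst p _ (- (2 * be))) (der_coord p i j))
             (derV (D0 p) (der_conf_den al be p i)).
move/der_eq; apply; rewrite /log_grad -/(delta _ _) (deltaC j); field; exact: D0.
Qed.

Lemma pderiv_christoffel m l i j p :
  pderiv m (christoffel conf_metric l i j) p =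
  let d a := log_grad m p * log_grad a p - 2 * be / D p * delta m a in
  d i * delta j l + d j * delta i l - d l * delta i j.
Proof.
rewrite /pderiv.
have -> : christoffel conf_metric l i j = (fun x => log_grad i x * delta j l
    + log_grad j x * delta i l - log_grad l x * delta i j).
  by apply/funext => x; rewrite christoffelE.
have dc a b c := derM (der_log_grad m a p) (der_cst p (basis_vec R m) (delta b c)).
have [_ ->] := derB (derD (dc i j l) (dc j i l)) (dc l i j).
by rewrite /= !mulr0 !addr0.
Qed.

(** Every contraction in the quadratic terms collapses to a Kronecker symbol or to
    the squared norm of [log_grad], and the latter is
    [4 * be / D - al * be * conf_factor] because [be * dot p p = D - al]. *)
Lemma riemann_coefE l k i j p :
  riemann_coef conf_metric l k i j p =
  al * be * conf_factor p * (delta j k * delta i l - delta i k * delta j l).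
Proof.
rewrite /riemann_coef !pderiv_christoffel /=.
pose c := fun a => log_grad a p.
have -> : \sum_(m < 3) (christoffel conf_metric l i m p * christoffel conf_metric m j k p
     - christoffel conf_metric l j m p * christoffel conf_metric m i k p) =
  \sum_(m < 3) delta m l * (c i * christoffel conf_metric m j k p
                          - c j * christoffel conf_metric m i k p)
  - \sum_(m < 3) delta m i * (c l * christoffel conf_metric m j k p)
  + \sum_(m < 3) delta m j * (c l * christoffel conf_metric m i k p)
  + delta i l * \sum_(m < 3) (c m * christoffel conf_metric m j k p)
  - delta j l * \sum_(m < 3) (c m * christoffel conf_metric m i k p).
  rewrite !mulr_sumr -!sumrN -!big_split /=; apply: eq_bigr => m _.
  rewrite !(christoffelE l) /c (deltaC i m) (deltaC j m); ring.
rewrite !sum_delta.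
have sumc a : \sum_(m < 3) (c m * christoffel conf_metric m a k p) =
    2 * c a * c k - delta a k * \sum_(m < 3) c m * c m.
  transitivity (\sum_(m < 3) (delta m k * (c m * c a) + delta m a * (c m * c k)
                 - delta a k * (c m * c m))).
    apply: eq_bigr => m _; rewrite christoffelE (deltaC k) (deltaC a m) /c; ring.
  rewrite !big_split /= !sum_delta sumrN -mulr_sumr; ring.
rewrite !sumc !christoffelE -/(c _) /c.
have -> : \sum_(m < 3) log_grad m p * log_grad m p = 4 * be / D p - al * be * conf_factor p.
  transitivity (\sum_(m < 3) ((2 * be / D p) ^+ 2 * (p 0 m * p 0 m))).
    by apply: eq_bigr => m _; rewrite /log_grad; field.
  rewrite -mulr_sumr -/(dot p p).
  have -> : dot p p = (D p - al) / be by rewrite /conf_den; field; rewrite gt_eqF.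
  by rewrite /conf_factor; field; rewrite D0 gt_eqF.
rewrite ?(deltaC j i) ?(deltaC k i) ?(deltaC l i) ?(deltaC k j) ?(deltaC l j) ?(deltaC l k).
field; exact: D0.
Qed.

Lemma riemannE p u v w : riemann conf_metric p u v w =
  (al * be * conf_factor p) *: (dot v w *: u - dot u w *: v).
Proof.
apply/rowP => l; rewrite !mxE; set K := al * be * conf_factor p.
have -> : \sum_(i < 3) \sum_(j < 3) \sum_(k < 3)
    riemann_coef conf_metric l k i j p * u 0 i * v 0 j * w 0 k =
  \sum_(i < 3) (delta i l * (K * dot v w * u 0 i)
     - K * v 0 l * (u 0 i * w 0 i)).
  apply: eq_bigr => i _.
  transitivity (\sum_(j < 3) (delta i l * K * u 0 i * (v 0 j * w 0 j)
     - delta j l * (K * u 0 i * w 0 i * v 0 j))).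
    apply: eq_bigr => j _.
    transitivity (\sum_(k < 3) (delta k j * (delta i l * K * u 0 i * v 0 j * w 0 k)
       - delta k i * (delta j l * K * u 0 i * v 0 j * w 0 k))).
      apply: eq_bigr => k _; rewrite riemann_coefE (deltaC j k) (deltaC i k) /K; ring.
    rewrite big_split sumrN /= !sum_delta; ring.
  rewrite big_split sumrN /= !sum_delta -mulr_sumr /dot; ring.
rewrite big_split sumrN /= !sum_delta -mulr_sumr /dot; ring.
Qed.

Lemma gram_neq0 u v : row_free (col_mx u v) ->
  dot u u * dot v v - dot u v ^+ 2 != 0.
Proof.
move=> fuv; apply/eqP => gram0.
have free a b : a *: u + b *: v = 0 -> a = 0 /\ b = 0.
  move=> h; have /eqP : row_mx a%:M b%:M *m col_mx u v = 0.
    by rewrite mul_row_col !mul_scalar_mx.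
  rewrite mulmx_free_eq0 // -row_mx0 => /eqP/eq_row_mx[/matrixP/(_ 0 0) + /matrixP/(_ 0 0)].
  by rewrite !mxE.
have /free[/eqP + _] : dot v v *: u + (- dot u v) *: v = 0.
  apply/eqP; rewrite -dot_eq0 !dotE (dotC v u); apply/eqP.
  transitivity (dot v v * (dot u u * dot v v - dot u v ^+ 2)); first ring.
  by rewrite gram0 mulr0.
rewrite dot_eq0 => /eqP v0; have [] := free 0 1.
  by rewrite v0 scale0r scaler0 addr0.
by move=> _ /eqP; rewrite oner_eq0.
Qed.

Lemma conf_metric_curvature p u v : row_free (col_mx u v) ->
  sectional_curvature conf_metric p u v = al * be.
Proof.
move=> /gram_neq0 guv; rewrite /sectional_curvature riemannE !conf_innerE !dotE.
rewrite (dotC v u); set c := conf_factor p; set G := _ - _ in guv.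
have c0 : c != 0 by rewrite gt_eqF // conf_factor_gt0.
have -> : c * dot u u * (c * dot v v) - (c * dot u v) ^+ 2 = c ^+ 2 * G.
  by rewrite /G; ring.
rewrite -[X in X / _](_ : al * be * (c ^+ 2 * G) = _); last by rewrite /G; ring.
by rewrite mulfK // mulf_neq0 // expf_neq0.
Qed.

Lemma geodesic_equationE p (u w : 'rV[R]_3) :
  (forall k, w 0 k + \sum_(i < 3) \sum_(j < 3)
     christoffel conf_metric k i j p * u 0 i * u 0 j = 0) <->
  w = (be / D p) *: (4 * dot p u *: u - 2 * dot u u *: p).
Proof.
have h k : \sum_(i < 3) \sum_(j < 3) christoffel conf_metric k i j p * u 0 i * u 0 j =
    - ((be / D p) *: (4 * dot p u *: u - 2 * dot u u *: p)) 0 k.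
  transitivity (\sum_(i < 3) (log_grad i p * u 0 i * u 0 k + delta i k *
      (u 0 i * \sum_(j < 3) (log_grad j p * u 0 j)) - log_grad k p * (u 0 i * u 0 i))).
    apply: eq_bigr => i _.
    transitivity (\sum_(j < 3) (delta j k * (log_grad i p * u 0 i * u 0 j)
       + delta i k * u 0 i * (log_grad j p * u 0 j)
       - delta j i * (log_grad k p * u 0 i * u 0 j))).
      apply: eq_bigr => j _; rewrite christoffelE (deltaC i j); ring.
    rewrite !big_split sumrN /= !sum_delta -mulr_sumr; ring.
  have sp : \sum_(i < 3) log_grad i p * u 0 i = - (2 * be) / D p * dot p u.
    by rewrite mulr_sumr; apply: eq_bigr => i _; rewrite /log_grad; field.
  rewrite !big_split sumrN /= !sum_delta -mulr_suml -mulr_sumr -/(dot u u) sp !mxE /log_grad.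
  by field.
split=> [e|-> k]; last by rewrite h addrN.
by apply/rowP => k; have := e k; rewrite h => /eqP; rewrite subr_eq0 => /eqP.
Qed.

End ConformalMetric.

(** * The candidate metric *)

Section Pullback.
Variables (R : realType).
Implicit Types p : 'rV[R]_3.

Lemma dot_inversion p : p != 0 -> dot (inversion p) (inversion p) = (dot p p)^-1.
Proof.
by rewrite -dot_eq0 => p0; rewrite /inversion !dotE; field.
Qed.

Lemma inversionK p : p != 0 -> inversion (inversion p) = p.
Proof.
move=> p0; rewrite {1}/inversion dot_inversion // invrK /inversion scalerA.
by rewrite divff ?scale1r // dot_eq0.
Qed.

Lemma inversion_neq0 p : p != 0 -> inversion p != 0.
Proof. by move=> p0; rewrite -dot_eq0 dot_inversion // invr_eq0 dot_eq0. Qed.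

Lemma inversion_differentiable p : p != 0 -> differentiable (@inversion R) p.
Proof.
move=> p0.
have -> : @inversion R =
    \sum_(i < 3) (fun x => ((dot x x)^-1 * x 0 i) *: (delta_mx 0 i : 'rV[R]_3)).
  apply/funext => x; rewrite fct_sumE.
  transitivity ((dot x x)^-1 *: \sum_(i < 3) x 0 i *: (delta_mx 0 i : 'rV[R]_3)).
    by rewrite -row_sum_delta.
  by rewrite scaler_sumr; apply: eq_bigr => i _; rewrite scalerA.
have hd (i : 'I_3) : differentiable (fun x : 'rV[R]_3 => x 0 i) p.
  exact: differentiable_coord.
apply: differentiable_sum => i; apply: differentiableZl.
apply: differentiableM => //; apply: differentiableV; last by rewrite dot_eq0.
rewrite (_ : (fun x => dot x x) = \sum_(i < 3) (fun x : 'rV[R]_3 => x 0 i * x 0 i)).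
  by apply: differentiable_sum => j; exact: differentiableM.
by apply/funext => x; rewrite fct_sumE.
Qed.

Lemma jacobian_inversion p : p != 0 -> 'J (@inversion R) p =
  (dot p p)^-1%:M - (2 / dot p p ^+ 2) *: (p^T *m p).
Proof.
move=> p0; have N0 : dot p p != 0 by rewrite dot_eq0.
apply/row_matrixP => i; rewrite rowE -deriveEjacobian; last exact: inversion_differentiable.
have did := is_derive_id p (delta_mx 0 i : 'rV[R]_3).
have [_ ->] := derZv (derV (f := fun x => dot x x) N0 (der_dot did did)) did.
have -> : dot (delta_mx 0 i) p = p 0 i.
  rewrite /dot (bigD1 i) //= big1 => [|j ji].
    by rewrite mxE !eqxx mul1r addr0.
  by rewrite mxE (negPf ji) andbF mul0r.
have -> : dot p (delta_mx 0 i) = p 0 i.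
  rewrite dotC /dot (bigD1 i) //= big1 => [|j ji].
    by rewrite mxE !eqxx mul1r addr0.
  by rewrite mxE (negPf ji) andbF mul0r.
apply/rowP => j; rewrite !mxE big_ord1 !mxE eqxx /= eq_sym.
by case: eqP => _ /=; field.
Qed.

(** The Jacobian of the inversion is the inverse square of the norm times a
    reflection. *)
Lemma jacobian_inversion_conformal p : p != 0 ->
  'J (@inversion R) p *m ('J (@inversion R) p)^T = ((dot p p)^-1 ^+ 2)%:M.
Proof.
move=> p0; have N0 : dot p p != 0 by rewrite dot_eq0.
rewrite jacobian_inversion //; set P := p^T *m p; set N := dot p p.
have PT : P^T = P by rewrite /P trmx_mul trmxK.
have PP : P *m P = N *: P.
  rewrite /P mulmxA -(mulmxA _ p) [N *: _]scalemxAl -mul_mx_scalar; congr (_ *m _ *m _).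
  by apply/matrixP => i j; rewrite !ord1 !mxE eqxx; apply: eq_bigr => k _; rewrite !mxE.
have -> : (N^-1%:M - (2 / N ^+ 2) *: P)^T = N^-1%:M - (2 / N ^+ 2) *: P.
  by apply/matrixP => i j; rewrite -[in RHS]PT !mxE eq_sym.
rewrite mulmxBl !mulmxBr.
rewrite -scalar_mxM -!scalemxAr -!scalemxAl PP mul_scalar_mx mul_mx_scalar !scalerA.
by clearbody P; apply/matrixP => i j; rewrite !mxE; case: eqP => _ /=; field.
Qed.

End Pullback.

Section SphericalMetric.
Variables (R : realType) (E : R).
Hypothesis hE : E < 0.

Definition curv : R := - (2 * E).

Lemma curv_gt0 : 0 < curv.
Proof. by rewrite /curv oppr_gt0 pmulr_rlt0 // ltr0n. Qed.

(** Coefficients of the conformal denominator, and orientation of the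
    stereographic projection, in each chart: the inverted chart is the
    projection from the opposite pole, rescaled. *)
Definition chart_al (b : chart_name) : R := if b is affine then curv else 1.
Definition chart_be (b : chart_name) : R := if b is affine then 1 else curv.
Definition chart_sg (b : chart_name) : R := if b is affine then 1 else -1.

Lemma chart_al_gt0 b : 0 < chart_al b.
Proof. by case: b; rewrite //= curv_gt0. Qed.

Lemma chart_be_gt0 b : 0 < chart_be b.
Proof. by case: b; rewrite //= curv_gt0. Qed.

Lemma chart_albe b : chart_al b * chart_be b = curv.
Proof. by case: b; rewrite /= ?mulr1 ?mul1r. Qed.

Definition spherical_metric : local_metrics R :=
  fun b => conf_metric (chart_al b) (chart_be b).

Lemma spherical_metric_riemannian : riemannian_metric E spherical_metric.
Proof.
split=> [b p _|b p _|b p _ u u0|p _ p0].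
- exact: conf_metric_continuous (chart_al_gt0 b) (chart_be_gt0 b) p.
- by rewrite /spherical_metric /conf_metric tr_scalar_mx.
- rewrite conf_innerE mulr_gt0 ?dot_gt0 // conf_factor_gt0 ?chart_al_gt0 //.
  exact: chart_be_gt0.
- rewrite /spherical_metric /conf_metric mul_mx_scalar -scalemxAl.
  rewrite jacobian_inversion_conformal // scale_scalar_mx; congr (_%:M).
  rewrite /conf_factor /conf_den dot_inversion //= mul1r.
  have N0 : 0 < dot p p by rewrite dot_gt0.
  have a0 := curv_gt0; rewrite /curv in a0 *.
  by field; rewrite !gt_eqF // addr_gt0.
Qed.

Lemma spherical_metric_smooth : smooth_metric E spherical_metric.
Proof.
move=> b i j k; rewrite /spherical_metric.
by apply: conf_metric_smooth; [exact: chart_al_gt0|exact: chart_be_gt0].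
Qed.

Lemma spherical_metric_curvature : constant_curvature E spherical_metric (- (2 * E)).
Proof.
move=> b p _ u v fuv; rewrite -/curv -(chart_albe b).
exact: conf_metric_curvature (chart_al_gt0 b) (chart_be_gt0 b) _ _ _ fuv.
Qed.

End SphericalMetric.

(** * Stereographic projection *)

Section Stereographic.
Variables (R : realType) (E : R).
Hypothesis hE : E < 0.
Implicit Types (p y v : 'rV[R]_3) (x : extended_space R).

Local Notation a := (curv E).
Local Notation al := (chart_al E).
Local Notation be := (chart_be E).
Local Notation sg := (@chart_sg R).
Let a0 : 0 < a := curv_gt0 hE.

(** A unit sphere with the last three coordinates scaled so that all formulas are
    rational in the curvature. *)
Definition on_ellipsoid (y0 : R) y : Prop := y0 ^+ 2 + a * dot y y = 1.

Definition height x : R :=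
  if x is Some p then (dot p p - a) / (dot p p + a) else 1.

Definition horizontal x : 'rV[R]_3 :=
  if x is Some p then (2 / (dot p p + a)) *: p else 0.

(** The center [(1, 0)] of the projection corresponds to the improper point. *)
Definition stereo (y0 : R) y : extended_space R :=
  if y0 == 1 then None else Some ((a / (1 - y0)) *: y).

Lemma norm_den_gt0 p : 0 < dot p p + a.
Proof. by rewrite ltr_wpDl // dot_ge0. Qed.

Lemma height_on_ellipsoid x : on_ellipsoid (height x) (horizontal x).
Proof.
rewrite /on_ellipsoid; case: x => [p|] /=; last by rewrite dot0l; ring.
by rewrite !dotE; field; rewrite gt_eqF // norm_den_gt0.
Qed.

Lemma height_horizontalK x : stereo (height x) (horizontal x) = x.
Proof.
rewrite /stereo; case: x => [p|] /=; last by rewrite eqxx.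
have N0 := norm_den_gt0 p.
have h : 1 - (dot p p - a) / (dot p p + a) = 2 * a / (dot p p + a).
  by field; rewrite gt_eqF.
case: eqP => [e|_].
  have : 0 < 2 * a / (dot p p + a) by rewrite divr_gt0 // mulr_gt0.
  by rewrite -h e subrr ltxx.
congr Some; rewrite h scalerA -[RHS]scale1r; congr (_ *: _).
by field; rewrite !gt_eqF.
Qed.

Lemma chart_height b x : chart_dom b x ->
  let D := conf_den (al b) (be b) (chart b x) in
  height x = sg b * (1 - 2 * al b / D) /\ horizontal x = (2 / D) *: chart b x.
Proof.
case: b; case: x => [p|] //= px; rewrite /conf_den.
- have N0 := norm_den_gt0 p; rewrite !mul1r (addrC a); split=> //.
  by field; rewrite gt_eqF.
- have p0 : p != 0 by apply/eqP => p0; apply: px; rewrite p0.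
  have N0 := norm_den_gt0 p.
  have pp0 : 0 < dot p p by rewrite dot_gt0.
  rewrite dot_inversion // /inversion; split.
    by field; rewrite !gt_eqF // addrC.
  rewrite scalerA; congr (_ *: _).
  by field; rewrite !gt_eqF // addrC.
- by rewrite dot0l !mulr0 addr0 scaler0; split=> //; field.
Qed.

Lemma ellipsoid_le1 (y0 : R) y b : on_ellipsoid y0 y -> sg b * y0 <= 1.
Proof.
move=> h; have : y0 ^+ 2 <= 1 by rewrite -h lerDl mulr_ge0 ?dot_ge0 // ltW.
by move=> h2; rewrite leNgt; apply/negP; case: b => /= h3; nra.
Qed.

Lemma ellipsoid_pole (y0 : R) y : on_ellipsoid y0 y -> y0 ^+ 2 = 1 -> y = 0.
Proof.
rewrite /on_ellipsoid => + h; rewrite h => /eqP.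
rewrite -subr_eq0 addrAC subrr add0r mulf_eq0 (gt_eqF a0) dot_eq0 /=.
by move/eqP.
Qed.

(** The two charts are the projections from [(1, 0)] and [(-1, 0)]; the side
    condition excludes the center. *)
Lemma chart_stereo b (y0 : R) y : on_ellipsoid y0 y ->
  (chart_dom b (stereo y0 y) <-> 0 < 1 - sg b * y0) /\
  (0 < 1 - sg b * y0 -> chart b (stereo y0 y) = (al b / (1 - sg b * y0)) *: y).
Proof.
move=> h; have le1 := ellipsoid_le1 b h; have ap := a0.
have pole := ellipsoid_pole h.
rewrite /stereo; case: b le1 => /= le1; case: (eqVneq y0 1) => [y01|y01].
- by split=> [|]; [split=> //|]; rewrite y01 mulr1 subrr ltxx.
- rewrite mul1r in le1 *; split=> //; split=> // _.
  by rewrite subr_gt0 lt_neqAle y01.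
- have -> : y = 0 by apply: pole; rewrite y01 expr1n.
  by split=> [|_]; [split=> // _; rewrite y01; lra|rewrite scaler0].
- have h1 : 0 < 1 - y0.
    by rewrite subr_gt0 lt_neqAle y01 -(mul1r y0); exact: (ellipsoid_le1 affine h).
  have yy : dot y y = (1 - y0) * (1 + y0) / a.
    apply: (mulfI (x := a)); first by rewrite gt_eqF.
    rewrite (_ : a * dot y y = 1 - y0 ^+ 2); last by rewrite -h; ring.
    by field; rewrite gt_eqF.
  rewrite mulN1r opprK.
  split; first split.
  + move=> ne; rewrite lt_neqAle -(addrC y0) -subr_ge0; apply/andP; split.
      apply/eqP => e; apply: ne; have -> : y = 0.
        by apply: pole; rewrite (_ : y0 = -1) ?sqrrN ?expr1n //; lra.
      by rewrite scaler0.
    by move: le1; lra.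
  + move=> h2 [] /eqP; rewrite scaler_eq0 mulf_eq0 invr_eq0 !gt_eqF //= -dot_eq0.
    by rewrite yy gt_eqF // divr_gt0 // mulr_gt0.
  + move=> h2; rewrite /inversion !dotE yy scalerA; congr (_ *: _).
    by field; rewrite !gt_eqF.
Qed.

End Stereographic.

(** * Harmonic motions *)

Section Harmonic.
Variable R : realType.

(** The factor [f] allows for a change of the time parameter. *)
Lemma harmonic_unique (I : set R) (kap t0 : R) (f u w : R -> R) :
  0 <= kap -> is_interval I -> I t0 -> u t0 = 0 -> w t0 = 0 ->
  (forall t, I t -> is_derive t 1 u (f t * w t)) ->
  (forall t, I t -> is_derive t 1 w (- kap * (f t * u t))) ->
  forall t, I t -> u t = 0.
Proof.
move=> kap0 iI It0 u0 w0 du dw.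
(* conservation of the energy [kap * u ^+ 2 + w ^+ 2], which vanishes at [t0] *)
have w00 t : I t -> w t = 0.
  move=> It; pose e s := kap * (u s * u s) + w s * w s.
  have : e t = e t0.
    apply: (constant_on_interval iI _ It It0) => s Is.
    have de := derD (derM (der_cst s _ kap) (derM (du s Is) (du s Is)))
                    (derM (dw s Is) (dw s Is)).
    by apply: der_eq de _; ring.
  rewrite /e u0 w0 !mulr0 addr0 => h.
  have h1 : 0 <= kap * (u t * u t) by rewrite mulr_ge0 // -expr2 sqr_ge0.
  have h2 : 0 <= w t * w t by rewrite -expr2 sqr_ge0.
  apply/eqP; rewrite -sqrf_eq0 expr2; apply/eqP; lra.
move=> t It; rewrite -u0; apply: (constant_on_interval iI _ It It0) => s Is.
by rewrite -(mulr0 (f s)) -(w00 s Is); exact: du.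
Qed.

Lemma harmonic_determined (I : set R) (kap t0 : R) (f u w u' w' : R -> R) :
  0 <= kap -> is_interval I -> I t0 -> u t0 = u' t0 -> w t0 = w' t0 ->
  (forall t, I t -> is_derive t 1 u (f t * w t)) ->
  (forall t, I t -> is_derive t 1 w (- kap * (f t * u t))) ->
  (forall t, I t -> is_derive t 1 u' (f t * w' t)) ->
  (forall t, I t -> is_derive t 1 w' (- kap * (f t * u' t))) ->
  forall t, I t -> u t = u' t.
Proof.
move=> kap0 iI It0 uu ww du dw du' dw' t It; apply/eqP; rewrite -subr_eq0; apply/eqP.
apply: (@harmonic_unique I kap t0 f (fun s => u s - u' s) (fun s => w s - w' s)) => //.
- by rewrite uu subrr.
- by rewrite ww subrr.
- by move=> s Is; apply: der_eq (derB (du s Is) (du' s Is)) _; ring.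
- by move=> s Is; apply: der_eq (derB (dw s Is) (dw' s Is)) _; ring.
Qed.

Lemma harmonic_determined_row (I : set R) (kap t0 : R) (f : R -> R) n
    (u w u' w' : R -> 'rV[R]_n) :
  0 <= kap -> is_interval I -> I t0 -> u t0 = u' t0 -> w t0 = w' t0 ->
  (forall t, I t -> is_derive t 1 u (f t *: w t)) ->
  (forall t, I t -> is_derive t 1 w (- kap *: (f t *: u t))) ->
  (forall t, I t -> is_derive t 1 u' (f t *: w' t)) ->
  (forall t, I t -> is_derive t 1 w' (- kap *: (f t *: u' t))) ->
  forall t, I t -> u t = u' t.
Proof.
move=> kap0 iI It0 uu ww du dw du' dw' t It; apply/rowP => i.
apply: (@harmonic_determined I kap t0 f (fun s => u s 0 i) (fun s => w s 0 i)
  (fun s => u' s 0 i) (fun s => w' s 0 i)) => //; rewrite ?uu ?ww // => s Is.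
- by have /der_rowP/(_ i) := du s Is; rewrite mxE.
- by have /der_rowP/(_ i) := dw s Is; rewrite !mxE.
- by have /der_rowP/(_ i) := du' s Is; rewrite mxE.
- by have /der_rowP/(_ i) := dw' s Is; rewrite !mxE.
Qed.

(** The second derivative of a curve at one time involves its first derivative
    nearby, so the closed formula [f] has to hold on an open set. *)
Lemma second_derivative_on_open (U : set R) n (x f f1 f2 : R -> 'rV[R]_n) :
  open U -> (forall s, U s -> x s = f s) ->
  (forall s, U s -> is_derive s 1 f (f1 s)) ->
  (forall s, U s -> is_derive s 1 f1 (f2 s)) ->
  forall t, U t -> is_derive t 1 x (f1 t) /\ is_derive t 1 (derive1 x) (f2 t).
Proof.
move=> oU xf df df1.
have nU s : U s -> \forall r \near s, U r by move: oU; rewrite openE; exact.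
have dx (s : R) : U s -> is_derive s 1 x (f1 s).
  move=> Us; apply: der_near (df s Us).
  by apply: filterS (nU s Us) => r /xf.
move=> t Ut; split; first exact: dx.
apply: der_near (df1 t Ut).
by apply: filterS (nU t Ut) => r /dx/derive1_der.
Qed.

End Harmonic.

(** * Great circles of the ellipsoid are the geodesics *)

Section Geodesics.
Variables (R : realType) (E : R).
Hypothesis hE : E < 0.

Local Notation a := (curv E).
Local Notation al := (chart_al E).
Local Notation be := (chart_be E).
Local Notation sg := (@chart_sg R).
Let a0 : 0 < a := curv_gt0 hE.
Let al0 b : 0 < al b := chart_al_gt0 hE b.
Let be0 b : 0 < be b := chart_be_gt0 hE b.

(** Parametrized at the constant speed whose square is [kap] for the quadratic
    form of the ellipsoid. *)
Definition great_circle (kap : R) (y0 v0 : R -> R) (y v : R -> 'rV[R]_3) : Prop :=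
  (forall t : R, [/\ is_derive t 1 y0 (v0 t), is_derive t 1 y (v t),
      is_derive t 1 v0 (- kap * y0 t) & is_derive t 1 v (- kap *: y t)]) /\
  (forall t : R, [/\ on_ellipsoid E (y0 t) (y t), y0 t * v0 t + a * dot (y t) (v t) = 0 &
      v0 t ^+ 2 + a * dot (v t) (v t) = kap]).

(** With [h = 1 - sg b * y0], the curve in the chart is [(al b / h) *: y] and its
    conformal denominator is [2 * al b / h]; the quadratic relations that hold on
    the ellipsoid reduce the geodesic equation to an identity. *)
Lemma great_circle_geodesic kap y0 v0 y v : great_circle kap y0 v0 y v ->
  geodesic_on E (spherical_metric E) setT (fun t => stereo E (y0 t) (y t)).
Proof.
move=> [dY cY] t _; split.
  rewrite /MEplus /stereo; case: ifP => //= _.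
  by rewrite (lt_le_trans _ (dot_ge0 _)) // pmulr_rlt0 // ltr0n.
move=> b bt /=; set x := chart b \o _.
pose h (s : R) : R := 1 - sg b * y0 s; pose U := [set s | 0 < h s].
have oU : open U.
  have ch : continuous h.
    move=> s; have [d _ _ _] := dY s.
    exact: der_cvg (derB (der_cst s 1 1) (derM (der_cst s 1 (sg b)) d)).
  exact: open_comp (fun s _ => ch s) (@open_gt _ 0).
have cs s := chart_stereo hE b (let: And3 e _ _ := cY s in e).
have Ut : U t by apply/(cs t).1.
have dh (s : R) : is_derive s 1 h (- sg b * v0 s).
  have [d _ _ _] := dY s.
  by apply: der_eq (derB (der_cst s 1 1) (derM (der_cst s 1 (sg b)) d)) _; ring.
have dh1 (s : R) : is_derive s 1 (fun r => - sg b * v0 r) (sg b * kap * y0 s).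
  have [_ _ d _] := dY s.
  by apply: der_eq (derM (der_cst s 1 (- sg b)) d) _; ring.
pose f (s : R) := (al b / h s) *: y s.
pose f1 (s : R) := (- al b * (- sg b * v0 s) / h s ^+ 2) *: y s + (al b / h s) *: v s.
pose f2 (s : R) := (2 * al b * (- sg b * v0 s) ^+ 2 / h s ^+ 3
    - al b * (sg b * kap * y0 s) / h s ^+ 2 - kap * al b / h s) *: y s
  + (- 2 * al b * (- sg b * v0 s) / h s ^+ 2) *: v s.
have dal (s : R) : U s -> is_derive s 1 (fun r => al b / h r)
    (- al b * (- sg b * v0 s) / h s ^+ 2).
  rewrite /U /= => hs; have hn0 : h s != 0 by rewrite gt_eqF.
  by apply: der_eq (derM (der_cst s 1 (al b)) (derV hn0 (dh s))) _; field.
have xf s : U s -> x s = f s by move/(cs s).2.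
have df (s : R) : U s -> is_derive s 1 f (f1 s).
  by move=> Us; have [_ d _ _] := dY s; exact: derZv (dal s Us) d.
have df1 (s : R) : U s -> is_derive s 1 f1 (f2 s).
  move=> Us; have hs : 0 < h s := Us.
  have hn0 : h s != 0 by rewrite gt_eqF.
  have hn20 : h s * h s != 0 by rewrite mulf_neq0.
  have [_ d _ d'] := dY s.
  have e1 := derM (derM (der_cst s 1 (- al b)) (dh1 s))
               (derV (f := fun r => h r * h r) hn20 (derM (dh s) (dh s))).
  have e := derDv (derZv e1 d) (derZv (dal s Us) d').
  apply: der_ext (der_eq e _) => [r|]; first by rewrite /f1 expr2.
  by apply/rowP => i; rewrite /f2 !mxE; field.
have dx (s : R) : U s -> is_derive s 1 x (f1 s) /\ is_derive s 1 (derive1 x) (f2 s).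
  exact: second_derivative_on_open oU xf df df1 s.
have [dxt dx1t] := dx t Ut; split.
- apply: filterS (open_nbhs_nbhs (conj oU Ut)) => s Us; split; first exact/(cs s).1.
  by have [[]] := dx s Us.
- by have [] := dx1t.
have xft : chart b (stereo E (y0 t) (y t)) = f t := xf t Ut.
rewrite (derive1_der dxt) (derive1_der dx1t) xft.
apply/(geodesic_equationE (al0 b) (be0 b)).
have [e1 e2 e3] := cY t.
have sg2 : sg b * sg b = 1 by case: (b); rewrite /= ?mulrNN ?mulr1.
have ht0 : h t != 0 by rewrite gt_eqF.
pose H' := - sg b * v0 t.
have Ey0 : y0 t = sg b * (1 - h t).
  by rewrite /h opprB addrCA subrr addr0 mulrA sg2 mul1r.
have Ev0 : v0 t = - sg b * H' by rewrite /H' mulrA mulrNN sg2 mul1r.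
have a1 : a != 0 by rewrite gt_eqF.
have aE : a = al b * be b by rewrite chart_albe.
have yy : dot (y t) (y t) = (2 * h t - h t ^+ 2) / a.
  apply: (mulfI a1); rewrite mulrC; move: e1; rewrite /on_ellipsoid Ey0 exprMn expr2 sg2.
  move=> e; rewrite [RHS]mulrC divfK //; move: e; lra.
have yv : dot (y t) (v t) = (1 - h t) * H' / a.
  apply: (mulfI a1); rewrite [RHS]mulrC divfK //.
  move: e2; rewrite Ey0 Ev0 => e.
  have -> : (1 - h t) * H' = - (sg b * (1 - h t) * (- sg b * H')).
    by rewrite -[LHS]mul1r -sg2; ring.
  by move: e; lra.
have vv : dot (v t) (v t) = (kap - H' ^+ 2) / a.
  apply: (mulfI a1); rewrite [RHS]mulrC divfK //.
  move: e3; rewrite Ev0 exprMn sqrrN (expr2 (sg b)) sg2 mul1r; lra.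
have al1 : al b != 0 by rewrite gt_eqF.
have be1 : be b != 0 by rewrite gt_eqF.
have xx : dot (f t) (f t) = al b / be b * (2 / h t - 1).
  by rewrite /f !dotE yy aE; field; rewrite ?ht0 ?al1 ?be1.
have xx1 : dot (f t) (f1 t) = - (al b / be b) * H' / h t ^+ 2.
  by rewrite /f /f1 !dotE yy yv aE -/H'; field; rewrite ?ht0 ?al1 ?be1.
have x1x1 : dot (f1 t) (f1 t) = al b / be b * kap / h t ^+ 2.
  by rewrite /f1 !dotE (dotC (v t) (y t)) yy yv vv aE -/H'; field; rewrite ?ht0 ?al1 ?be1.
have -> : conf_den (al b) (be b) (f t) = 2 * al b / h t.
  by rewrite /conf_den xx; field; rewrite ?ht0 ?al1 ?be1.
rewrite xx1 x1x1 /f /f1 /f2 -/H' Ey0.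
rewrite (_ : sg b * kap * (sg b * (1 - h t)) = (sg b * sg b) * kap * (1 - h t)); last ring.
rewrite sg2; apply/rowP => i; rewrite !mxE; by field; rewrite ?ht0 ?al1 ?be1.
Qed.

End Geodesics.

Section GeodesicsAreGreatCircles.
Variables (R : realType) (E : R).
Hypothesis hE : E < 0.

Local Notation a := (curv E).
Local Notation al := (chart_al E).
Local Notation be := (chart_be E).
Local Notation sg := (@chart_sg R).
Let a0 : 0 < a := curv_gt0 hE.
Let al0 b : 0 < al b := chart_al_gt0 hE b.
Let be0 b : 0 < be b := chart_be_gt0 hE b.

(** The geodesic equation in a chart says exactly that the acceleration of the lift
    to the ellipsoid is normal to it. At each time a chart is chosen around the
    current point; the resulting equation mentions no chart. *)
Lemma geodesic_lift_derivatives (J : set R) c t :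
  geodesic_on E (spherical_metric E) J c -> J t ->
  let y0 s := height E (c s) in let y s := horizontal E (c s) in
  let kap := derive1 y0 t ^+ 2 + a * dot (derive1 y t) (derive1 y t) in
  [/\ is_derive t 1 y0 (derive1 y0 t), is_derive t 1 y (derive1 y t),
      is_derive t 1 (derive1 y0) (- kap * y0 t) &
      is_derive t 1 (derive1 y) (- kap *: y t)].
Proof.
move=> gc Jt y0 y kap.
have [b bt] : exists b, chart_dom b (c t).
  by case: (c t) => [p|]; [exists affine|exists inverted].
have [_ /(_ b bt)] := gc t Jt; set x := chart b \o c => -[near_x d2x].
move=> /(geodesic_equationE (al0 b) (be0 b)) eqx.
pose D s : R := conf_den (al b) (be b) (x s).
have D0 s : D s != 0 by exact: conf_den_neq0.
have D20 s : D s * D s != 0 by rewrite mulf_neq0.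
pose m (s : R) : R := 2 * be b * dot (x s) (derive1 x s).
pose v0 s : R := 2 * al b * sg b * m s / (D s * D s).
pose v (s : R) : 'rV[R]_3 := (- 2 * m s / (D s * D s)) *: x s + (2 / D s) *: derive1 x s.
have dD s : derivable x s 1 -> is_derive s 1 D (m s).
  move=> /der_derive1 dx.
  apply: der_eq (derD (der_cst s 1 (al b)) (derM (der_cst s 1 (be b)) (der_dot dx dx))) _.
  by rewrite /m (dotC (derive1 x s)); ring.
have nn := nbhs_interior near_x.
have ndy : \forall s \near t, is_derive (s : R) 1 y0 (v0 s) /\ is_derive (s : R) 1 y (v s).
  apply: filterS nn => s ns.
  have [_ dxs] := nbhs_singleton ns.
  have dDs := derV (D0 s) (dD s dxs).
  split.
    apply: der_near (der_eq (derM (der_cst s 1 (sg b)) (derB (der_cst s 1 1)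
        (derM (der_cst s 1 (2 * al b)) dDs))) _).
      by apply: filterS ns => r [hr _]; have [e _] := chart_height hE hr; rewrite /y0 e.
    by rewrite /v0; field.
  apply: der_near (der_eq (derZv (derM (der_cst s 1 2) dDs) (der_derive1 dxs)) _).
    by apply: filterS ns => r [hr _]; have [_ e] := chart_height hE hr; rewrite /y e.
  by rewrite /v; congr (_ *: _ + _); field.
have [dy0 dy] := nbhs_singleton ndy.
have [_ dxt] := nbhs_singleton near_x.
have dx := der_derive1 dxt; have ddx := der_derive1 d2x.
have [y0t yt] := chart_height hE bt.
set n := dot (derive1 x t) (derive1 x t).
set mt := dot (x t) (derive1 x t).
have al1 : al b != 0 by rewrite gt_eqF.
have be1 : be b != 0 by rewrite gt_eqF.
have sg2 : sg b * sg b = 1 by case: (b); rewrite /= ?mulrNN ?mulr1.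
have aE : a = al b * be b by rewrite chart_albe.
have xx : dot (x t) (x t) = (D t - al b) / be b.
  by rewrite /D /conf_den; field.
have kapE : kap = 4 * al b * be b * n / (D t * D t).
  rewrite /kap (derive1_der dy0) (derive1_der dy) /v0 /v !dotE.
  rewrite (dotC (derive1 x t)) -/n -/mt xx /m -/mt aE.
  have -> : (2 * al b * sg b * (2 * be b * mt) / (D t * D t)) ^+ 2 =
    (sg b * sg b) * (2 * al b * (2 * be b * mt) / (D t * D t)) ^+ 2 by ring.
  by rewrite sg2; field; rewrite D0 be1.
have xddx : dot (x t) (derive1 (derive1 x) t) =
    be b / D t * (4 * mt ^+ 2 - 2 * n * ((D t - al b) / be b)).
  by rewrite eqx !dotE -/mt -/n xx -/(D t); ring.
have dm : is_derive t 1 m (2 * be b * (n + be b / D t *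
    (4 * mt ^+ 2 - 2 * n * ((D t - al b) / be b)))).
  by apply: der_eq (derM (der_cst t 1 (2 * be b)) (der_dot dx ddx)) _; rewrite -/n xddx; ring.
have dDt := dD t dxt.
have dDD := derV (f := fun s => D s * D s) (D20 t) (derM dDt dDt).
have near_v0 : \forall s \near t, v0 s = derive1 y0 s.
  by apply: filterS ndy => s [d _]; rewrite (derive1_der d).
have near_v : \forall s \near t, v s = derive1 y s.
  by apply: filterS ndy => s [_ d]; rewrite (derive1_der d).
split.
- by rewrite (derive1_der dy0).
- by rewrite (derive1_der dy).
- apply: (der_near near_v0).
  apply: der_eq (derM (derM (der_cst t 1 (2 * al b * sg b)) dm) dDD) _.
  rewrite kapE /y0 y0t -/(x t) -/(D t) /m -/mt.
  by field; rewrite D0 be1.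
- apply: (der_near near_v).
  have d1 := derZv (derM (derM (der_cst t 1 (- 2)) dm) dDD) dx.
  have d2 := derZv (derM (der_cst t 1 2) (derV (D0 t) dDt)) ddx.
  apply: der_eq (derDv d1 d2) _.
  rewrite kapE /y yt -/(x t) -/(D t) eqx -/mt -/n -/(D t) /m -/mt.
  apply/rowP => i; rewrite !mxE; field.
  by rewrite D0 be1.
Qed.

(** Velocity zero is admitted, so that constant geodesics extend as well. *)
Lemma great_circle_exists (t0 A0 V0 : R) (A V : 'rV[R]_3) :
  on_ellipsoid E A0 A -> A0 * V0 + a * dot A V = 0 ->
  exists y0 v0 y v, great_circle E (V0 ^+ 2 + a * dot V V) y0 v0 y v /\
    [/\ y0 t0 = A0, v0 t0 = V0, y t0 = A & v t0 = V].
Proof.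
move=> hA hAV; set kap := V0 ^+ 2 + _.
have kap0 : 0 <= kap by rewrite addr_ge0 ?sqr_ge0 // mulr_ge0 ?dot_ge0 // ltW.
pose w := Num.sqrt kap; have w2 : w ^+ 2 = kap by rewrite sqr_sqrtr.
have [B0 [B [hV0 hV]]] : exists B0 B, V0 = w * B0 /\ V = w *: B.
  have [k0|k0] := eqVneq kap 0; last first.
    have w0 : w != 0 by rewrite -sqrf_eq0 w2.
    by exists (w^-1 * V0), (w^-1 *: V); rewrite mulrA scalerA divff // mul1r scale1r.
  have /andP[/eqP V00 /eqP VV] : (V0 ^+ 2 == 0) && (a * dot V V == 0).
    by rewrite -paddr_eq0 ?sqr_ge0 ?mulr_ge0 ?dot_ge0 ?(ltW a0) //; apply/eqP.
  exists 0, 0; rewrite mulr0 scaler0; split; apply/eqP; first by rewrite -sqrf_eq0 V00.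
  by move/eqP: VV; rewrite mulf_eq0 (gt_eqF a0) dot_eq0.
have dth (t : R) : is_derive t 1 (fun s => w * (s - t0)) w.
  apply: der_eq (derM (der_cst t 1 w) (derB (der_id t) (der_cst t 1 t0))) _.
  ring.
pose C (t : R) := cos (w * (t - t0)); pose S (t : R) := sin (w * (t - t0)).
have dC (t : R) : is_derive t 1 C (- w * S t).
  by apply: der_eq (der_comp (is_derive_cos _) (dth t)) _; rewrite /S; ring.
have dS (t : R) : is_derive t 1 S (w * C t).
  by apply: der_eq (der_comp (is_derive_sin _) (dth t)) _; rewrite /C; ring.
have CS t : C t ^+ 2 + S t ^+ 2 = 1 by exact: cos2Dsin2.
exists (fun t => C t * A0 + S t * B0), (fun t => w * (C t * B0 - S t * A0)).
exists (fun t => C t *: A + S t *: B), (fun t => w *: (C t *: B + (- S t) *: A)).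
have C0 : C t0 = 1 by rewrite /C subrr mulr0 cos0.
have S0 : S t0 = 0 by rewrite /S subrr mulr0 sin0.
split; last first.
  rewrite C0 S0 !scale0r !scale1r oppr0 scale0r !addr0 !mul1r !mul0r addr0 subr0.
  by rewrite hV0 hV.
have w2' : kap = w * w by rewrite -w2 expr2.
split=> t.
  split.
  - by apply: der_eq (derD (derM (dC t) (der_cst t 1 A0)) (derM (dS t) (der_cst t 1 B0))) _; ring.
  - apply: der_eq (derDv (derZv (dC t) (der_cstv t 1 A)) (derZv (dS t) (der_cstv t 1 B))) _.
    by apply/rowP => i; rewrite !mxE; ring.
  - apply: der_eq (derM (der_cst t 1 w) (derB (derM (dC t) (der_cst t 1 B0))
      (derM (dS t) (der_cst t 1 A0)))) _.
    by rewrite w2'; ring.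
  - apply: der_eq (derZv (der_cst t 1 w) (derDv (derZv (dC t) (der_cstv t 1 B))
      (derZv (derN (dS t)) (der_cstv t 1 A)))) _.
    by rewrite w2'; apply/rowP => i; rewrite !mxE; ring.
have S2 : S t ^+ 2 = 1 - C t ^+ 2 by rewrite -(CS t); ring.
rewrite /on_ellipsoid !dotE (dotC B A).
have [w0|w0] := eqVneq w 0.
  have -> : C t = 1 by rewrite /C w0 mul0r cos0.
  have -> : S t = 0 by rewrite /S w0 mul0r sin0.
  rewrite w2' w0; split; [|ring|ring].
  by rewrite -[RHS]hA; ring.
have kap_ne0 : w * w != 0 by rewrite mulf_neq0.
have hAB : a * dot A B = - (A0 * B0).
  move: hAV; rewrite hV0 hV !dotE => h.
  by apply: (mulfI w0); rewrite -[LHS]subr0 -h; ring.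
have hAA : a * dot A A = 1 - A0 ^+ 2 by rewrite -hA; ring.
have hBB : a * dot B B = 1 - B0 ^+ 2.
  have hk : w * w = w * w * (B0 ^+ 2 + a * dot B B).
    by rewrite -[LHS]w2' /kap hV0 hV !dotE; ring.
  by apply: (mulfI kap_ne0); rewrite mulrBr mulr1 {2}hk; ring.
split.
- transitivity ((C t * A0 + S t * B0) ^+ 2 + (C t ^+ 2 * (a * dot A A)
    + 2 * C t * S t * (a * dot A B) + S t ^+ 2 * (a * dot B B))); first ring.
  by rewrite hAA hAB hBB -[RHS](CS t); ring.
- transitivity (w * ((C t * A0 + S t * B0) * (C t * B0 - S t * A0)
    + (C t ^+ 2 - S t ^+ 2) * (a * dot A B) + C t * S t * (a * dot B B - a * dot A A))).
    ring.
  by rewrite hAA hAB hBB; ring.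
- transitivity (w * w * ((C t * B0 - S t * A0) ^+ 2 + (S t ^+ 2 * (a * dot A A)
    - 2 * C t * S t * (a * dot A B) + C t ^+ 2 * (a * dot B B)))); first ring.
  by rewrite hAA hAB hBB w2' -[RHS]mulr1 -[X in _ = _ * X](CS t); ring.
Qed.

(** The velocity is tangent and the acceleration normal, so the speed is constant;
    the equation of motion is then linear with constant coefficients, and its
    solutions are defined for all times. *)
Lemma geodesic_extends (J : set R) c : open J -> is_interval J -> J !=set0 ->
  geodesic_on E (spherical_metric E) J c ->
  exists kap y0 v0 y v, great_circle E kap y0 v0 y v /\
    forall t, J t -> stereo E (y0 t) (y t) = c t.
Proof.
move=> oJ iJ [t0 Jt0] gc.
pose Y0 s := height E (c s); pose Y s := horizontal E (c s).
pose V0 := derive1 Y0; pose V := derive1 Y.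
pose kap t := V0 t ^+ 2 + a * dot (V t) (V t).
have dY t : J t -> [/\ is_derive t 1 Y0 (V0 t), is_derive t 1 Y (V t),
    is_derive t 1 V0 (- kap t * Y0 t) & is_derive t 1 V (- kap t *: Y t)].
  exact: geodesic_lift_derivatives gc.
have onY t : on_ellipsoid E (Y0 t) (Y t) by exact: height_on_ellipsoid.
have YV t : J t -> Y0 t * V0 t + a * dot (Y t) (V t) = 0.
  move=> Jt; have [d1 d2 _ _] := dY t Jt.
  have dq := derD (derM d1 d1) (derM (der_cst t 1 a) (der_dot d2 d2)).
  have dc : is_derive t 1 (fun s => Y0 s * Y0 s + a * dot (Y s) (Y s)) 0.
    apply: der_ext (der_cst t 1 1) => s.
    by rewrite -expr2; exact/esym/onY.
  have := der_unique dq dc; rewrite (dotC (V t)) => h.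
  have : 2 * (Y0 t * V0 t + a * dot (Y t) (V t)) = 0 by rewrite -h; ring.
  by move/eqP; rewrite mulf_eq0 pnatr_eq0 /= => /eqP.
have kapc t : J t -> kap t = kap t0.
  move=> Jt; apply: (constant_on_interval iJ _ Jt Jt0) => s Js.
  have [_ _ d1 d2] := dY s Js.
  have dq := derD (derM d1 d1) (derM (der_cst s 1 a) (der_dot d2 d2)).
  apply: der_ext (der_eq dq _) => [r|]; first by rewrite /kap expr2.
  rewrite !dotE (dotC (V s)).
  transitivity (- 2 * kap s * (Y0 s * V0 s + a * dot (Y s) (V s))); first ring.
  by rewrite YV // mulr0.
have [y0 [v0 [y [v [gy [e1 e2 e3 e4]]]]]] := great_circle_exists t0 (onY t0) (YV t0 Jt0).
exists (kap t0), y0, v0, y, v; split=> // t Jt.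
have kap0 : 0 <= kap t0 by rewrite addr_ge0 ?sqr_ge0 // mulr_ge0 ?dot_ge0 // ltW.
have [gd _] := gy.
rewrite -[RHS](height_horizontalK hE) -/(Y0 t) -/(Y t); congr stereo.
- apply: (harmonic_determined (f := fun=> 1) kap0 iJ Jt0 e1 e2) Jt => s Js; rewrite mul1r.
  + by have [] := gd s.
  + by have [] := gd s.
  + by have [] := dY s Js.
  + by have [_ _ + _] := dY s Js; rewrite kapc.
- apply: (harmonic_determined_row (f := fun=> 1) kap0 iJ Jt0 e3 e4) Jt => s Js; rewrite scale1r.
  + by have [] := gd s.
  + by have [] := gd s.
  + by have [] := dY s Js.
  + by have [_ _ _] := dY s Js; rewrite kapc.
Qed.

Lemma spherical_metric_complete : complete_metric E (spherical_metric E).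
Proof.
move=> J c oJ iJ J0 /(geodesic_extends oJ iJ J0)[kap [y0 [v0 [y [v [gy h]]]]]].
by exists (fun t => stereo E (y0 t) (y t)); first exact: great_circle_geodesic gy.
Qed.

End GeodesicsAreGreatCircles.

(** * Kepler states and unit tangent vectors of the ellipsoid *)

Section FourVectors.
Variable R : realType.
Implicit Types (p q : 'rV[R]_4) (u v : 'rV[R]_3) (s : R).

Definition vec4 s u : 'rV[R]_4 := \row_i (if unlift ord0 i is Some j then u 0 j else s).

Lemma scal_vec4 s u : scal (vec4 s u) = s.
Proof. by rewrite /scal mxE unlift_none. Qed.

Lemma vect_vec4 s u : vect (vec4 s u) = u.
Proof. by apply/rowP => j; rewrite !mxE liftK. Qed.

Lemma vec4E q : vec4 (scal q) (vect q) = q.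
Proof.
by apply/rowP => i; rewrite mxE; case: unliftP => [j|] ->; rewrite ?mxE.
Qed.

Lemma vec4P p q : scal p = scal q -> vect p = vect q -> p = q.
Proof. by move=> e1 e2; rewrite -(vec4E p) e1 e2 vec4E. Qed.

Lemma dot4E p q : dot p q = scal p * scal q + dot (vect p) (vect q).
Proof.
rewrite {1}/dot big_ord_recl; congr (_ + _).
by apply: eq_bigr => j _; rewrite !mxE.
Qed.

Lemma scalD p q : scal (p + q) = scal p + scal q. Proof. by rewrite /scal mxE. Qed.
Lemma scalZ s q : scal (s *: q) = s * scal q. Proof. by rewrite /scal mxE. Qed.
Lemma scalN q : scal (- q) = - scal q. Proof. by rewrite /scal mxE. Qed.
Lemma vectD p q : vect (p + q) = vect p + vect q.
Proof. by apply/rowP => i; rewrite !mxE. Qed.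
Lemma vectZ s q : vect (s *: q) = s *: vect q.
Proof. by apply/rowP => i; rewrite !mxE. Qed.
Lemma vectN q : vect (- q) = - vect q.
Proof. by apply/rowP => i; rewrite !mxE. Qed.
Lemma scal_e0 : scal (e0 R) = 1. Proof. by rewrite /scal mxE. Qed.
Lemma vect_e0 : vect (e0 R) = 0.
Proof. by apply/rowP => i; rewrite !mxE. Qed.

Lemma der_vec4P (q : R -> 'rV[R]_4) (t : R) (d : 'rV[R]_4) :
  is_derive t 1 q d <->
  is_derive t 1 (fun s => scal (q s)) (scal d) /\
  is_derive t 1 (fun s => vect (q s)) (vect d).
Proof.
split=> [/der_rowP dq|[d0 /der_rowP dv]].
  split; first exact: dq.
  apply/der_rowP => i; apply: der_ext (der_eq (dq (lift ord0 i)) _) => [s|];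
    by rewrite mxE.
apply/der_rowP => i; case: (unliftP ord0 i) => [j|] -> //.
by apply: der_ext (der_eq (dv j) _) => [s|]; rewrite mxE.
Qed.

Lemma dot_cross u v : dot (cross u v) (cross u v) =
  dot u u * dot v v - dot u v ^+ 2.
Proof.
rewrite /dot !big_ord_recr !big_ord0 /= !mxE.
set i0 := widen_ord _ (widen_ord _ ord_max); set i1 := widen_ord _ ord_max.
set i2 := (ord_max : 'I_3).
have -> : i0 + 1 = i1 by apply/val_inj.
have -> : i0 + 2%:R = i2 by apply/val_inj.
have -> : i1 + 1 = i2 by apply/val_inj.
have -> : i1 + 2%:R = i0 by apply/val_inj.
have -> : i2 + 1 = i0 by apply/val_inj.
have -> : i2 + 2%:R = i1 by apply/val_inj.
ring.
Qed.

End FourVectors.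

Section PolarState.
Variables (R : realType) (gamma c r w0 : R) (n P : 'rV[R]_3).
Hypotheses (c0 : 0 < c) (r0 : 0 < r) (cr : c ^+ 2 + r ^+ 2 = 1).
Hypotheses (nn : dot n n = 1) (Pn : dot P n = - w0 / r).

(** Position and velocity in polar coordinates around [e0]: [c] and [r] are the
    cosine and sine of the polar angle, [n] the direction, [w0] the vertical
    velocity, and [P] becomes the vector [pi]. *)
Definition polar_pos : 'rV[R]_4 := vec4 c (r *: n).
Definition polar_vel : 'rV[R]_4 := vec4 w0 (c^-1 *: (P + (w0 * r) *: n)).

Let c1 : c != 0. Proof. by rewrite gt_eqF. Qed.
Let r1 : r != 0. Proof. by rewrite gt_eqF. Qed.
Let r2 : r ^+ 2 = 1 - c ^+ 2. Proof. by rewrite -cr; ring. Qed.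

Lemma polar_radius : Num.sqrt (1 - c ^+ 2) = r.
Proof. by rewrite -r2 sqrtr_sqr ger0_norm // ltW. Qed.

Lemma polar_speed : dot polar_vel polar_vel = (dot P P - w0 ^+ 2) / c ^+ 2.
Proof.
rewrite dot4E !scal_vec4 !vect_vec4 !dotE nn (dotC n) Pn; set m := dot P P.
transitivity ((c ^+ 2 * w0 ^+ 2 + m - 2 * w0 ^+ 2 + w0 ^+ 2 * r ^+ 2) / c ^+ 2).
  by field; rewrite c1 r1.
by rewrite r2; field.
Qed.

Lemma polar_phase_space : phase_space polar_pos polar_vel.
Proof.
have cc : c ^+ 2 < 1 by rewrite -subr_gt0 -r2 exprn_gt0.
split.
- by rewrite dot4E !scal_vec4 !vect_vec4 !dotE nn -[RHS]cr; ring.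
- rewrite dot4E !scal_vec4 !vect_vec4 !dotE nn (dotC n) Pn.
  transitivity (w0 / c * (c ^+ 2 - 1 + r ^+ 2)); first by field; rewrite c1 r1.
  by rewrite r2; ring.
- by rewrite scal_vec4; apply/eqP => e; move: cc; rewrite e expr1n ltxx.
- by rewrite scal_vec4; apply/eqP => e; move: cc; rewrite e sqrrN expr1n ltxx.
Qed.

Lemma polar_pi : pi_vec polar_pos polar_vel = P.
Proof.
rewrite /pi_vec !scal_vec4 !vect_vec4 !scalerA divff // scale1r.
by rewrite addrK.
Qed.

Lemma polar_mu : dot (mu_vec polar_pos polar_vel) (mu_vec polar_pos polar_vel) =
  (r ^+ 2 * dot P P - w0 ^+ 2) / c ^+ 2.
Proof.
rewrite /mu_vec dot_cross !vect_vec4 !dotE nn (dotC n) Pn; set m := dot P P.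
by field; rewrite c1 r1.
Qed.

Lemma polar_energy :
  kepler_energy gamma polar_pos polar_vel = dot P P / 2 - gamma * (c / r).
Proof.
rewrite /kepler_energy /hamiltonian polar_mu scal_vec4 polar_radius polar_speed.
set m := dot P P.
transitivity (m * (1 - r ^+ 2) / c ^+ 2 / 2 - gamma * (c / r)).
  by field; rewrite c1 r1.
by rewrite r2; field; rewrite c1 r1.
Qed.

(** The factor [r * c] is the rate of the physical time with respect to the
    Kepler parameter. *)
Lemma polar_acceleration : (r * c) *: acceleration gamma polar_pos polar_vel =
  vec4 (gamma * c - r * (dot P P - w0 ^+ 2))
       (- (r ^+ 2 * (dot P P - w0 ^+ 2) / c + gamma * c ^+ 2 / r) *: n).
Proof.
rewrite /acceleration polar_speed !scal_vec4 polar_radius; set m := dot P P.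
apply: vec4P.
- rewrite scalZ scalD scalN !scalZ scal_e0 !scal_vec4.
  transitivity (gamma * c / r ^+ 2 * (1 - c ^+ 2) - r * (m - w0 ^+ 2)).
    by field; rewrite c1 r1.
  by rewrite -r2; field.
- rewrite vectZ vectD vectN !vectZ vect_e0 !vect_vec4 scaler0 add0r.
  by apply/rowP => i; rewrite !mxE; field; rewrite c1 r1.
Qed.

End PolarState.

(** The direction [n] is the normalized spatial part of the position. *)
Lemma polar_state_exists (R : realType) (q v : 'rV[R]_4) :
  phase_space q v -> 0 < scal q ->
  exists r n, [/\ 0 < r, scal q ^+ 2 + r ^+ 2 = 1, dot n n = 1,
    dot (pi_vec q v) n = - scal v / r &
    q = polar_pos (scal q) r n /\ v = polar_vel (scal q) r (scal v) n (pi_vec q v)].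
Proof.
move=> [qq qv q1 qN1] c0; set c := scal q in c0 *; set u := vect q.
have c1 : c != 0 by rewrite gt_eqF.
have uu : dot u u = 1 - c ^+ 2.
  by move: qq; rewrite dot4E -/c -/u => <-; ring.
have uw : dot u (vect v) = - (c * scal v).
  by move: qv; rewrite dot4E -/c -/u => e; rewrite -[RHS]addr0 -e; ring.
have u0 : 0 < dot u u.
  rewrite lt_neqAle dot_ge0 andbT eq_sym uu subr_eq0 eq_sym sqrf_eq1 negb_or.
  by rewrite q1.
pose r := Num.sqrt (dot u u); have r0 : 0 < r by rewrite sqrtr_gt0.
have r1 : r != 0 by rewrite gt_eqF.
have r2 : r ^+ 2 = 1 - c ^+ 2 by rewrite sqr_sqrtr ?dot_ge0.
have wE : vect v = c^-1 *: (pi_vec q v + (scal v * r) *: (r^-1 *: u)).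
  rewrite scalerA mulfK // /pi_vec -/c -/u subrK scalerA mulVf ?scale1r //.
exists r, (r^-1 *: u); split=> //.
- by rewrite r2; ring.
- by rewrite !dotE -r2 in uu *; rewrite uu; field.
- rewrite /pi_vec -/c -/u !dotE (dotC (vect v)) uw uu.
  transitivity (- scal v * (c ^+ 2 + (1 - c ^+ 2)) / r); [by field|].
  by rewrite (_ : _ + _ = 1) ?mulr1 //; ring.
- by rewrite /polar_pos scalerA divff // scale1r vec4E /polar_vel -wE vec4E.
Qed.

Section KeplerState.
Variables (R : realType) (gamma E : R).
Hypotheses (hgamma : 0 < gamma) (hE : E < 0).

Local Notation a := (curv E).
Let a0 : 0 < a := curv_gt0 hE.
Let a1 : a != 0. Proof. by rewrite gt_eqF. Qed.
Let g1 : gamma != 0. Proof. by rewrite gt_eqF. Qed.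

(** The tangent of the polar angle. *)
Definition kepler_rho (y0 : R) : R := gamma / a * (1 - y0).
Definition kepler_cos (y0 : R) : R := (Num.sqrt (1 + kepler_rho y0 ^+ 2))^-1.
Definition kepler_sin (y0 : R) : R := kepler_rho y0 * kepler_cos y0.
Definition kepler_dir (y0 v0 : R) (y v : 'rV[R]_3) : 'rV[R]_3 :=
  - (v + (v0 / (1 - y0)) *: y).
Definition kepler_mom (y0 : R) (y : 'rV[R]_3) : 'rV[R]_3 := (a / (1 - y0)) *: y.
Definition kepler_vel0 (y0 v0 : R) : R := kepler_cos y0 * (gamma * v0 / a).

(** The Kepler state over a unit tangent vector of the ellipsoid. *)
Definition kepler_pos (y0 v0 : R) (y v : 'rV[R]_3) :=
  polar_pos (kepler_cos y0) (kepler_sin y0) (kepler_dir y0 v0 y v).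
Definition kepler_vel (y0 v0 : R) (y v : 'rV[R]_3) :=
  polar_vel (kepler_cos y0) (kepler_sin y0) (kepler_vel0 y0 v0)
    (kepler_dir y0 v0 y v) (kepler_mom y0 y).

Lemma one_plus_rho2_gt0 (y0 : R) : 0 < 1 + kepler_rho y0 ^+ 2.
Proof. by rewrite ltr_pwDl // sqr_ge0. Qed.

Lemma kepler_cos_gt0 (y0 : R) : 0 < kepler_cos y0.
Proof. by rewrite invr_gt0 sqrtr_gt0 one_plus_rho2_gt0. Qed.

Lemma kepler_cos_sin (y0 : R) : kepler_cos y0 ^+ 2 + kepler_sin y0 ^+ 2 = 1.
Proof.
rewrite /kepler_sin exprMn -{1}(mul1r (kepler_cos y0 ^+ 2)) -mulrDl.
rewrite exprVn sqr_sqrtr ?ltW ?one_plus_rho2_gt0 //.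
by rewrite divff // gt_eqF // one_plus_rho2_gt0.
Qed.

Lemma kepler_rho_gt0 (y0 : R) : y0 < 1 -> 0 < kepler_rho y0.
Proof. by move=> y1; rewrite mulr_gt0 ?divr_gt0 // subr_gt0. Qed.

Lemma kepler_sin_gt0 (y0 : R) : y0 < 1 -> 0 < kepler_sin y0.
Proof. by move=> y1; rewrite mulr_gt0 ?kepler_rho_gt0 ?kepler_cos_gt0. Qed.

(** Tangent vectors of the ellipsoid off the pole; squared speed [a] on the
    ellipsoid is speed one for the metric. *)
Definition tangent_data (y0 v0 : R) (y v : 'rV[R]_3) : Prop :=
  [/\ on_ellipsoid E y0 y, y0 * v0 + a * dot y v = 0,
      v0 ^+ 2 + a * dot v v = a & y0 < 1].

Section StateOfTangent.
Variables (y0 v0 : R) (y v : 'rV[R]_3).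
Hypothesis hY : tangent_data y0 v0 y v.

Local Notation c := (kepler_cos y0).
Local Notation r := (kepler_sin y0).
Local Notation n := (kepler_dir y0 v0 y v).
Local Notation w0 := (kepler_vel0 y0 v0).
Local Notation P := (kepler_mom y0 y).
Local Notation q := (kepler_pos y0 v0 y v).
Local Notation w := (kepler_vel y0 v0 y v).

Let y1 : y0 < 1. Proof. by have [] := hY. Qed.
Let h0 : 1 - y0 != 0. Proof. by rewrite gt_eqF // subr_gt0. Qed.
Let c1 : c != 0. Proof. by rewrite gt_eqF // kepler_cos_gt0. Qed.
Let r1 : r != 0. Proof. by rewrite gt_eqF // kepler_sin_gt0. Qed.

Let yy : dot y y = (1 - y0 ^+ 2) / a.
Proof. by have [e _ _ _] := hY; rewrite -e; field. Qed.
Let yv : dot y v = - (y0 * v0) / a.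
Proof. by have [_ e _ _] := hY; rewrite -[y0 * v0]subr0 -e; field. Qed.
Let vv : dot v v = (a - v0 ^+ 2) / a.
Proof. by have [_ _ e _] := hY; rewrite -[X in X - _]e; field. Qed.

Lemma dot_dir : dot n n = 1.
Proof. by rewrite /kepler_dir !dotE (dotC v) yy yv vv; field; rewrite a1 h0. Qed.

Let w0E : w0 = r * v0 / (1 - y0).
Proof. by rewrite /kepler_vel0 /kepler_sin /kepler_rho; field; rewrite a1 h0. Qed.

Lemma dot_mom_dir : dot P n = - w0 / r.
Proof.
rewrite w0E; transitivity (- v0 / (1 - y0)); last by field; rewrite h0 r1.
by rewrite /kepler_mom /kepler_dir !dotE yy yv; field; rewrite a1 h0.
Qed.

Lemma dot_mom : dot P P = gamma * (1 + y0) * c / r.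
Proof.
rewrite /kepler_mom /kepler_sin /kepler_rho !dotE yy; field.
by rewrite g1 a1 h0 c1.
Qed.

Let c0 := kepler_cos_gt0 y0.
Let r0 := kepler_sin_gt0 y1.
Let cr := kepler_cos_sin y0.

Lemma kepler_state_phase_space : phase_space q w.
Proof. exact: polar_phase_space c0 r0 cr dot_dir dot_mom_dir. Qed.

Lemma kepler_state_pi : pi_vec q w = P.
Proof. exact: polar_pi _ _ _ _ c0. Qed.

Lemma kepler_state_mu : dot (mu_vec q w) (mu_vec q w) =
  (gamma / a) ^+ 2 * (a * (1 - y0 ^+ 2) - v0 ^+ 2).
Proof.
rewrite (polar_mu c0 r0 dot_dir dot_mom_dir) dot_mom.
transitivity (r / c * gamma * (1 + y0) - (w0 / c) ^+ 2).
  by field; rewrite c1 r1.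
by rewrite w0E /kepler_sin /kepler_rho; field; rewrite a1 h0 c1.
Qed.

Lemma kepler_state_energy : kepler_energy gamma q w = E.
Proof.
rewrite (polar_energy gamma c0 r0 cr dot_dir dot_mom_dir) dot_mom.
have -> : E = - a / 2 by rewrite /curv; field.
by rewrite /kepler_sin /kepler_rho; field; rewrite a1 h0 g1 c1.
Qed.

End StateOfTangent.
End KeplerState.

(** * From great circles to Kepler orbits *)

Section StateDerivative.
Variables (R : realType) (gamma E : R).
Hypotheses (hgamma : 0 < gamma) (hE : E < 0).

Local Notation a := (curv E).
Let a0 : 0 < a := curv_gt0 hE.
Let a1 : a != 0. Proof. by rewrite gt_eqF. Qed.
Let g1 : gamma != 0. Proof. by rewrite gt_eqF. Qed.

(** Rate of the physical time with respect to the Kepler parameter. *)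
Definition time_rate (y0 : R) : R := kepler_sin gamma E y0 * kepler_cos gamma E y0.

Lemma der_sqrt (f : R -> R) (t d : R) : 0 < f t -> is_derive t 1 f d ->
  is_derive t 1 (fun s => Num.sqrt (f s)) (d / (2 * Num.sqrt (f t))).
Proof.
move=> ft df; apply: der_eq (der_comp (is_derive1_sqrt ft) df) _.
by rewrite mulrC.
Qed.

Variables (y0 v0 : R -> R) (y v : R -> 'rV[R]_3) (s : R).
Hypotheses (dy0 : is_derive s 1 y0 (v0 s)) (dy : is_derive s 1 y (v s)).
Hypotheses (dv0 : is_derive s 1 v0 (- a * y0 s)) (dv : is_derive s 1 v (- a *: y s)).
Hypothesis hY : tangent_data E (y0 s) (v0 s) (y s) (v s).

Local Notation rho := (kepler_rho gamma E (y0 s)).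
Local Notation c := (kepler_cos gamma E (y0 s)).
Local Notation r := (kepler_sin gamma E (y0 s)).
Local Notation n := (kepler_dir (y0 s) (v0 s) (y s) (v s)).
Local Notation w0 := (kepler_vel0 gamma E (y0 s) (v0 s)).
Local Notation P := (kepler_mom E (y0 s) (y s)).

Let y1 : y0 s < 1. Proof. by have [] := hY. Qed.
Let h0 : 1 - y0 s != 0. Proof. by rewrite gt_eqF // subr_gt0. Qed.
Let c1 : c != 0. Proof. by rewrite gt_eqF // kepler_cos_gt0. Qed.
Let r1 : r != 0. Proof. by rewrite gt_eqF // kepler_sin_gt0. Qed.
Let r2 : r ^+ 2 = 1 - c ^+ 2.
Proof. by rewrite -(kepler_cos_sin gamma E (y0 s)); ring. Qed.
Let hs : 1 - y0 s = a * r / (gamma * c).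
Proof. by rewrite /kepler_sin /kepler_rho; field; rewrite ?g1 ?c1 ?a1. Qed.
Let dh : is_derive s 1 (fun t => 1 - y0 t) (- v0 s).
Proof. by apply: der_eq (derB (der_cst s 1 1) dy0) _; ring. Qed.

Let drho : is_derive s 1 (fun t => kepler_rho gamma E (y0 t)) (- (w0 / c)).
Proof.
apply: der_eq (derM (der_cst s 1 (gamma / a)) dh) _.
by rewrite /kepler_vel0; field; rewrite ?g1 ?c1 ?a1.
Qed.

Lemma der_kepler_cos : is_derive s 1 (fun t => kepler_cos gamma E (y0 t)) (r * c * w0).
Proof.
have d1 := derD (der_cst s 1 1) (derM drho drho).
have p1 : 0 < 1 + rho * rho by rewrite -expr2 one_plus_rho2_gt0.
have sq1 : Num.sqrt (1 + rho * rho) != 0 by rewrite gt_eqF // sqrtr_gt0.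
have d2 := derV (f := fun t => Num.sqrt (1 + kepler_rho gamma E (y0 t) * kepler_rho gamma E (y0 t)))
  sq1 (der_sqrt (f := fun t => 1 + kepler_rho gamma E (y0 t) * kepler_rho gamma E (y0 t)) p1 d1).
apply: der_eq d2 _.
have -> : Num.sqrt (1 + rho * rho) = c^-1 by rewrite /kepler_cos invrK expr2.
by rewrite /kepler_sin; field; rewrite ?c1.
Qed.

Let dsin : is_derive s 1 (fun t => kepler_sin gamma E (y0 t)) (- (c ^+ 2 * w0)).
Proof.
apply: der_eq (derM drho der_kepler_cos) _.
have -> : rho = r / c by rewrite /kepler_sin mulfK.
transitivity (- w0 + r ^+ 2 * w0); first by field.
by rewrite r2; ring.
Qed.

Let ddir : is_derive s 1 (fun t => kepler_dir (y0 t) (v0 t) (y t) (v t))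
  (P + (w0 / r) *: n).
Proof.
have d1 := derM dv0 (derV (f := fun t => 1 - y0 t) h0 dh).
apply: der_eq (derNv (derDv dv (derZv d1 dy))) _.
have -> : w0 / r = v0 s / (1 - y0 s).
  by rewrite /kepler_vel0 hs; field; rewrite ?g1 ?c1 ?a1 ?r1.
rewrite /kepler_mom /kepler_dir.
apply/rowP => i; rewrite !mxE; field; exact: h0.
Qed.

Lemma der_kepler_mom : is_derive s 1 (fun t => kepler_mom E (y0 t) (y t))
  (- (gamma * c / r) *: n).
Proof.
apply: der_eq (derZv (derM (der_cst s 1 a) (derV (f := fun t => 1 - y0 t) h0 dh)) dy) _.
have -> : gamma * c / r = a / (1 - y0 s) by rewrite hs; field; rewrite ?g1 ?c1 ?a1 ?r1.
by rewrite /kepler_dir; apply/rowP => i; rewrite !mxE; field; exact: h0.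
Qed.

Let dvel0 : is_derive s 1 (fun t => kepler_vel0 gamma E (y0 t) (v0 t))
  (r * w0 ^+ 2 - c * gamma * y0 s).
Proof.
apply: der_eq (derM der_kepler_cos (derM (derM (der_cst s 1 gamma) dv0) (der_cst s 1 a^-1))) _.
by rewrite /kepler_vel0; field; exact: a1.
Qed.

Lemma der_kepler_pos :
  is_derive s 1 (fun t => kepler_pos gamma E (y0 t) (v0 t) (y t) (v t))
   (time_rate (y0 s) *: kepler_vel gamma E (y0 s) (v0 s) (y s) (v s)).
Proof.
apply/der_vec4P; rewrite scalZ vectZ !scal_vec4 !vect_vec4; split.
  apply: der_ext der_kepler_cos => t; by rewrite scal_vec4.
apply: der_ext (der_eq (derZv dsin ddir) _) => [t|]; first by rewrite vect_vec4.
rewrite /time_rate; set N := n; set Q := P; clearbody N Q.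
apply/rowP => i; rewrite !mxE.
transitivity (r * Q 0 i + w0 * (1 - c ^+ 2) * N 0 i); first by field.
by rewrite -r2; field.
Qed.

Lemma der_kepler_vel :
  is_derive s 1 (fun t => kepler_vel gamma E (y0 t) (v0 t) (y t) (v t))
   (time_rate (y0 s) *: acceleration gamma
      (kepler_pos gamma E (y0 s) (v0 s) (y s) (v s))
      (kepler_vel gamma E (y0 s) (v0 s) (y s) (v s))).
Proof.
rewrite polar_acceleration ?kepler_cos_gt0 ?kepler_sin_gt0 ?kepler_cos_sin //;
  [|exact: dot_dir hY|exact: dot_mom_dir hY].
rewrite (dot_mom hgamma hE hY); set PP := gamma * (1 + y0 s) * c / r.
have PPE : r * PP = gamma * (1 + y0 s) * c by rewrite /PP; field.
apply/der_vec4P; rewrite !scal_vec4 !vect_vec4; split.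
  apply: der_ext (der_eq dvel0 _) => [t|]; first by rewrite scal_vec4.
  by rewrite mulrBr PPE; ring.
have d1 := derDv der_kepler_mom (derZv (derM dvel0 dsin) ddir).
have d2 := derV (f := fun t => kepler_cos gamma E (y0 t)) c1 der_kepler_cos.
apply: der_ext (der_eq (derZv d2 d1) _) => [t|].
  by rewrite vect_vec4.
set N := n; set Q := P; clearbody N Q.
apply/rowP => i; rewrite !mxE; set Qi := Q 0 i; set Ni := N 0 i.
transitivity ((- gamma / r - gamma * y0 s * r + w0 ^+ 2 * (1 - c ^+ 2) / c) * Ni).
  by field; rewrite ?c1 ?r1.
rewrite -r2.
transitivity ((- gamma * r * (1 + y0 s) + r ^+ 2 * w0 ^+ 2 / c - gamma * (1 - r ^+ 2) / r) * Ni).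
  by field; rewrite ?c1 ?r1.
have -> : 1 - r ^+ 2 = c ^+ 2 by rewrite r2; ring.
by rewrite /PP; field; rewrite ?c1 ?r1.
Qed.

End StateDerivative.

(** * From Kepler orbits to great circles *)

Section OrbitLift.
Variables (R : realType) (gamma E : R).
Hypotheses (hgamma : 0 < gamma) (hE : E < 0).

Local Notation a := (curv E).
Let a0 : 0 < a := curv_gt0 hE.
Let a1 : a != 0. Proof. by rewrite gt_eqF. Qed.
Let g1 : gamma != 0. Proof. by rewrite gt_eqF. Qed.

Definition polar_sin (q : 'rV[R]_4) : R := Num.sqrt (1 - scal q ^+ 2).

(** On the energy surface these are the coordinates of the stereographic lift of
    [pi] and of the derivative of this lift with respect to arc length. *)
Definition lift_y0 (q : 'rV[R]_4) : R := 1 - a / gamma * (polar_sin q / scal q).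
Definition lift_y (q v : 'rV[R]_4) : 'rV[R]_3 :=
  (polar_sin q / (gamma * scal q)) *: pi_vec q v.
Definition lift_v0 (q v : 'rV[R]_4) : R := a * scal v / (gamma * scal q).
Definition lift_v (q v : 'rV[R]_4) : 'rV[R]_3 :=
  - ((scal v / (gamma * scal q)) *: pi_vec q v + (polar_sin q)^-1 *: vect q).

(** The vector [pi] at energy [E] determines the position up to rotation
    around the pole; in particular the orbit stays in the upper half-sphere. *)
Lemma energy_pi (q v : 'rV[R]_4) : phase_space q v -> kepler_energy gamma q v = E ->
  [/\ 0 < scal q, 0 < polar_sin q, dot (vect q) (vect q) = polar_sin q ^+ 2 &
      dot (pi_vec q v) (pi_vec q v) + a = 2 * gamma * scal q / polar_sin q].
Proof.
move=> ps; have [qq qv q1 qN1] := ps.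
have uu : dot (vect q) (vect q) = 1 - scal q ^+ 2 by rewrite -qq dot4E; ring.
have u0 : 0 < 1 - scal q ^+ 2.
  rewrite -uu lt_neqAle dot_ge0 andbT eq_sym uu subr_eq0 eq_sym sqrf_eq1 negb_or.
  by rewrite q1.
have r0 : 0 < polar_sin q by rewrite sqrtr_gt0.
have r1 : polar_sin q != 0 by rewrite gt_eqF.
have r2 : polar_sin q ^+ 2 = 1 - scal q ^+ 2 by rewrite sqr_sqrtr // ltW.
have uw : dot (vect q) (vect v) = - (scal q * scal v).
  by rewrite -[RHS]addr0 -qv dot4E; ring.
rewrite /kepler_energy /hamiltonian /mu_vec dot_cross -/(polar_sin q) uw uu => e.
have EE : E = - a / 2 by rewrite /curv; field.
have piE : dot (pi_vec q v) (pi_vec q v) + a = 2 * gamma * scal q / polar_sin q.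
  rewrite /pi_vec !dotE (dotC (vect v)) uw uu; apply/eqP.
  move: (etrans e EE) => /eqP; rewrite -subr_eq0 dot4E => /eqP {}e.
  rewrite -subr_eq0 -(mulr0 2) -[X in _ == 2 * X]e; apply/eqP.
  by field.
rewrite r2; split=> //.
have : 0 < 2 * gamma * scal q / polar_sin q by rewrite -piE ltr_wpDl // dot_ge0.
by rewrite pmulr_lgt0 ?invr_gt0 // pmulr_rgt0 // mulr_gt0.
Qed.

Section State.
Variables (q v : 'rV[R]_4).
Hypotheses (ps : phase_space q v) (en : kepler_energy gamma q v = E).

Let s0 : 0 < scal q. Proof. by have [] := energy_pi ps en. Qed.
Let r0 : 0 < polar_sin q. Proof. by have [] := energy_pi ps en. Qed.
Let s1 : scal q != 0. Proof. by rewrite gt_eqF. Qed.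
Let r1 : polar_sin q != 0. Proof. by rewrite gt_eqF. Qed.
Let piE : dot (pi_vec q v) (pi_vec q v) = 2 * gamma * scal q / polar_sin q - a.
Proof. by have [_ _ _ <-] := energy_pi ps en; ring. Qed.
Let r2 : polar_sin q ^+ 2 = 1 - scal q ^+ 2.
Proof. by have [_ _ <- _] := energy_pi ps en; have [<- _ _ _] := ps; rewrite dot4E; ring. Qed.
Let piu : dot (pi_vec q v) (vect q) = - scal v.
Proof.
have [qq qv _ _] := ps.
rewrite /pi_vec !dotE (dotC (vect v)).
transitivity (scal q * (dot q v - scal q * scal v) - scal v * (dot q q - scal q ^+ 2)).
  by rewrite !dot4E; ring.
by rewrite qq qv; ring.
Qed.

Lemma lift_tangent_data : tangent_data E (lift_y0 q) (lift_v0 q v) (lift_y q v) (lift_v q v).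
Proof.
have [_ _ uu _] := energy_pi ps en.
rewrite /tangent_data /on_ellipsoid /lift_y0 /lift_v0 /lift_y /lift_v.
move: piE piu; set P := pi_vec q v; clearbody P => hp hu.
split.
- by rewrite !dotE hp; field; rewrite ?g1 ?s1 ?r1.
- by rewrite !dotE hp hu; field; rewrite ?g1 ?s1 ?r1.
- by rewrite !dotE (dotC (vect q)) hp hu uu; field; rewrite ?g1 ?s1 ?r1.
- by rewrite gtrBl mulr_gt0 ?divr_gt0.
Qed.

Lemma lift_rho : kepler_rho gamma E (lift_y0 q) = polar_sin q / scal q.
Proof. by rewrite /kepler_rho /lift_y0; field; rewrite ?g1 ?a1 ?s1. Qed.

Lemma lift_cos : kepler_cos gamma E (lift_y0 q) = scal q.
Proof.
rewrite /kepler_cos lift_rho.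
have -> : 1 + (polar_sin q / scal q) ^+ 2 = (scal q)^-1 ^+ 2.
  by rewrite expr_div_n r2; field.
by rewrite sqrtr_sqr ger0_norm ?invrK // invr_ge0 ltW.
Qed.

Lemma lift_sin : kepler_sin gamma E (lift_y0 q) = polar_sin q.
Proof. by rewrite /kepler_sin lift_cos lift_rho divfK. Qed.

Lemma lift_mom : kepler_mom E (lift_y0 q) (lift_y q v) = pi_vec q v.
Proof.
rewrite /kepler_mom /lift_y /lift_y0 scalerA -[RHS]scale1r; congr (_ *: _).
have -> : 1 - (1 - a / gamma * (polar_sin q / scal q)) = a * polar_sin q / (gamma * scal q).
  by field; rewrite g1 s1.
by field; rewrite ?g1 ?a1 ?s1 ?r1.
Qed.

Let dirE : kepler_dir (lift_y0 q) (lift_v0 q v) (lift_y q v) (lift_v q v) =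
  (polar_sin q)^-1 *: vect q.
Proof.
rewrite /kepler_dir /lift_v /lift_v0 /lift_y /lift_y0.
have -> : 1 - (1 - a / gamma * (polar_sin q / scal q)) = a * polar_sin q / (gamma * scal q).
  by field; rewrite g1 s1.
set P := pi_vec q v; set u := vect q; clearbody P u.
apply/rowP => i; rewrite !mxE; field.
by rewrite ?g1 ?a1 ?s1 ?r1.
Qed.

(** The passage from tangent vectors to Kepler states inverts the lift. *)
Lemma lift_pos : kepler_pos gamma E (lift_y0 q) (lift_v0 q v) (lift_y q v) (lift_v q v) = q.
Proof.
rewrite /kepler_pos /polar_pos dirE lift_cos lift_sin scalerA divff // scale1r.
exact: vec4E.
Qed.

Lemma lift_vel : kepler_vel gamma E (lift_y0 q) (lift_v0 q v) (lift_y q v) (lift_v q v) = v.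
Proof.
rewrite /kepler_vel /polar_vel dirE lift_cos lift_sin lift_mom.
have -> : kepler_vel0 gamma E (lift_y0 q) (lift_v0 q v) = scal v.
  by rewrite /kepler_vel0 lift_cos /lift_v0; field; rewrite ?g1 ?a1 ?s1.
rewrite scalerA mulfK // /pi_vec subrK scalerA mulVf // scale1r.
exact: vec4E.
Qed.

End State.

Section Orbit.
Variables (I : set R) (q v : R -> 'rV[R]_4).
Hypotheses (orb : kepler_orbit gamma I q v) (en : has_energy gamma E I q v).
Variable (t : R).
Hypothesis It : I t.

Let ps : phase_space (q t) (v t).
Proof. by have [_ _ _ /(_ t It)[]] := orb. Qed.
Let dq : is_derive t 1 q (v t).
Proof. by have [_ _ _ /(_ t It)[]] := orb. Qed.
Let dv : is_derive t 1 v (acceleration gamma (q t) (v t)).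
Proof. by have [_ _ _ /(_ t It)[]] := orb. Qed.

Local Notation c := (scal (q t)).
Local Notation r := (polar_sin (q t)).
Local Notation w0 := (scal (v t)).

Let c0 : 0 < c. Proof. by have [] := energy_pi ps (en It). Qed.
Let r0 : 0 < r. Proof. by have [] := energy_pi ps (en It). Qed.
Let c1 : c != 0. Proof. by rewrite gt_eqF. Qed.
Let r1 : r != 0. Proof. by rewrite gt_eqF. Qed.
Let r2 : r ^+ 2 = 1 - c ^+ 2.
Proof. by have [_ _ <- _] := energy_pi ps (en It); have [<- _ _ _] := ps; rewrite dot4E; ring. Qed.

Let cr1 : c ^+ 2 + r ^+ 2 = 1. Proof. by rewrite r2; ring. Qed.

Let dc : is_derive t 1 (fun s => scal (q s)) w0.
Proof. by have /der_vec4P[] := dq. Qed.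
Let du : is_derive t 1 (fun s => vect (q s)) (vect (v t)).
Proof. by have /der_vec4P[] := dq. Qed.
Let acc0 : scal (acceleration gamma (q t) (v t)) =
  gamma / r ^+ 3 - (dot (v t) (v t) + gamma * (c / r ^+ 3)) * c.
Proof. by rewrite /acceleration scalD scalN !scalZ scal_e0 mulr1. Qed.
Let accv : vect (acceleration gamma (q t) (v t)) =
  - (dot (v t) (v t) + gamma * (c / r ^+ 3)) *: vect (q t).
Proof. by rewrite /acceleration vectD vectN !vectZ vect_e0 scaler0 add0r scaleNr. Qed.
Let dw0 : is_derive t 1 (fun s => scal (v s)) (scal (acceleration gamma (q t) (v t))).
Proof. by have /der_vec4P[] := dv. Qed.
Let dw : is_derive t 1 (fun s => vect (v s)) (vect (acceleration gamma (q t) (v t))).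
Proof. by have /der_vec4P[] := dv. Qed.

Lemma der_pi : is_derive t 1 (fun s => pi_vec (q s) (v s)) (- (gamma / r ^+ 3) *: vect (q t)).
Proof.
apply: der_eq (derDv (derZv dc dw) (derNv (derZv dw0 du))) _.
rewrite accv acc0; set X := dot _ _ + _.
by apply/rowP => i; rewrite !mxE; ring.
Qed.

Lemma der_polar_sin : is_derive t 1 (fun s => polar_sin (q s)) (- (c * w0) / r).
Proof.
have p : 0 < 1 - c * c by rewrite -expr2 -r2 exprn_gt0.
apply: der_eq (der_sqrt (f := fun s => 1 - scal (q s) * scal (q s)) p
  (derB (der_cst t 1 1) (derM dc dc))) _.
have -> : Num.sqrt (1 - c * c) = r by rewrite /polar_sin expr2.
by field.
Qed.

(** Rate of the Kepler parameter with respect to the physical time. *)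
Definition arc_rate (p : 'rV[R]_4) : R := (scal p * polar_sin p)^-1.

Lemma arc_rate_gt0 : 0 < arc_rate (q t).
Proof. by rewrite invr_gt0 mulr_gt0. Qed.

Lemma arc_rate_continuous : {for t, continuous (fun s => arc_rate (q s))}.
Proof.
have n0 : c * r != 0 by rewrite mulf_neq0.
exact: der_cvg (derV (f := fun s => scal (q s) * polar_sin (q s)) n0 (derM dc der_polar_sin)).
Qed.

Lemma time_rate_lift : time_rate gamma E (lift_y0 (q t)) * arc_rate (q t) = 1.
Proof.
rewrite /time_rate (lift_cos ps (en It)) (lift_sin ps (en It)) /arc_rate.
by field; rewrite ?c1 ?r1.
Qed.

Lemma der_lift_y0 : is_derive t 1 (fun s => lift_y0 (q s))
  (arc_rate (q t) * lift_v0 (q t) (v t)).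
Proof.
apply: der_eq (derB (der_cst t 1 1) (derM (der_cst t 1 (a / gamma))
  (derM der_polar_sin (derV (f := fun s => scal (q s)) c1 dc)))) _.
rewrite /arc_rate /lift_v0.
transitivity (a / gamma * (w0 * (c ^+ 2 + r ^+ 2)) / (r * c ^+ 2)).
  by field; rewrite ?g1 ?c1 ?r1.
by rewrite cr1; field; rewrite ?g1 ?c1 ?r1.
Qed.

Lemma der_lift_v0 : is_derive t 1 (fun s => lift_v0 (q s) (v s))
  (- a * (arc_rate (q t) * lift_y0 (q t))).
Proof.
have gc1 : gamma * c != 0 by rewrite mulf_neq0.
apply: der_eq (derM (derM (der_cst t 1 a) dw0)
  (derV (f := fun s => gamma * scal (q s)) gc1 (derM (der_cst t 1 gamma) dc))) _.
have [rr [n [hr cr nn Pn [qE vE]]]] := polar_state_exists ps c0.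
have rE : r = rr by rewrite qE /polar_sin scal_vec4 (polar_radius hr cr).
have speed := polar_speed c0 hr cr nn Pn; rewrite -vE in speed.
have [_ _ _ piE] := energy_pi ps (en It).
have {}piE : dot (pi_vec (q t) (v t)) (pi_vec (q t) (v t)) = 2 * gamma * c / rr - a.
  by rewrite -rE -piE; ring.
rewrite acc0 speed piE rE /arc_rate /lift_y0 rE.
have r1' : rr != 0 by rewrite gt_eqF.
transitivity (a / gamma * (gamma / rr ^+ 3 * (1 - c ^+ 2) / c - (2 * gamma * c / rr - a) / c ^+ 2)).
  by field; rewrite ?g1 ?c1 ?r1'.
have -> : 1 - c ^+ 2 = rr ^+ 2 by rewrite -rE r2.
by field; rewrite ?g1 ?c1 ?r1'.
Qed.

Lemma der_lift_y : is_derive t 1 (fun s => lift_y (q s) (v s))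
  (arc_rate (q t) *: lift_v (q t) (v t)).
Proof.
have gc1 : gamma * c != 0 by rewrite mulf_neq0.
apply: der_eq (derZv (derM der_polar_sin
  (derV (f := fun s => gamma * scal (q s)) gc1 (derM (der_cst t 1 gamma) dc))) der_pi) _.
rewrite /arc_rate /lift_v; set P := pi_vec _ _; set u := vect _; clearbody P u.
apply/rowP => i; rewrite !mxE.
transitivity (- w0 * (c ^+ 2 + r ^+ 2) / (gamma * r * c ^+ 2) * P 0 i
   - (r ^+ 2 * c)^-1 * u 0 i); first by field; rewrite ?g1 ?c1 ?r1.
by rewrite cr1; field; rewrite ?g1 ?c1 ?r1.
Qed.

Lemma der_lift_v : is_derive t 1 (fun s => lift_v (q s) (v s))
  (- a *: (arc_rate (q t) *: lift_y (q t) (v t))).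
Proof.
have gc1 : gamma * c != 0 by rewrite mulf_neq0.
have d1 := der_lift_v0.
have d2 := derNv (derDv (derZv (derM (der_cst t 1 a^-1) d1) der_pi)
  (derZv (derV (f := fun s => polar_sin (q s)) r1 der_polar_sin) du)).
apply: der_ext (der_eq d2 _) => [s|].
  rewrite /lift_v; congr (- (_ *: _ + _)); rewrite /lift_v0.
  by rewrite -!mulrA mulKf.
have wE : vect (v t) = c^-1 *: (pi_vec (q t) (v t) + w0 *: vect (q t)).
  by rewrite /pi_vec subrK scalerA mulVf ?scale1r.
rewrite wE /arc_rate /lift_v0 /lift_y /lift_y0.
set P := pi_vec _ _; set u := vect _; clearbody P u.
apply/rowP => i; rewrite !mxE.
transitivity ((1 - a / gamma * (r / c)) / (c * r) * P 0 i - (r * c)^-1 * P 0 i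
  + w0 / (c * r ^+ 3) * (1 - r ^+ 2 - c ^+ 2) * u 0 i).
  by field; rewrite ?a1 ?g1 ?c1 ?r1.
by rewrite r2; field; rewrite ?g1 ?c1 ?r1.
Qed.

Lemma speed_is_arc_rate :
  Num.sqrt (inner (spherical_metric E affine) (pi_vec (q t) (v t))
     (derive1 (fun s => pi_vec (q s) (v s)) t) (derive1 (fun s => pi_vec (q s) (v s)) t))
  = (scal (q t) * enorm (vect (q t)))^-1.
Proof.
have [_ _ uu piE] := energy_pi ps (en It).
have e : enorm (vect (q t)) = r by rewrite /enorm uu sqrtr_sqr ger0_norm // ltW.
rewrite (derive1_der der_pi) conf_innerE !dotE uu e.
have -> : conf_factor (chart_al E affine) (chart_be E affine) (pi_vec (q t) (v t)) *
  (- (gamma / r ^+ 3) * (- (gamma / r ^+ 3) * r ^+ 2)) = (c * r)^-1 ^+ 2.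
  rewrite /conf_factor /conf_den /= mul1r addrC piE; field.
  by rewrite ?g1 ?c1 ?r1.
by rewrite sqrtr_sqr ger0_norm // invr_ge0 mulr_ge0 // ltW.
Qed.

End Orbit.

Lemma spherical_metric_arclength : arclength_is_kepler_time E gamma (spherical_metric E).
Proof.
move=> I q v orb en p t1 t2 I1 I2 t12.
have [_ iI _ _] := orb.
apply: eq_integral => t; rewrite inE /= in_itv /= => tt.
congr EFin; apply: (speed_is_arc_rate orb en).
exact: interval_between iI I1 I2 tt.
Qed.

End OrbitLift.

(** * Global structure of the orbits *)

Section Endpoint.
Variable R : realType.

Lemma nonpos_at_endpoint (g : R -> R) (u e d : R) : {for u, continuous g} -> 0 < d ->
  (forall h, 0 < h < d -> g (u + e * h) <= 0) -> g u <= 0.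
Proof.
move=> cg d0 gh; rewrite leNgt; apply/negP => gu.
pose k h : R := g (u + e * h).
have ck : {for 0, continuous k}.
  have c1 : {for 0, continuous (fun h : R => u + e * h)}.
    exact: der_cvg (derD (der_cst (0 : R) 1 u) (derM (der_cst (0 : R) 1 e) (der_id (0 : R)))).
  by apply: (continuous_comp c1); rewrite mulr0 addr0.
have : \forall h \near (0 : R), 0 < k h.
  by apply: (cvgr_gt (k 0) ck); rewrite /k mulr0 addr0.
move=> /nbhs_ballP[r /= r0 hr].
pose h := Num.min (r / 2) (d / 2).
have h0 : 0 < h by rewrite lt_min !divr_gt0.
have hr2 : h <= r / 2 by rewrite ge_min lexx.
have hd2 : h <= d / 2 by rewrite ge_min lexx orbT.
have : 0 < k h by apply: hr; rewrite /ball /= sub0r normrN ger0_norm ?ltW //; lra.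
rewrite ltNge gh //; rewrite h0 /=; lra.
Qed.

Lemma cos_2pi_int (m : int) : cos (m%:~R * (pi *+ 2)) = 1 :> R.
Proof.
have h (n : nat) : cos (n%:R * (pi *+ 2)) = 1 :> R.
  by rewrite mulr_natl -[X in cos X]add0r (periodicn (@cosD2pi R)) cos0.
case: m => n; first exact: h.
by rewrite NegzE rmorphN /= mulNr cosN; exact: h.
Qed.

Lemma sin_2pi_int (m : int) : sin (m%:~R * (pi *+ 2)) = 0 :> R.
Proof.
have h (n : nat) : sin (n%:R * (pi *+ 2)) = 0 :> R.
  by rewrite mulr_natl -[X in sin X]add0r (periodicn (@sinD2pi R)) sin0.
case: m => n; first exact: h.
by rewrite NegzE rmorphN /= mulNr sinN; apply/eqP; rewrite oppr_eq0 h.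
Qed.

Lemma cos_lt1 (x : R) : 0 < x < pi *+ 2 -> cos x < 1.
Proof.
move=> /andP[x0 x2].
have s0 : 0 < sin (x / 2).
  by apply: sin_gt0_pi; move: x2; rewrite mulr2n => x2; apply/andP; split; lra.
rewrite (_ : x = (x / 2) *+ 2); last by rewrite mulr2n; field.
rewrite cos_mulr2n cos2sin2 mulr2n.
have := exprn_gt0 2 s0; lra.
Qed.

Lemma angle_exists (x y : R) : x ^+ 2 + y ^+ 2 = 1 -> exists t, cos t = x /\ sin t = y.
Proof.
move=> h; have x1 : -1 <= x <= 1.
  have : 0 <= y ^+ 2 by exact: sqr_ge0.
  by move=> y2; apply/andP; split; nra.
have hx : cos (acos x) = x by apply: acosK; rewrite in_itv.
have hs : sin (acos x) = `|y|.
  by rewrite sin_acos // -sqrtr_sqr; congr Num.sqrt; rewrite -h; ring.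
have [y0|y0] := leP 0 y.
  by exists (acos x); rewrite hs ger0_norm.
by exists (- acos x); rewrite cosN sinN hs ltr0_norm // opprK.
Qed.

End Endpoint.

Section CircleGlobal.
Variables (R : realType) (E : R).
Hypothesis hE : E < 0.
Local Notation a := (curv E).
Let a0 : 0 < a := curv_gt0 hE.
Let k : R := Num.sqrt a.
Let k0 : 0 < k. Proof. by rewrite sqrtr_gt0. Qed.
Let k1 : k != 0. Proof. by rewrite gt_eqF. Qed.
Let k2 : k * k = a. Proof. by rewrite -expr2 sqr_sqrtr // ltW. Qed.

Definition full_turn : R := (pi *+ 2) / k.

Lemma full_turn_gt0 : 0 < full_turn.
Proof. by rewrite divr_gt0 // pmulrn_lgt0 // pi_gt0. Qed.

Variables (y0 v0 : R -> R) (y v : R -> 'rV[R]_3).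
Hypothesis gc : great_circle E a y0 v0 y v.

Let dth (s1 s : R) : is_derive s 1 (fun x => k * (x - s1)) k.
Proof.
apply: der_eq (derM (der_cst s 1 k) (derB (der_id s) (der_cst s 1 s1))) _; ring.
Qed.
Let dC (s1 s : R) : is_derive s 1 (fun x => cos (k * (x - s1))) (- k * sin (k * (s - s1))).
Proof. by apply: der_eq (der_comp (is_derive_cos _) (dth s1 s)) _; ring. Qed.
Let dS (s1 s : R) : is_derive s 1 (fun x => sin (k * (x - s1))) (k * cos (k * (s - s1))).
Proof. by apply: der_eq (der_comp (is_derive_sin _) (dth s1 s)) _; ring. Qed.

Lemma circle_height_explicit s1 s :
  y0 s = cos (k * (s - s1)) * y0 s1 + sin (k * (s - s1)) * (v0 s1 / k).
Proof.
have [gd _] := gc.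
have iT : is_interval [set: R] by [].
pose w x := - k * sin (k * (x - s1)) * y0 s1 + cos (k * (x - s1)) * v0 s1.
apply: (@harmonic_determined R setT a s1 (fun=> 1) y0 v0
  (fun x => cos (k * (x - s1)) * y0 s1 + sin (k * (x - s1)) * (v0 s1 / k)) w) => //;
  first exact: ltW.
- by rewrite subrr mulr0 cos0 sin0 mul1r mul0r addr0.
- by rewrite /w subrr mulr0 cos0 sin0 mulr0 mul0r mul1r add0r.
- by move=> t _; rewrite mul1r; have [] := gd t.
- by move=> t _; rewrite mul1r; have [] := gd t.
- move=> t _; apply: der_eq (derD (derM (dC s1 t) (der_cst t 1 (y0 s1)))
    (derM (dS s1 t) (der_cst t 1 (v0 s1 / k)))) _.
  by rewrite /w; field.
- move=> t _; apply: der_eq (derD (derM (derM (der_cst t 1 (- k)) (dS s1 t)) (der_cst t 1 (y0 s1)))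
    (derM (dC s1 t) (der_cst t 1 (v0 s1)))) _.
  by rewrite -k2; field.
Qed.

Lemma circle_horizontal_explicit s1 s :
  y s = cos (k * (s - s1)) *: y s1 + sin (k * (s - s1)) *: (k^-1 *: v s1).
Proof.
have [gd _] := gc.
have iT : is_interval [set: R] by [].
pose w x := (- k * sin (k * (x - s1))) *: y s1 + cos (k * (x - s1)) *: v s1.
apply: (@harmonic_determined_row R setT a s1 (fun=> 1) 3 y v
  (fun x => cos (k * (x - s1)) *: y s1 + sin (k * (x - s1)) *: (k^-1 *: v s1)) w) => //;
  first exact: ltW.
- by rewrite subrr mulr0 cos0 sin0 scale1r scale0r addr0.
- by rewrite /w subrr mulr0 cos0 sin0 mulr0 scale0r scale1r add0r.
- by move=> t _; rewrite scale1r; have [] := gd t.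
- by move=> t _; rewrite scale1r; have [] := gd t.
- move=> t _; apply: der_eq (derDv (derZv (dC s1 t) (der_cstv t 1 (y s1)))
    (derZv (dS s1 t) (der_cstv t 1 (k^-1 *: v s1)))) _.
  by rewrite /w; apply/rowP => i; rewrite !mxE; field.
- move=> t _; apply: der_eq (derDv (derZv (derM (der_cst t 1 (- k)) (dS s1 t)) (der_cstv t 1 (y s1)))
    (derZv (dC s1 t) (der_cstv t 1 (v s1)))) _.
  by rewrite -k2; apply/rowP => i; rewrite !mxE; field.
Qed.

Lemma circle_periodic (m : int) s :
  y0 (s + m%:~R * full_turn) = y0 s /\ y (s + m%:~R * full_turn) = y s.
Proof.
rewrite (circle_height_explicit s) (circle_horizontal_explicit s).
have -> : k * (s + m%:~R * full_turn - s) = m%:~R * (pi *+ 2).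
  by rewrite /full_turn; field.
by rewrite cos_2pi_int sin_2pi_int mul1r mul0r scale1r scale0r !addr0.
Qed.

(** The height is a harmonic oscillator, and this is twice its energy; the
    largest possible value [a] is attained exactly on the circles through the
    pole. *)
Definition circle_energy (s : R) : R := a * y0 s ^+ 2 + v0 s ^+ 2.

Lemma circle_energy_const s1 s2 : circle_energy s1 = circle_energy s2.
Proof.
have [gd _] := gc.
apply: (@constant_on_interval R setT) => // t _.
have [d _ d' _] := gd t.
have e := derD (derM (der_cst t 1 a) (derM d d)) (derM d' d').
apply: der_ext (der_eq e _) => [x|]; first by rewrite /circle_energy !expr2.
by ring.
Qed.

Lemma circle_energy_le s : circle_energy s <= a.
Proof.
have [_ /(_ s) [e1 e2 e3]] := gc; have := dot_ge0 (cross (y s) (v s)).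
rewrite dot_cross => h.
have {h} : 0 <= a * (a * (dot (y s) (y s) * dot (v s) (v s) - dot (y s) (v s) ^+ 2)).
  by rewrite mulr_ge0 ?(ltW a0) // mulr_ge0 ?(ltW a0).
have -> : a * (a * (dot (y s) (y s) * dot (v s) (v s) - dot (y s) (v s) ^+ 2)) =
  (a * dot (y s) (y s)) * (a * dot (v s) (v s)) - (a * dot (y s) (v s)) ^+ 2 by ring.
have -> : a * dot (y s) (y s) = 1 - y0 s ^+ 2 by rewrite -e1; ring.
have -> : a * dot (v s) (v s) = a - v0 s ^+ 2 by rewrite -[X in X - _]e3; ring.
have -> : a * dot (y s) (v s) = - (y0 s * v0 s) by rewrite -[RHS]addr0 -e2; ring.
have -> : (1 - y0 s ^+ 2) * (a - v0 s ^+ 2) - (- (y0 s * v0 s)) ^+ 2 = a - circle_energy s.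
  by rewrite /circle_energy; ring.
by rewrite subr_ge0.
Qed.

Lemma pole_energy s : y0 s = 1 -> circle_energy s = a.
Proof.
have [_ /(_ s) [e1 e2 e3]] := gc => h.
have ys : y s = 0 by apply: (ellipsoid_pole hE e1); rewrite h expr1n.
move: e2; rewrite ys dot0l mulr0 addr0 h mul1r => v00.
by rewrite /circle_energy h v00; ring.
Qed.

Lemma pole_exists s : circle_energy s = a -> exists s1, y0 s1 = 1.
Proof.
move=> h; have : y0 s ^+ 2 + (v0 s / k) ^+ 2 = 1.
  by apply: (mulfI (mulf_neq0 k1 k1)); rewrite mulr1 [RHS]k2 -[RHS]h /circle_energy -k2; field.
move=> h1; have [t [ct st]] := angle_exists h1.
exists (s + t / k); rewrite (circle_height_explicit s).
have -> : k * (s + t / k - s) = t by field.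
by rewrite ct st -[RHS]h1; ring.
Qed.

Lemma circle_height_from_pole l s : y0 l = 1 -> y0 s = cos (k * (s - l)).
Proof.
move=> h; rewrite (circle_height_explicit l) h mulr1.
have e := pole_energy h; move: e; rewrite /circle_energy h expr1n mulr1.
rewrite -[RHS]addr0 => /addrI/eqP; rewrite sqrf_eq0 => /eqP ->.
by rewrite mul0r mulr0 addr0.
Qed.

Lemma lt1_between_poles l s : y0 l = 1 -> l < s < l + full_turn -> y0 s < 1.
Proof.
move=> h /andP[ls sl]; rewrite (circle_height_from_pole _ h).
apply: cos_lt1; rewrite mulr_gt0 ?subr_gt0 //= mulrC -ltr_pdivlMr // ltrBlDl.
exact: sl.
Qed.

Lemma turn_into_window l s : y0 l = 1 -> y0 s < 1 ->
  exists m : int, l < s + m%:~R * full_turn < l + full_turn.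
Proof.
move=> hl hs; have P0 := full_turn_gt0.
pose x := (s - l) / full_turn; exists (- Num.floor x).
have := floor_itv x; rewrite /= => /andP[f1 f2].
set s' := s + _.
have sE : s' = l + (x - (Num.floor x)%:~R) * full_turn.
  by rewrite /s' /x rmorphN /=; field; rewrite gt_eqF.
have s'1 : y0 s' < 1 by rewrite (circle_periodic _ _).1.
have s'l : s' != l by apply/eqP => e; rewrite e hl ltxx in s'1.
have ls : l <= s' by rewrite sE lerDl mulr_ge0 ?(ltW P0) // subr_ge0.
rewrite lt_neqAle eq_sym s'l ls /= sE ltrD2l.
rewrite gtr_pMl // ltrBlDl -[X in _ + X]/(1%:~R) -intrD1 //.
Qed.

(** Maximal intervals of the arc length free of collisions: everything, or the
    span between two consecutive passages through the pole. *)
Definition window (S : set R) : Prop :=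
  (S = setT /\ forall s, y0 s < 1) \/
  exists2 l, y0 l = 1 & S = [set s | l < s < l + full_turn].

Lemma window_exists s0 : y0 s0 < 1 -> exists2 S, window S & S s0.
Proof.
move=> h0; have [[l hl]|no_pole] := pselect (exists l, y0 l = 1); last first.
  exists setT => //; left; split=> // s.
  have [_ /(_ s) [e1 _ _]] := gc.
  rewrite lt_neqAle -[X in X <= 1]mul1r (ellipsoid_le1 hE affine e1) andbT.
  by apply/eqP => e; apply: no_pole; exists s.
have [m hm] := turn_into_window hl h0.
pose l' := l + (- m)%:~R * full_turn.
have hl' : y0 l' = 1 by rewrite (circle_periodic _ _).1.
exists [set s | l' < s < l' + full_turn]; first by right; exists l'.
move: hm; rewrite /= /l' rmorphN /= mulNr => /andP[h1 h2].
by apply/andP; split; lra.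
Qed.

Lemma window_open S : window S -> open S.
Proof.
move=> [[-> _]|[l _ ->]]; first exact: openT.
have -> : [set s | l < s < l + full_turn] = [set` `]l, l + full_turn[%R].
  by apply/seteqP; split=> s; rewrite /= in_itv.
exact: interval_open.
Qed.

Lemma window_interval S : window S -> is_interval S.
Proof.
move=> [[-> _]//|[l _ ->]] x z /= /andP[x1 x2] /andP[z1 z2] w /andP[xw wz].
by apply/andP; split; lra.
Qed.

Lemma window_lt1 S s : window S -> S s -> y0 s < 1.
Proof. by move=> [[-> h] _|[l h ->] /= hs]; [exact: h|exact: lt1_between_poles h hs]. Qed.

Lemma window_covers S s : window S -> y0 s < 1 ->
  exists2 s', S s' & y0 s' = y0 s /\ y s' = y s.
Proof.
move=> [[-> _]|[l hl ->]] hs; first by exists s.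
have [m hm] := turn_into_window hl hs.
by exists (s + m%:~R * full_turn) => //; exact: circle_periodic.
Qed.

End CircleGlobal.

Section OrbitOfCircle.
Variables (R : realType) (gamma E : R).
Hypotheses (hgamma : 0 < gamma) (hE : E < 0).
Local Notation a := (curv E).
Let a0 : 0 < a := curv_gt0 hE.

Variables (y0 v0 : R -> R) (y v : R -> 'rV[R]_3).
Hypothesis gc : great_circle E a y0 v0 y v.

Let gd (s : R) : [/\ is_derive s 1 y0 (v0 s), is_derive s 1 y (v s),
  is_derive s 1 v0 (- a * y0 s) & is_derive s 1 v (- a *: y s)].
Proof. by have [] := gc. Qed.

Lemma circle_tangent_data s : y0 s < 1 -> tangent_data E (y0 s) (v0 s) (y s) (v s).
Proof. by have [_ /(_ s) []] := gc. Qed.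

Let drho (s : R) : is_derive s 1 (fun x => kepler_rho gamma E (y0 x))
  (gamma / a * - v0 s).
Proof.
have [d _ _ _] := gd s.
apply: der_eq (derM (der_cst s 1 (gamma / a)) (derB (der_cst s 1 1) d)) _; ring.
Qed.

Lemma circle_cos_continuous (s : R) : {for s, continuous (fun x => kepler_cos gamma E (y0 x))}.
Proof.
pose f x := 1 + kepler_rho gamma E (y0 x) * kepler_rho gamma E (y0 x).
have f0 : 0 < f s by rewrite /f -expr2 one_plus_rho2_gt0.
have sq0 : Num.sqrt (f s) != 0 by rewrite gt_eqF // sqrtr_gt0.
exact: der_cvg (derV (f := fun x => Num.sqrt (f x)) sq0
  (der_sqrt f0 (derD (der_cst s 1 1) (derM (drho s) (drho s))))).
Qed.

Lemma circle_rate_continuous (s : R) : {for s, continuous (fun x => time_rate gamma E (y0 x))}.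
Proof.
have cr : {for s, continuous (fun x => kepler_rho gamma E (y0 x))} := der_cvg (drho s).
have cc := circle_cos_continuous (s := s).
have h : {for s, continuous (fun x => kepler_rho gamma E (y0 x) * kepler_cos gamma E (y0 x)
   * kepler_cos gamma E (y0 x))}.
  by apply: continuousM; [apply: continuousM|].
exact: h.
Qed.

Lemma time_rate_gt0 s : y0 s < 1 -> 0 < time_rate gamma E (y0 s).
Proof. by move=> h; rewrite mulr_gt0 ?kepler_sin_gt0 ?kepler_cos_gt0. Qed.

Lemma time_rateE s : time_rate gamma E (y0 s) =
  kepler_rho gamma E (y0 s) / (1 + kepler_rho gamma E (y0 s) ^+ 2).
Proof.
rewrite /time_rate /kepler_sin -mulrA -expr2 /kepler_cos exprVn sqr_sqrtr //.
exact/ltW/one_plus_rho2_gt0.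
Qed.

(** Physical time along the circle, vanishing speed at the pole included. *)
Lemma time_exists (s0 t0 : R) : exists T, T s0 = t0 /\
  forall s : R, is_derive s 1 T (time_rate gamma E (y0 s)).
Proof.
have iT : is_interval [set: R] by [].
have [F dF] := @primitive_on_interval R setT (fun x => time_rate gamma E (y0 x)) openT
  iT (fun t _ => @circle_rate_continuous t).
exists (fun s => F s - F s0 + t0); split; first by rewrite subrr add0r.
move=> s; apply: der_eq (derD (derB (dF s I) (der_cst s 1 (F s0))) (der_cst s 1 t0)) _.
ring.
Qed.

(** A circle that misses the pole is traversed infinitely often: its rate is
    bounded below. *)
Lemma time_onto (T : R -> R) : (forall s : R, is_derive s 1 T (time_rate gamma E (y0 s))) ->
  (forall s, y0 s < 1) -> T @` setT = setT.
Proof.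
move=> dT lt1; have iR : is_interval [set: R] by [].
have C1 : circle_energy E y0 v0 0 < a.
  rewrite lt_neqAle (circle_energy_le hE gc) andbT; apply/eqP => e.
  by have [s1 hs] := pole_exists hE gc e; have := lt1 s1; rewrite hs ltxx.
pose M := Num.sqrt (circle_energy E y0 v0 0 / a).
have C0 : 0 <= circle_energy E y0 v0 0.
  by rewrite addr_ge0 ?sqr_ge0 // mulr_ge0 ?sqr_ge0 // ltW.
have M1 : M < 1.
  by rewrite -sqrtr1 ltr_sqrt // ltr_pdivrMr // mul1r.
have yM s : y0 s <= M.
  apply: le_trans (ler_norm _) _; rewrite -sqrtr_sqr ler_wsqrtr // ler_pdivlMr //.
  rewrite (circle_energy_const gc 0 s) /circle_energy mulrC lerDl; exact: sqr_ge0.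
have yN s : -1 <= y0 s.
  have [_ /(_ s) [e1 _ _]] := gc; have := ellipsoid_le1 hE inverted e1.
  by rewrite /= mulN1r lerNl.
pose rmin := gamma / a * (1 - M); pose rmax := gamma / a * 2.
have ga0 : 0 < gamma / a by rewrite divr_gt0.
have rmin0 : 0 < rmin by rewrite mulr_gt0 // subr_gt0.
pose del := rmin / (1 + rmax ^+ 2).
have B0 : 0 < 1 + rmax ^+ 2 by rewrite ltr_pwDl // sqr_ge0.
have del0 : 0 < del by rewrite divr_gt0.
have fdel s : del <= time_rate gamma E (y0 s).
  rewrite time_rateE; have p := one_plus_rho2_gt0 gamma E (y0 s).
  have r1 : rmin <= kepler_rho gamma E (y0 s).
    by rewrite /rmin /kepler_rho ler_pM2l // lerD2l lerN2.
  have r2 : kepler_rho gamma E (y0 s) <= rmax.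
    rewrite /rmax /kepler_rho ler_pM2l //; have := yN s; lra.
  rewrite /del ler_pM ?invr_ge0 ?(ltW rmin0) ?(ltW B0) // lef_pV2 ?posrE //.
  by rewrite lerD2l ler_sqr ?nnegrE // ?(le_trans (ltW rmin0)) // (le_trans r1).
have grow s1 s2 : s1 < s2 -> del * (s2 - s1) <= T s2 - T s1.
  move=> h; have [c _ ->] := @mvt_interval R setT T _ s1 s2 iR
    (fun t _ => dT t) I I h.
  by rewrite ler_pM2r ?subr_gt0.
have [g [_ iT _ _]] := @inverse_on_interval R setT T _ openT iR
  (fun t _ => dT t) (fun t _ => time_rate_gt0 (lt1 t)).
apply/seteqP; split=> // t _.
pose s := (`|t - T 0| + 1) / del.
have s0 : 0 < s by rewrite divr_gt0 // ltr_wpDl.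
have sd : del * s = `|t - T 0| + 1 by rewrite /s mulrC divfK // gt_eqF.
have h1 := grow 0 s s0.
have s0N : - s < 0 by rewrite oppr_lt0.
have h2 := grow (- s) 0 s0N.
apply: (iT (T (- s)) (T s)); [by exists (- s)|by exists s|].
move: h1 h2; rewrite subr0 sub0r opprK sd => h1 h2.
have := ler_norm (t - T 0); have := ler_norm (- (t - T 0)); rewrite normrN => n1 n2.
by apply/andP; split; lra.
Qed.

Lemma time_nondecreasing (T : R -> R) :
  (forall s : R, is_derive s 1 T (time_rate gamma E (y0 s))) ->
  forall s1 s2, s1 <= s2 -> T s1 <= T s2.
Proof.
move=> dT s1 s2; rewrite le_eqVlt => /predU1P[-> //|s12].
have iR : is_interval [set: R] by [].
have [c _ e] := mvt_interval iR (fun t _ => dT t) I I s12.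
rewrite -subr_ge0 e mulr_ge0 ?subr_ge0 ?(ltW s12) // time_rateE.
rewrite divr_ge0 ?(ltW (one_plus_rho2_gt0 _ _ _)) // mulr_ge0 ?divr_ge0 ?(ltW hgamma) ?(ltW a0) //.
have [_ /(_ c) [e1 _ _]] := gc; have := ellipsoid_le1 hE affine e1.
by rewrite /= mul1r subr_ge0.
Qed.

Section Window.
Variables (S : set R) (T : R -> R).
Hypotheses (wS : window E y0 S).
Hypothesis dT : forall s : R, is_derive s 1 T (time_rate gamma E (y0 s)).

Let lt1 s : S s -> y0 s < 1 := @window_lt1 R E hE y0 v0 y v gc S s wS.

(** The orbit is the Kepler state of the circle as a function of the inverse of the
    physical time [T]. It is maximal because an extension would have to be at
    [e0] at the end of the window. *)
Lemma kepler_orbit_of_circle s0 : S s0 -> exists tau q w,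
  [/\ maximal_kepler_orbit gamma (T @` S) q w,
      has_energy gamma E (T @` S) q w,
      forall s, S s -> tau (T s) = s,
      forall s, S s -> is_derive (T s) 1 tau (time_rate gamma E (y0 s))^-1 &
      forall s, S s -> q (T s) = kepler_pos gamma E (y0 s) (v0 s) (y s) (v s) /\
                       w (T s) = kepler_vel gamma E (y0 s) (v0 s) (y s) (v s)].
Proof.
move=> Ss0; have oS := window_open wS; have iS := window_interval wS.
have [tau [oT iT tauK dtau]] := inverse_on_interval oS iS (fun s _ => dT s)
  (fun s Ss => time_rate_gt0 (lt1 Ss)).
pose Q s := kepler_pos gamma E (y0 s) (v0 s) (y s) (v s).
pose W s := kepler_vel gamma E (y0 s) (v0 s) (y s) (v s).
exists tau, (fun t => Q (tau t)), (fun t => W (tau t)).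
have state s : S s -> tangent_data E (y0 s) (v0 s) (y s) (v s).
  by move=> /lt1/circle_tangent_data.
have orb : kepler_orbit gamma (T @` S) (fun t => Q (tau t)) (fun t => W (tau t)).
  split=> //; first by exists (T s0), s0.
  move=> _ [s Ss <-]; have rn0 : time_rate gamma E (y0 s) != 0.
    by rewrite gt_eqF // time_rate_gt0 // lt1.
  have [d1 d2 d3 d4] := gd s.
  rewrite tauK //; split.
  - exact: kepler_state_phase_space (state s Ss).
  - have dQ : is_derive (tau (T s)) 1 Q (time_rate gamma E (y0 s) *: W s).
      by rewrite tauK //; exact: der_kepler_pos d1 d2 d3 d4 (state s Ss).
    apply: der_eq (der_compv dQ (dtau s Ss)) _.
    by rewrite scalerA mulVf // scale1r.
  - have dW : is_derive (tau (T s)) 1 W (time_rate gamma E (y0 s) *: acceleration gamma (Q s) (W s)).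
      by rewrite tauK //; exact: der_kepler_vel d1 d2 d3 d4 (state s Ss).
    apply: der_eq (der_compv dW (dtau s Ss)) _.
    by rewrite scalerA mulVf // scale1r.
split=> //; last by move=> s Ss; rewrite !tauK.
  split=> // J q' w' orb' IJ agree.
  have [[ST lt1']|[l hl Sl]] := wS.
    by rewrite ST time_onto.
  (* [kepler_cos] is continuous along the circle and equals 1 at the pole *)
  have [_ iJ _ ps'] := orb'.
  have no_collision u e d : y0 u = 1 -> 0 < d ->
      (forall h, 0 < h < d -> S (u + e * h)) -> J (T u) -> False.
    move=> hu d0 near_u Ju.
    have [[_ _ q1 _] dq' _] := ps' _ Ju.
    have /der_vec4P[dscal _] := dq'.
    pose g s := scal (q' (T s)) - kepler_cos gamma E (y0 s).
    have cg : {for u, continuous g}.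
      apply: continuousB; last exact: circle_cos_continuous.
      exact: (der_cvg (der_comp (f := fun t => scal (q' t)) dscal (dT u))).
    have g0 h : 0 < h < d -> g (u + e * h) = 0.
      move=> /near_u Sh; have [e1 _] := agree (T (u + e * h)) (ex_intro2 _ _ _ Sh erefl).
      by rewrite /g e1 tauK // scal_vec4 subrr.
    have gle : g u <= 0.
      by apply: (nonpos_at_endpoint (e := e) cg d0) => h /g0 ->.
    have gge : - g u <= 0.
      apply: (nonpos_at_endpoint (g := fun s => - g s) (e := e) (d := d)) => //.
        exact: continuousN.
      by move=> h /g0 ->; rewrite oppr0.
    have : g u = 0 by lra.
    rewrite /g /kepler_cos /kepler_rho hu subrr mulr0 expr0n addr0 sqrtr1 invr1.
    by move/eqP; rewrite subr_eq0; apply/negP.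
  have P0 := full_turn_gt0 hE.
  have J0 : J (T s0) by apply: IJ; exists s0.
  move=> t Jt; apply: contrapT => nIt.
  have out s : S s -> t != T s.
    by move=> Ss; apply/eqP => e; apply: nIt; exists s.
  have cT u : {for u, continuous (fun s => T s - t)}.
    exact: der_cvg (derB (dT u) (der_cst u 1 t)).
  have inS s : l < s < l + full_turn E -> S s by rewrite Sl.
  have ls0 : l < s0 < l + full_turn E by move: Ss0; rewrite Sl.
  have [ls0l ls0r] := andP ls0.
  have Tl : T l <= T s0 := time_nondecreasing dT (ltW ls0l).
  have Tr : T s0 <= T (l + full_turn E) := time_nondecreasing dT (ltW ls0r).
  have hr : y0 (l + full_turn E) = 1.
    by have [+ _] := circle_periodic hE gc 1 l; rewrite mul1r => ->.
  have [tlt|tgt|te] := ltgtP t (T s0); last by have := out s0 Ss0; rewrite te eqxx.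
    have above s : S s -> t < T s.
      move=> Ss; rewrite lt_neqAle out //= leNgt.
      apply/negP => h; apply: nIt.
      by apply: (iT (T s) (T s0)); [exists s|exists s0|rewrite !ltW].
    have tl : - (T l - t) <= 0.
      apply: (nonpos_at_endpoint (g := fun s => - (T s - t)) (e := 1) (d := full_turn E)) => //.
        by apply: continuousN; exact: cT.
      move=> h /andP[h1 h2]; rewrite oppr_le0 subr_ge0; apply/ltW/above/inS.
      by rewrite mul1r; apply/andP; split; lra.
    apply: (no_collision l 1 (full_turn E)) => //.
      by move=> h /andP[h3 h4]; apply: inS; rewrite mul1r; apply/andP; split; lra.
    by apply: (iJ t (T s0)) => //; apply/andP; split; lra.
  have below s : S s -> T s < t.
    move=> Ss; rewrite lt_neqAle eq_sym out //= leNgt.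
    apply/negP => h; apply: nIt.
    by apply: (iT (T s0) (T s)); [exists s0|exists s|rewrite !ltW].
  have tr : T (l + full_turn E) - t <= 0.
    apply: (nonpos_at_endpoint (g := fun s => T s - t) (e := -1) (d := full_turn E)) => //.
    move=> h /andP[h1 h2]; rewrite subr_le0; apply/ltW/below/inS.
    by rewrite mulN1r; apply/andP; split; lra.
  apply: (no_collision (l + full_turn E) (-1) (full_turn E)) => //.
    by move=> h /andP[h3 h4]; apply: inS; rewrite mulN1r; apply/andP; split; lra.
  by apply: (iJ (T s0) t) => //; apply/andP; split; lra.
move=> _ [s Ss <-]; rewrite tauK //.
exact: kepler_state_energy (state s Ss).
Qed.

End Window.
End OrbitOfCircle.

(** * Geodesics and Kepler orbits trace the same curves *)

Section KeplerGeodesics.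
Variables (R : realType) (gamma E : R).
Hypotheses (hgamma : 0 < gamma) (hE : E < 0).
Local Notation a := (curv E).
Let a0 : 0 < a := curv_gt0 hE.

Lemma stereoK (y0 : R) (y : 'rV[R]_3) : on_ellipsoid E y0 y ->
  height E (stereo E y0 y) = y0 /\ horizontal E (stereo E y0 y) = y.
Proof.
move=> h; rewrite /stereo; have a1 : a != 0 by rewrite gt_eqF.
case: eqVneq => [e|ne] /=.
  by rewrite e; split=> //; apply/esym/(ellipsoid_pole hE h); rewrite e expr1n.
have h1 : 0 < 1 - y0.
  by rewrite subr_gt0 lt_neqAle ne -(mul1r y0) (ellipsoid_le1 hE affine h).
have h0 : 1 - y0 != 0 by rewrite gt_eqF.
have yy : dot y y = (1 - y0 ^+ 2) / a by rewrite -h; field.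
have den : dot ((a / (1 - y0)) *: y) ((a / (1 - y0)) *: y) = 2 * a / (1 - y0) - a.
  by rewrite !dotE yy; field; rewrite h0.
rewrite den subrK; split; first by field; rewrite ?h0 ?a1.
by rewrite scalerA -[RHS]scale1r; congr (_ *: _); field; rewrite ?h0 ?a1.
Qed.

Lemma stereo_lt1 (y0 : R) (y : 'rV[R]_3) : y0 < 1 ->
  stereo E y0 y = Some (kepler_mom E y0 y).
Proof. by move=> h; rewrite /stereo lt_eqF. Qed.

Lemma circle_nonconstant (y0 v0 : R -> R) (y v : R -> 'rV[R]_3) kap :
  0 < kap -> great_circle E kap y0 v0 y v ->
  exists s t, stereo E (y0 s) (y s) <> stereo E (y0 t) (y t).
Proof.
move=> kap0 [gd gY]; apply: contrapT => h.
have same s : y0 s = y0 0 /\ y s = y 0.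
  have e : stereo E (y0 s) (y s) = stereo E (y0 0) (y 0).
    by apply: contrapT => ne; apply: h; exists s, 0.
  have [es _ _] := gY s; have [e0 _ _] := gY 0.
  have [h1 h2] := stereoK es; have [h3 h4] := stereoK e0.
  by split; [rewrite -h1 e|rewrite -h2 e].
have [d1 d2 _ _] := gd 0; have [_ _ hk] := gY 0.
have v00 : v0 0 = 0.
  exact: der_unique d1 (der_ext (fun s => esym (same s).1) (der_cst (0 : R) 1 (y0 0))).
have v1 : v 0 = 0.
  exact: der_unique d2 (der_ext (fun s => esym (same s).2) (der_cstv (0 : R) 1 (y 0))).
by move: hk kap0; rewrite v00 v1 dot0l expr0n mulr0 addr0 => <-; rewrite ltxx.
Qed.

Section Hodograph.
Variables (y0 v0 : R -> R) (y v : R -> 'rV[R]_3) (S : set R) (T : R -> R).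
Variables (q w : R -> 'rV[R]_4).
Hypotheses (gc : great_circle E a y0 v0 y v) (wS : window E y0 S) (S0 : S !=set0).
Hypothesis state : forall s, S s ->
  q (T s) = kepler_pos gamma E (y0 s) (v0 s) (y s) (v s) /\
  w (T s) = kepler_vel gamma E (y0 s) (v0 s) (y s) (v s).

Let data s : S s -> tangent_data E (y0 s) (v0 s) (y s) (v s).
Proof. by move=> Ss; apply: (circle_tangent_data gc); exact: (window_lt1 hE gc wS Ss). Qed.

Lemma circle_pi s : S s -> stereo E (y0 s) (y s) = Some (pi_vec (q (T s)) (w (T s))).
Proof.
move=> Ss; have [-> ->] := state Ss.
rewrite kepler_state_pi stereo_lt1 //.
by have [] := data Ss.
Qed.

(** Angular momentum zero is a property of the circle: its square is a multiple of
    [a - circle_energy]. *)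
Lemma circle_mu s s' : S s ->
  (mu_vec (q (T s)) (w (T s)) = 0) <-> circle_energy E y0 v0 s' = a.
Proof.
move=> Ss; rewrite (circle_energy_const gc s' s); have [-> ->] := state Ss.
have := kepler_state_mu hgamma hE (data Ss).
have -> : a * (1 - y0 s ^+ 2) - v0 s ^+ 2 = a - circle_energy E y0 v0 s.
  by rewrite /circle_energy; ring.
set mu := mu_vec _ _ => hmu; split=> [m0|e].
  move: hmu; rewrite m0 dot0l => /esym/eqP.
  by rewrite mulf_eq0 sqrf_eq0 gt_eqF ?divr_gt0 //= subr_eq0 => /eqP ->.
by apply/eqP; rewrite -dot_eq0 hmu e subrr mulr0.
Qed.

Lemma hodograph_of_circle :
  hodograph (T @` S) q w = range (fun s => stereo E (y0 s) (y s)).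
Proof.
apply/seteqP; split=> x.
- move=> [[_ [s Ss <-] ->]|[-> mu0]]; first by exists s => //; exact: circle_pi.
  have [s Ss] := S0.
  have /(circle_mu s Ss) e : mu_vec (q (T s)) (w (T s)) = 0 by apply: mu0; exists s.
  have [l hl] := pole_exists hE gc e.
  by exists l => //; rewrite /stereo hl eqxx.
- move=> [s _ <-].
  have [lt1|ge1] := ltP (y0 s) 1.
    have [s' Ss' [e1 e2]] := window_covers hE gc wS lt1.
    by left; exists (T s'); [exists s'|rewrite -e1 -e2; exact: circle_pi].
  have hs : y0 s = 1.
    apply/eqP; rewrite eq_le ge1 andbT -(mul1r (y0 s)).
    by have [_ /(_ s) [e1 _ _]] := gc; exact: (ellipsoid_le1 hE affine e1).
  right; split; first by rewrite /stereo hs eqxx.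
  move=> _ [s' Ss' <-]; apply/(circle_mu s Ss'); exact: (pole_energy hE gc hs).
Qed.

End Hodograph.

(** The lift of an orbit and the great circle with the same initial data solve the
    same linear equation in the Kepler parameter [sig]. *)
Lemma circle_of_orbit (I : set R) (q v : R -> 'rV[R]_4) t0 :
  kepler_orbit gamma I q v -> has_energy gamma E I q v -> I t0 ->
  exists y0 v0 y1 v1 sig, great_circle E a y0 v0 y1 v1 /\
    [/\ sig t0 = 0, forall t, I t -> is_derive t 1 sig (arc_rate (q t)),
      forall t, I t -> y0 (sig t) = lift_y0 gamma E (q t) /\
                       v0 (sig t) = lift_v0 gamma E (q t) (v t) &
      forall t, I t -> y1 (sig t) = lift_y gamma (q t) (v t) /\
                       v1 (sig t) = lift_v gamma (q t) (v t)].
Proof.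
move=> orb en It0; have [oI iI _ ps] := orb.
have data t : I t -> tangent_data E (lift_y0 gamma E (q t)) (lift_v0 gamma E (q t) (v t))
    (lift_y gamma (q t) (v t)) (lift_v gamma (q t) (v t)).
  by move=> It; have [p _ _] := ps t It; exact: (lift_tangent_data hgamma hE p (en t It)).
have [F dF] := primitive_on_interval oI iI (f := fun t => arc_rate (q t))
  (fun t It => arc_rate_continuous hgamma hE orb en It).
pose sig t := F t - F t0.
have sig0 : sig t0 = 0 by rewrite /sig subrr.
have dsig t : I t -> is_derive t 1 sig (arc_rate (q t)).
  by move=> It; apply: der_eq (derB (dF t It) (der_cst t 1 (F t0))) _; rewrite subr0.
have [d1 d2 d3 _] := data t0 It0.
have := great_circle_exists hE 0 d1 d2; rewrite d3.
move=> [y0 [v0 [y1 [v1 [gc [e1 e2 e3 e4]]]]]].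
exists y0, v0, y1, v1, sig; split=> //; have [gd _] := gc.
have a0' : 0 <= a by exact: ltW.
pose f t := arc_rate (q t).
pose l0 t := lift_y0 gamma E (q t); pose m0 t := lift_v0 gamma E (q t) (v t).
pose l1 t := lift_y gamma (q t) (v t); pose m1 t := lift_v gamma (q t) (v t).
have c1 s : I s -> is_derive s 1 (fun t => y0 (sig t)) (f s * v0 (sig s)).
  move=> Is; have [d _ _ _] := gd (sig s).
  by apply: der_eq (der_comp d (dsig s Is)) _; rewrite mulrC.
have c2 s : I s -> is_derive s 1 (fun t => v0 (sig t)) (- a * (f s * y0 (sig s))).
  move=> Is; have [_ _ d _] := gd (sig s).
  by apply: der_eq (der_comp d (dsig s Is)) _; rewrite /f; ring.
have c3 s : I s -> is_derive s 1 (fun t => y1 (sig t)) (f s *: v1 (sig s)).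
  move=> Is; have [_ d _ _] := gd (sig s); exact: (der_compv d (dsig s Is)).
have c4 s : I s -> is_derive s 1 (fun t => v1 (sig t)) (- a *: (f s *: y1 (sig s))).
  move=> Is; have [_ _ _ d] := gd (sig s).
  by apply: der_eq (der_compv d (dsig s Is)) _; rewrite !scalerA mulrC.
have k1 s : I s -> is_derive s 1 l0 (f s * m0 s).
  by move=> Is; exact: (der_lift_y0 hgamma hE orb en Is).
have k2 s : I s -> is_derive s 1 m0 (- a * (f s * l0 s)).
  by move=> Is; exact: (der_lift_v0 hgamma hE orb en Is).
have k3 s : I s -> is_derive s 1 l1 (f s *: m1 s).
  by move=> Is; exact: (der_lift_y hgamma hE orb en Is).
have k4 s : I s -> is_derive s 1 m1 (- a *: (f s *: l1 s)).
  by move=> Is; exact: (der_lift_v hgamma hE orb en Is).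
have scaled (u w : R -> R) (s : R) : is_derive s 1 u (f s * w s) ->
    is_derive s 1 (fun t => - a * u t) (- a * (f s * w s)).
  by move=> d; apply: der_eq (derM (der_cst s 1 (- a)) d) _; ring.
have scaledv (u w : R -> 'rV[R]_3) (s : R) : is_derive s 1 u (f s *: w s) ->
    is_derive s 1 (fun t => - a *: u t) (- a *: (f s *: w s)).
  move=> d; apply: der_eq (derZv (der_cst s 1 (- a)) d) _.
  by rewrite scale0r add0r.
have swap x y : - a * (x * y) = x * (- a * y) by ring.
have swapv x (y : 'rV[R]_3) : - a *: (x *: y) = x *: (- a *: y).
  by rewrite !scalerA mulrC.
split=> // t It.
- split.
  + apply: (@harmonic_determined R I a t0 f (fun t => y0 (sig t)) (fun t => v0 (sig t))
      l0 m0 a0' iI It0 _ _ c1 c2 k1 k2 t It); by rewrite sig0.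
  + refine (@harmonic_determined R I a t0 f (fun t => v0 (sig t)) (fun t => - a * y0 (sig t))
      m0 (fun t => - a * l0 t) a0' iI It0 _ _ _ _ _ _ t It).
    * by rewrite sig0.
    * by rewrite sig0 e1.
    * by move=> s Is; rewrite -swap; exact: (c2 s Is).
    * by move=> s Is; exact: (scaled _ (fun t => v0 (sig t)) s (c1 s Is)).
    * by move=> s Is; rewrite -swap; exact: (k2 s Is).
    * by move=> s Is; exact: (scaled _ m0 s (k1 s Is)).
- split.
  + apply: (@harmonic_determined_row R I a t0 f 3 (fun t => y1 (sig t)) (fun t => v1 (sig t))
      l1 m1 a0' iI It0 _ _ c3 c4 k3 k4 t It); by rewrite sig0.
  + refine (@harmonic_determined_row R I a t0 f 3 (fun t => v1 (sig t))
      (fun t => - a *: y1 (sig t)) m1 (fun t => - a *: l1 t) a0' iI It0 _ _ _ _ _ _ t It).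
    * by rewrite sig0.
    * by rewrite sig0 e3.
    * by move=> s Is; rewrite -swapv; exact: (c4 s Is).
    * by move=> s Is; exact: (scaledv _ (fun t => v1 (sig t)) s (c3 s Is)).
    * by move=> s Is; rewrite -swapv; exact: (k4 s Is).
    * by move=> s Is; exact: (scaledv _ m1 s (k3 s Is)).
Qed.

(** The Kepler parameter [sig] inverts [T], so the orbit is a restriction of the
    one constructed from its circle, and maximality gives equality. *)
Lemma maximal_orbit_is_circle (I : set R) (q v : R -> 'rV[R]_4) :
  maximal_kepler_orbit gamma I q v -> has_energy gamma E I q v ->
  exists y0 v0 y1 v1 S T sig, [/\ great_circle E a y0 v0 y1 v1, window E y0 S /\ S !=set0,
    I = T @` S,
    forall s, S s -> q (T s) = kepler_pos gamma E (y0 s) (v0 s) (y1 s) (v1 s) /\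
                     v (T s) = kepler_vel gamma E (y0 s) (v0 s) (y1 s) (v1 s) &
    forall t, I t -> [/\ S (sig t), T (sig t) = t & is_derive t 1 sig (arc_rate (q t))]].
Proof.
move=> [orb maxI] en; have [oI iI [t0 It0] ps] := orb.
have [y0 [v0 [y1 [v1 [sig [gc [sig0 dsig sy sv]]]]]]] := circle_of_orbit orb en It0.
have lt1 t : I t -> y0 (sig t) < 1.
  move=> It; have [-> _] := sy t It; have [p _ _] := ps t It.
  by have [] := lift_tangent_data hgamma hE p (en t It).
have lt0 : y0 0 < 1 by rewrite -sig0; exact: lt1.
have [S wS S00] := window_exists hE gc lt0.
have [T [T0 dT]] := time_exists gamma gc 0 t0.
have arc0 t (It : I t) : 0 < arc_rate (q t) := arc_rate_gt0 hgamma hE orb en It.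
have [_ [_ iSig _ _]] := inverse_on_interval oI iI dsig arc0.
have Ssig t : I t -> S (sig t).
  move=> It; case: wS => [[-> _]//|[l hl Sl]].
  have P0 := full_turn_gt0 hE.
  have hr : y0 (l + full_turn E) = 1.
    by have [+ _] := circle_periodic hE gc 1 l; rewrite mul1r => ->.
  have avoid p : y0 p = 1 -> ~ (sig @` I) p.
    by move=> hp [t' It' e]; have := lt1 t' It'; rewrite e hp ltxx.
  have sI : (sig @` I) (sig t) by exists t.
  have s0I : (sig @` I) 0 by exists t0.
  move: S00; rewrite Sl /= => /andP[l0 r0].
  apply/andP; split; rewrite ltNge; apply/negP => h.
    by apply: (avoid l hl); apply: (iSig (sig t) 0) => //; rewrite h ltW.
  by apply: (avoid _ hr); apply: (iSig 0 (sig t)) => //; rewrite h ltW.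
have Tsig t : I t -> T (sig t) = t.
  move=> It; apply/eqP; rewrite -subr_eq0; apply/eqP.
  have -> : 0 = T (sig t0) - t0 by rewrite sig0 T0 subrr.
  apply: (constant_on_interval (F := fun t => T (sig t) - t) iI _ It It0) => s Is.
  apply: der_eq (derB (der_comp (dT (sig s)) (dsig s Is)) (der_id s)) _.
  have [-> _] := sy s Is; have [p _ _] := ps s Is.
  by rewrite (time_rate_lift hgamma hE orb en Is) subrr.
have [tau [q' [w' [[orb' max'] en' tauK dtau state]]]] :=
  kepler_orbit_of_circle hgamma hE gc wS dT S00.
have agree t : I t -> q' t = q t /\ w' t = v t.
  move=> It; have [p _ _] := ps t It; have e := en t It.
  have [h1 h2] := state _ (Ssig t It); rewrite Tsig // in h1 h2.
  have [e1 e2] := sy t It; have [e3 e4] := sv t It.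
  rewrite h1 h2 e1 e2 e3 e4.
  by rewrite (lift_pos hgamma hE p e) (lift_vel hgamma hE p e).
have sub : I `<=` T @` S by move=> t It; exists (sig t); [exact: Ssig|exact: Tsig].
have II : I = T @` S by apply/seteqP; split=> //; exact: (maxI _ _ _ orb' sub agree).
exists y0, v0, y1, v1, S, T, sig; split=> //; first by split=> //; exists 0.
- move=> s Ss; have IT : I (T s) by rewrite II; exists s.
  have [<- <-] := agree _ IT; exact: state.
- by move=> t It; split; [exact: Ssig|exact: Tsig|exact: dsig].
Qed.

Lemma great_circle_rescale kap (y0 v0 : R -> R) (y v : R -> 'rV[R]_3) (c : R) :
  great_circle E kap y0 v0 y v ->
  great_circle E (c ^+ 2 * kap) (fun s => y0 (c * s)) (fun s => c * v0 (c * s))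
    (fun s => y (c * s)) (fun s => c *: v (c * s)).
Proof.
move=> [gd gY].
have dc (s : R) : is_derive s 1 (fun x => c * x) c.
  by apply: der_eq (derM (der_cst s 1 c) (der_id s)) _; ring.
split=> s.
  have [d1 d2 d3 d4] := gd (c * s); split.
  - by apply: der_eq (der_comp d1 (dc s)) _; rewrite mulrC.
  - exact: (der_compv d2 (dc s)).
  - by apply: der_eq (derM (der_cst s 1 c) (der_comp d3 (dc s))) _; ring.
  - apply: der_eq (derZv (der_cst s 1 c) (der_compv d4 (dc s))) _.
    by rewrite scale0r add0r !scalerA; congr (_ *: _); ring.
have [e1 e2 e3] := gY (c * s); split=> //; rewrite !dotE.
- by transitivity (c * (y0 (c * s) * v0 (c * s) + a * dot (y (c * s)) (v (c * s))));
    [ring|rewrite e2 mulr0].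
- by rewrite -[in RHS]e3; ring.
Qed.

Lemma spherical_geodesics_are_kepler_circles :
  geodesics_are_kepler_circles E gamma (spherical_metric E).
Proof.
split.
- move=> c [gc [s [t cst]]].
  have [kap [y0 [v0 [y [v [gY h]]]]]] :=
    geodesic_extends hE openT (fun _ _ _ _ _ _ => I) (ex_intro _ 0 I) gc.
  have ch s' : c s' = stereo E (y0 s') (y s') by rewrite h.
  have kap0 : 0 < kap.
    have [gd gE] := gY; have [_ _ e] := gE 0.
    have : 0 <= kap by rewrite -e addr_ge0 ?sqr_ge0 // mulr_ge0 ?dot_ge0 // ltW.
    rewrite le_eqVlt => /predU1P[k0|//]; exfalso; apply: cst.
    have zero r : v0 r = 0 /\ v r = 0.
      have [_ _ /eqP] := gE r.
      rewrite -k0 paddr_eq0 ?sqr_ge0 ?mulr_ge0 ?dot_ge0 ?(ltW a0) //.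
      by rewrite sqrf_eq0 mulf_eq0 (gt_eqF a0) dot_eq0 /= => /andP[/eqP -> /eqP ->].
    rewrite !ch; congr stereo.
      apply: (@constant_on_interval R setT) => // r _.
      by have [d _ _ _] := gd r; have [<- _] := zero r.
    apply: (@constant_on_interval_row R setT) => // r _.
    by have [_ d _ _] := gd r; have [_ <-] := zero r.
  pose om := Num.sqrt (a / kap).
  have om0 : 0 < om by rewrite sqrtr_gt0 divr_gt0.
  have gY' := great_circle_rescale om gY.
  rewrite sqr_sqrtr ?divfK ?gt_eqF // in gY'; last by rewrite ltW // divr_gt0.
  have [r lt1] : exists r, y0 (om * r) < 1.
    apply: contrapT => no; apply: cst.
    have one r : y0 r = 1.
      apply/eqP; rewrite eq_le; apply/andP; split.
        by have [_ /(_ r) [e _ _]] := gY; rewrite -[X in X <= _]mul1r (ellipsoid_le1 hE affine e).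
      rewrite leNgt; apply/negP => lt1; apply: no; exists (om^-1 * r).
      by rewrite mulrA divff ?mul1r // gt_eqF.
    by rewrite !ch /stereo !one eqxx.
  have [S wS Sr] := window_exists hE gY' lt1.
  have [T [_ dT]] := time_exists gamma gY' r 0.
  have [tau [q [w [maxq en tauK dtau state]]]] := kepler_orbit_of_circle hgamma hE gY' wS dT Sr.
  exists (T @` S), q, w; split=> //; split.
    rewrite (hodograph_of_circle gY' wS (ex_intro _ r Sr) state).
    apply/seteqP; split=> _ [x _ <-].
      by exists (om * x); rewrite ?ch.
    by exists (om^-1 * x) => //; rewrite mulrA divff ?mul1r ?ch // gt_eqF.
  exists (fun t' => om * tau t') => _ [x Sx <-].
  have rate0 : 0 < time_rate gamma E (y0 (om * x)).
    exact/(time_rate_gt0 hgamma hE)/(window_lt1 hE gY' wS Sx).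
  have d := derM (der_cst (T x) 1 om) (dtau x Sx).
  split; first by case: d.
    by rewrite (derive1_der d) mul0r add0r mulr_gt0 // invr_gt0.
  by rewrite tauK // ch -(circle_pi gY' wS state Sx).
- move=> I q v maxq en.
  have [y0 [v0 [y [w [S [T [sig [gc [wS S0] II state sigP]]]]]]]] :=
    maximal_orbit_is_circle maxq en.
  exists (fun s => stereo E (y0 s) (y s)).
    split; first exact: (great_circle_geodesic hE gc).
    exact: (circle_nonconstant a0 gc).
  split; first by rewrite II (hodograph_of_circle gc wS S0 state).
  exists sig => t It; have [Ss Ts d] := sigP t It; split.
  + by case: d.
  + by rewrite (derive1_der d); have [orb _] := maxq; exact: (arc_rate_gt0 hgamma hE orb en It).
  + by rewrite (circle_pi gc wS state Ss) Ts.
Qed.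

End KeplerGeodesics.

(** * Uniqueness of the metric *)

Section QuadraticForms.
Variables (R : realType) (n : nat).

Lemma symmetric_form_determined (A B : 'M[R]_n) : A^T = A -> B^T = B ->
  (forall u : 'rV[R]_n, u != 0 -> (u *m A *m u^T) 0 0 = (u *m B *m u^T) 0 0) -> A = B.
Proof.
move=> sA sB h; have {}h (u : 'rV[R]_n) : (u *m A *m u^T) 0 0 = (u *m B *m u^T) 0 0.
  by have [->|u0] := eqVneq u 0; [rewrite !mul0mx|exact: h].
have ent (M : 'M[R]_n) i j : ((delta_mx 0 i : 'rV_n) *m M *m (delta_mx 0 j : 'rV_n)^T) 0 0 = M i j.
  by rewrite -rowE trmx_delta -colE !mxE.
have pol (M : 'M[R]_n) i j : let w := delta_mx 0 i + delta_mx 0 j : 'rV[R]_n in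
    (w *m M *m w^T) 0 0 = M i i + M i j + M j i + M j j.
  rewrite /= linearD /= !mulmxDr !mulmxDl.
  have e (x y : 'M[R]_1) : (x + y) 0 0 = x 0 0 + y 0 0 by rewrite mxE.
  rewrite !e !ent; ring.
have sym (M : 'M[R]_n) : M^T = M -> forall i j, M j i = M i j.
  by move=> sM i j; rewrite -[in LHS]sM mxE.
apply/matrixP => i j; have := h (delta_mx 0 i + delta_mx 0 j).
have := h (delta_mx 0 i); have := h (delta_mx 0 j); rewrite !ent !pol.
rewrite (sym A sA) (sym B sB); lra.
Qed.

End QuadraticForms.

Section Uniqueness.
Variables (R : realType) (gamma E : R).
Hypotheses (hgamma : 0 < gamma) (hE : E < 0).
Local Notation a := (curv E).
Let a0 : 0 < a := curv_gt0 hE.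
Let a1 : a != 0. Proof. by rewrite gt_eqF. Qed.

Lemma continuous_sum_at n (F : 'I_n -> R -> R) (t : R) :
  (forall i, {for t, continuous (F i)}) -> {for t, continuous (fun s => \sum_i F i s)}.
Proof.
move=> cF; apply: (cvg_big (op := +%R)) => [|i _]; last exact: cF.
exact: add_continuous.
Qed.

Lemma continuous_inner (G : 'rV[R]_3 -> 'M[R]_3) (p d : R -> 'rV[R]_3) (t : R) :
  {for p t, continuous G} -> {for t, continuous p} -> {for t, continuous d} ->
  {for t, continuous (fun s => inner G (p s) (d s) (d s))}.
Proof.
move=> cG cp cd.
have -> : (fun s => inner G (p s) (d s) (d s)) =
    (fun s => \sum_j (\sum_i d s 0 i * G (p s) i j) * d s 0 j).
  apply/funext => s; rewrite /inner mxE; apply: eq_bigr => j _.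
  by rewrite mxE; congr (_ * _); rewrite mxE.
have cdi i : {for t, continuous (fun s => d s 0 i)}.
  exact: (continuous_comp cd (@coord_continuous _ _ _ 0 i _)).
have cGp : {for t, continuous (fun s => G (p s))} by exact: (continuous_comp cp cG).
have cGij i j : {for t, continuous (fun s => G (p s) i j)}.
  exact: (continuous_comp cGp (@coord_continuous _ _ _ i j _)).
apply: continuous_sum_at => j; apply: continuousM; last exact: cdi.
by apply: continuous_sum_at => i; apply: continuousM; [exact: cdi|exact: cGij].
Qed.

(** The vector [pi] moves along the spatial part of the position, so these orbits
    have hodographs through [p] with an arbitrary tangent [e]. *)
Lemma orbit_through (p e : 'rV[R]_3) : dot e e = 1 -> exists I q v,
  [/\ kepler_orbit gamma I q v, has_energy gamma E I q v, I 0,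
      pi_vec (q 0) (v 0) = p & exists2 c, c != 0 & vect (q 0) = c *: e].
Proof.
move=> ee.
have [Y0 [Y [hY lt1 hp]]] : exists Y0 Y,
    [/\ on_ellipsoid E Y0 Y, Y0 < 1 & stereo E Y0 Y = Some p].
  exists (height E (Some p)), (horizontal E (Some p)); split.
  - exact: height_on_ellipsoid.
  - rewrite /= ltr_pdivrMr ?norm_den_gt0 // mul1r; have := a0; lra.
  - exact: height_horizontalK.
have h0 : 1 - Y0 != 0 by rewrite gt_eqF // subr_gt0.
have YY : dot Y Y = (1 - Y0 ^+ 2) / a by rewrite -hY; field.
(* the unit tangent vector whose Kepler direction is [- e] *)
pose V0 := a * dot Y e; pose V := e - (a * dot Y e / (1 - Y0)) *: Y.
have e1 : Y0 * V0 + a * dot Y V = 0.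
  by rewrite /V0 /V !dotE YY; field; rewrite a1 h0.
have e2 : V0 ^+ 2 + a * dot V V = a.
  rewrite /V0 /V !dotE YY ee (dotC e).
  by field; rewrite a1 h0.
have := great_circle_exists hE 0 hY e1; rewrite e2.
move=> [y0 [v0 [y [v [gc [i1 i2 i3 i4]]]]]].
have lt0 : y0 0 < 1 by rewrite i1.
have [S wS S0] := window_exists hE gc lt0.
have [T [T0 dT]] := time_exists gamma gc 0 0.
have [tau [q [w [[orb _] en _ _ state]]]] := kepler_orbit_of_circle hgamma hE gc wS dT S0.
exists (T @` S), q, w; split=> //; first by exists 0.
  have := circle_pi hE gc wS state S0; rewrite T0 i1 i3.
  by rewrite hp => -[].
have [qE _] := state 0 S0; rewrite T0 i1 i2 i3 i4 in qE.
exists (- kepler_sin gamma E Y0); first by rewrite oppr_eq0 gt_eqF // kepler_sin_gt0.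
rewrite qE vect_vec4 /kepler_dir /V /V0 subrK scalerN scaleNr.
by [].
Qed.

Variable (g' : local_metrics R).
Hypotheses (rg' : riemannian_metric E g') (ag' : arclength_is_kepler_time E gamma g').
Local Notation g := (spherical_metric E).

Let all_affine p : chart_image E affine p.
Proof.
exists (Some p) => //; split=> //; rewrite /MEplus /=.
by rewrite (lt_le_trans _ (dot_ge0 _)) // pmulr_rlt0 // ltr0n.
Qed.

Let all_inverted p : chart_image E inverted p.
Proof.
have [->|p0] := eqVneq p 0; first by exists None.
exists (Some (inversion p)); last by rewrite /= inversionK.
split; rewrite /MEplus /=.
  by rewrite (lt_le_trans _ (dot_ge0 _)) // pmulr_rlt0 // ltr0n.
by move=> [] /eqP; rewrite (negPf (inversion_neq0 p0)).
Qed.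

(** The two lengths agree over all time intervals, hence so do the integrands at
    the time when [pi] passes through [p] with velocity along [e]. *)
Lemma affine_unit_determined p e : dot e e = 1 ->
  inner (g' affine) p e e = inner (g affine) p e e.
Proof.
move=> ee; have [I [q [v [orb en I0 p0 [c c0 qe]]]]] := orbit_through p ee.
have [oI iI _ ps] := orb; have [cg' _ posg' _] := rg'.
pose P t := pi_vec (q t) (v t).
pose f G t := Num.sqrt (inner G (P t) (derive1 P t) (derive1 P t)).
have dP t : I t -> is_derive t 1 P (- (gamma / polar_sin (q t) ^+ 3) *: vect (q t)).
  by move=> It; exact: (der_pi orb It).
have cdP t : I t -> {for t, continuous (derive1 P)}.
  move=> It; have [pst dq _] := ps t It.
  have [_ r0 _ _] := energy_pi hgamma hE pst (en t It).
  have dr := der_polar_sin hgamma hE orb en It.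
  have r1 : polar_sin (q t) * (polar_sin (q t) * polar_sin (q t)) != 0 by rewrite !mulf_neq0 // gt_eqF.
  have /der_vec4P[_ dv] := dq.
  have d := derZv (derN (derM (der_cst t 1 gamma) (derV (f := fun s =>
    polar_sin (q s) * (polar_sin (q s) * polar_sin (q s))) r1 (derM dr (derM dr dr))))) dv.
  apply: der_cvg (der_near _ d).
  have nI : \forall s \near t, I s by move: oI; rewrite openE; exact.
  apply: filterS nI => s Is; rewrite (derive1_der (dP s Is)).
  by rewrite exprS expr2.
have cf G t : I t -> (forall p, {for p, continuous G}) -> {for t, continuous (f G)}.
  move=> It cG.
  apply: (@continuous_comp _ _ _ (fun t => inner G (P t) (derive1 P t) (derive1 P t)) Num.sqrt).
    apply: continuous_inner; first exact: cG.
      exact: der_cvg (dP t It).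
    exact: cdP.
  exact: sqrt_continuous.
have ff : f (g' affine) 0 = f (g affine) 0.
  apply: (integrals_determine oI) I0 => [t It|t It|t1 t2 I1 I2 t12].
  - by apply: cf => // x; exact: cg'.
  - by apply: cf => // x; exact: conf_metric_continuous (chart_al_gt0 hE _) (chart_be_gt0 hE _) x.
  - rewrite (ag' orb en I1 I2 t12).
    by rewrite (spherical_metric_arclength hgamma hE orb en I1 I2 t12).
have [pst _ _] := ps 0 I0; have [_ r0 _ _] := energy_pi hgamma hE pst (en 0 I0).
pose k := - (gamma / polar_sin (q 0) ^+ 3) * c.
have k0 : k != 0.
  by rewrite mulf_neq0 // oppr_eq0 mulf_neq0 ?invr_neq0 ?expf_neq0 // gt_eqF.
have dP0 : derive1 P 0 = k *: e by rewrite (derive1_der (dP 0 I0)) qe scalerA.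
have scale G : inner G p (k *: e) (k *: e) = k ^+ 2 * inner G p e e.
  rewrite /inner linearZ /= -!scalemxAl -scalemxAr scalerA mxE expr2.
  by [].
have e0 : e != 0 by rewrite -dot_gt0 ee ltr01.
move: ff; rewrite /f dP0 /P p0 !scale => /(congr1 (fun x => x ^+ 2)).
rewrite !sqr_sqrtr.
- by move=> /mulfI; apply; rewrite expf_neq0.
- rewrite mulr_ge0 ?sqr_ge0 // conf_innerE mulr_ge0 ?dot_ge0 //.
  exact/ltW/(conf_factor_gt0 (chart_al_gt0 hE _) (chart_be_gt0 hE _)).
- by rewrite mulr_ge0 ?sqr_ge0 // ltW // posg'.
Qed.

Lemma affine_determined p : g' affine p = g affine p.
Proof.
have [_ sg' _ _] := rg'; have [_ sg _ _] := spherical_metric_riemannian hE.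
apply: symmetric_form_determined => [||u u0].
- exact: sg'.
- exact: sg.
have uu : 0 < dot u u by rewrite dot_gt0.
pose k := Num.sqrt (dot u u); have k0 : 0 < k by rewrite sqrtr_gt0.
have k1 : k != 0 by rewrite gt_eqF.
have kk : k ^+ 2 = dot u u by rewrite sqr_sqrtr // ltW.
have ee : dot (k^-1 *: u) (k^-1 *: u) = 1 by rewrite !dotE -kk; field.
have := affine_unit_determined p ee.
rewrite /inner linearZ /= -!scalemxAl -!scalemxAr !scalerA !mxE.
by move/mulfI; apply; rewrite mulf_neq0 // invr_neq0.
Qed.

(** The Jacobian of the inversion is invertible off the origin. *)
Lemma inverted_determined_off_pole w : w != 0 -> g' inverted w = g inverted w.
Proof.
move=> w0; have p0 := inversion_neq0 w0.
have [_ _ _ pb'] := rg'; have [_ _ _ pb] := spherical_metric_riemannian hE.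
have := affine_determined (inversion w).
rewrite (pb' _ (all_affine _) p0) (pb _ (all_affine _) p0) inversionK //.
set J := 'J _ _ => e; have JJ := jacobian_inversion_conformal p0; rewrite -/J in JJ.
have n0 : (dot (inversion w) (inversion w))^-1 ^+ 2 != 0.
  by rewrite expf_neq0 // invr_neq0 // dot_eq0.
have /andP[uJ uJT] : (J \in unitmx) && (J^T \in unitmx).
  rewrite -unitmx_mul JJ unitmxE det_scalar unitfE expf_neq0 //.
by apply: (can_inj (mulKmx uJ)); apply: (can_inj (mulmxK uJT)).
Qed.

Lemma metric_unique : metric_eq E g' g.
Proof.
case=> w _; first exact: affine_determined.
have [->|] := eqVneq w 0; last exact: inverted_determined_off_pole.
have [cg' _ _ _] := rg'; have [cg _ _ _] := spherical_metric_riemannian hE.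
pose l (t : R) : 'rV[R]_3 := t *: delta_mx 0 0.
have cl : {for 0, continuous l}.
  exact: der_cvg (derZv (der_id (0 : R)) (der_cstv (0 : R) 1 (delta_mx 0 0))).
apply/matrixP => i j.
have cij (G : 'rV[R]_3 -> 'M[R]_3) : {for 0, continuous G} ->
    {for 0, continuous (fun t => G (l t) i j)}.
  move=> cG; have cG' : {for l 0, continuous G} by rewrite /l scale0r.
  have cGl : {for 0, continuous (fun t => G (l t))} := continuous_comp cl cG'.
  exact: (continuous_comp cGl (@coord_continuous _ _ _ i j _)).
pose D t := g' inverted (l t) i j - g inverted (l t) i j.
have cD : {for 0, continuous D}.
  by apply: continuousB; apply: cij; [exact: cg'|exact: cg].
have D0 h : 0 < h < 1 -> D (0 + 1 * h) = 0.
  move=> /andP[h0 _]; rewrite /D inverted_determined_off_pole ?subrr //.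
  rewrite add0r mul1r /l scaler_eq0 gt_eqF //=; apply/eqP => /matrixP/(_ 0 0).
  by rewrite !mxE => /eqP; rewrite oner_eq0.
have l1 : D 0 <= 0 by apply: (nonpos_at_endpoint (e := 1) cD ltr01) => h /D0 ->.
have l2 : - D 0 <= 0.
  apply: (nonpos_at_endpoint (g := fun t => - D t) (e := 1) _ ltr01).
    exact: continuousN.
  by move=> h /D0 ->; rewrite oppr0.
have : D 0 = 0 by lra.
by rewrite /D /l scale0r => /eqP; rewrite subr_eq0 => /eqP.
Qed.

End Uniqueness.

Theorem theorem4p1 (R : realType) (gamma E : R)
    (hgamma : 0 < gamma) (hE : E < 0) :
  exists g : local_metrics R,
    [/\ riemannian_metric E g,
        arclength_is_kepler_time E gamma g,
        (forall g' : local_metrics R, riemannian_metric E g' ->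
           arclength_is_kepler_time E gamma g' -> metric_eq E g' g) &
        [/\ smooth_metric E g,
            complete_metric E g,
            constant_curvature E g (- (2 * E)) &
            geodesics_are_kepler_circles E gamma g]].
Proof.
exists (spherical_metric E); split.
- exact: spherical_metric_riemannian hE.
- exact: spherical_metric_arclength hgamma hE.
- by move=> g' rg' ag'; exact: (metric_unique hgamma hE rg' ag').
- split.
  + exact: spherical_metric_smooth hE.
  + exact: spherical_metric_complete hE.
  + exact: spherical_metric_curvature hE.
  + exact: spherical_geodesics_are_kepler_circles hgamma hE.
Qed.
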